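(* Let $S$ be a finite set of cardinality $n$ and let $M=(m_{st})_{s,t\in S}$ be a Coxeter matrix over $S$. Suppose that $m_{st}\ge 6\cdot 2^{n}$ for all $s\neq t\in S$. Then the Coxeter group $W(M)=\langle S\mid (st)^{m_{st}},\ s,t\in S\rangle$ satisfies $\operatorname{rank}(W(M))=n$.
   Context: A Coxeter matrix over $S$ is a symmetric matrix $M=(m_{st})_{s,t\in S}$ with $m_{ss}=1$ for all $s\in S$ and $m_{st}\in\{2,3,4,\dots\}\cup\{\infty\}$ for $s\ne t$. In the presentation of $W(M)$ there is no relation for a pair $s,t$ with $m_{st}=\infty$ (and $\infty$ is larger than every integer). The rank of a group $G$ is the smallest cardinality of a generating set of $G$. *)

(* Defs.v *)
From HB Require Import structures.
From mathcomp Require Import all_boot generic_quotient.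
From mathcomp Require Import boolp classical_sets functions cardinality.

Set Implicit Arguments.
Unset Strict Implicit.
Unset Printing Implicit Defensive.

Local Open Scope classical_set_scope.

Section Presentation.
Variable X : choiceType.

(* (x, true) is the letter x and (x, false) is the formal inverse of x. *)
Definition word := seq (X * bool).

Definition inv_word (w : word) : word := rev [seq (l.1, ~~ l.2) | l <- w].

Variable R : set word.

(* Equality of words modulo free cancellation and the relators r = 1, r in R. *)
Inductive pres_eq : word -> word -> Prop :=
| pres_refl w : pres_eq w w
| pres_sym u v : pres_eq u v -> pres_eq v u
| pres_trans u v w : pres_eq u v -> pres_eq v w -> pres_eq u w
| pres_cat u u' v v' :
    pres_eq u u' -> pres_eq v v' -> pres_eq (u ++ v) (u' ++ v')
| pres_cancel x b : pres_eq [:: (x, b); (x, ~~ b)] [::]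
| pres_relator r : R r -> pres_eq r [::].

Definition pres_eqb : rel word := fun u v => `[< pres_eq u v >].

Lemma pres_eqb_refl : reflexive pres_eqb.
Proof. by move=> w; apply/asboolP/pres_refl. Qed.

Lemma pres_eqb_sym : symmetric pres_eqb.
Proof. by move=> u v; apply/asboolP/asboolP; apply: pres_sym. Qed.

Lemma pres_eqb_trans : transitive pres_eqb.
Proof.
move=> v u w /asboolP uv /asboolP vw; apply/asboolP.
exact: pres_trans uv vw.
Qed.

Canonical pres_equiv := EquivRel pres_eqb pres_eqb_refl pres_eqb_sym
  pres_eqb_trans.

Definition pres_group : Type := {eq_quot pres_equiv}%qT.

HB.instance Definition _ := Choice.on pres_group.
HB.instance Definition _ := EqQuotient.on pres_group.

Definition pres_class (w : word) : pres_group := (\pi_pres_group w)%qT.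

Definition pres_one : pres_group := pres_class [::].
Definition pres_mul (g h : pres_group) : pres_group :=
  pres_class (repr g ++ repr h).
Definition pres_inv (g : pres_group) : pres_group :=
  pres_class (inv_word (repr g)).

Lemma pres_classP u v : pres_class u = pres_class v <-> pres_eq u v.
Proof.
by split=> [/eqmodP/asboolP //|uv]; apply/eqmodP/asboolP.
Qed.

Lemma pres_reprK g : pres_class (repr g) = g.
Proof. exact: reprK. Qed.

Lemma pres_repr w : pres_eq (repr (pres_class w)) w.
Proof. by apply/pres_classP; rewrite pres_reprK. Qed.

Lemma inv_word_cat u v : inv_word (u ++ v) = inv_word v ++ inv_word u.
Proof. by rewrite /inv_word map_cat rev_cat. Qed.

Lemma inv_wordK : involutive inv_word.
Proof.
move=> w; rewrite /inv_word map_rev revK -map_comp.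
by rewrite -[RHS]map_id; apply: eq_map => -[x b] /=; rewrite negbK.
Qed.

Lemma pres_mulwV w : pres_eq (w ++ inv_word w) [::].
Proof.
elim: w => [|[x b] w IHw]; first exact: pres_refl.
rewrite -cat1s inv_word_cat -catA (catA w).
apply: pres_trans (pres_cancel x b).
apply: (pres_cat (pres_refl [:: (x, b)])).
exact: (pres_cat IHw (pres_refl [:: (x, ~~ b)])).
Qed.

Lemma pres_mulVw w : pres_eq (inv_word w ++ w) [::].
Proof. by have := pres_mulwV (inv_word w); rewrite inv_wordK. Qed.

Lemma pres_mulA : associative pres_mul.
Proof.
move=> f g h; apply/pres_classP.
apply: pres_trans (pres_cat (pres_refl _) (pres_repr _)) _.
rewrite catA; apply: pres_cat (pres_refl _).
exact/pres_sym/pres_repr.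
Qed.

Lemma pres_mul1 : left_id pres_one pres_mul.
Proof.
move=> g; rewrite -[RHS]pres_reprK; apply/pres_classP.
exact: (pres_cat (pres_repr [::]) (pres_refl _)).
Qed.

Lemma pres_mulr1 : right_id pres_one pres_mul.
Proof.
move=> g; rewrite -[RHS]pres_reprK; apply/pres_classP.
rewrite -[X in pres_eq _ X]cats0.
exact: (pres_cat (pres_refl _) (pres_repr [::])).
Qed.

Lemma pres_mulV : left_inverse pres_one pres_inv pres_mul.
Proof.
move=> g; apply/pres_classP; apply: pres_trans (pres_mulVw (repr g)).
exact: (pres_cat (pres_repr _) (pres_refl _)).
Qed.

Lemma pres_mulrV : right_inverse pres_one pres_inv pres_mul.
Proof.
move=> g; apply/pres_classP; apply: pres_trans (pres_mulwV (repr g)).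
exact: (pres_cat (pres_refl _) (pres_repr _)).
Qed.

HB.instance Definition _ := isGroup.Build pres_group
  pres_mulA pres_mul1 pres_mulr1 pres_mulV pres_mulrV.

End Presentation.

Section Rank.
Variable G : groupType.
Local Open Scope group_scope.

Definition is_subgroup (H : set G) : Prop :=
  [/\ H 1, forall x y, H x -> H y -> H (x * y) & forall x, H x -> H x^-1].

Definition generates (A : set G) : Prop := smallest is_subgroup A = setT.

(* The smallest cardinality of a generating set of G is the natural number n;
   infinite generating sets also take part in the comparison. *)
Definition has_rank (n : nat) : Prop :=
  (exists2 A : set G, generates A & (A #= `I_n)%card) /\
  (forall A : set G, generates A -> (`I_n #<= A)%card).

End Rank.

Section Coxeter.
Variable S : finType.

(* The entry None stands for infinity. *)
Implicit Type M : S -> S -> option nat.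

Definition entry_ge (m : option nat) (k : nat) : bool :=
  if m is Some m' then k <= m' else true.

Definition is_coxeter_matrix M : Prop :=
  [/\ forall s, M s s = Some 1,
      forall s t, M s t = M t s &
      forall s t, s != t -> entry_ge (M s t) 2].

(* The case s = t is included and gives the relator s s. *)
Definition coxeter_relators M : set (word S) :=
  [set r | exists s t m, M s t = Some m /\
     r = flatten (nseq m [:: (s, true); (t, true)])].

Definition coxeter_group M : groupType := pres_group (coxeter_relators M).

End Coxeter.

(* Main.v *)
(* Suppose that k < n elements generate W.  Consider finite graphs with edges
   labelled by S such that every equivariant map from the graph to a W-set sends
   each vertex to a point fixed by W; the subdivided rose of k words
   representing the generators is one, with |E| + 1 <= |V| + k.  Choose such a
   graph with |E| + |non-loop edges| minimal.  Identifying vertices, pruning, and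
   replacing an arc of four edges by three new ones all keep the property, so in
   a minimal graph each {s,t}-segment is short compared to m(s,t).  The only
   exception is a segment with a loop at one end: there a new loop can be placed
   half-way, at the price of one edge and of remembering a constraint whose
   length is m(s,t) divided by a power of two; this can be repeated at most k
   times, whence the bound 6 * 2^n.  A graph all of whose segments are short
   embeds into a W-set obtained by completing the dihedral orbits again and
   again, and there a generator whose edge is missing at a vertex moves that
   vertex.  Hence no edge is missing, the graph is itself a W-set, so all its
   edges are loops and |E| >= n |V|, which contradicts |E| + 1 <= |V| + k. *)

Require Import Defs.
From mathcomp Require Import all_boot.
From mathcomp Require Import zify boolp classical_sets functions cardinality.

Set Implicit Arguments.
Unset Strict Implicit.
Unset Printing Implicit Defensive.

(** * Alternating words *)

(** An arc can be replaced only where four consecutive edges meet no branching, and such arcs come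
    from a degree count. In a minimal graph a vertex without loop has at least two non-loop edges,
    so at most [2 * (nlc - V0)] vertices branch or join a loop to other edges. Validity keeps
    [nlc - V0 < k], which holds for the rose, so an alternating path of about [8 * k] edges without
    repetition contains a good arc. On a segment with a loop at one end the relation passes over
    each edge twice, so edges deleted there cannot be recovered from it; this forces the halving. A
    constraint of length [2 * m / 2^i] is kept only while [nlc - V0 <= k - i]: the shorter it is,
    the fewer vertices branch, and about [8 * (k - i)] edges suffice. Its length is at least
    [24 * 2^(k - i)], which leaves room for the arc. Constraints are assumed of the maps considered,
    so the completion must satisfy them too. Hence a gap may join the ends of two different
    segments, and the first round of the completion takes a prescribed pairing of the open ends. *)

Section Alternating.
(** Letters are counted from 0: after i steps of a walk begun with a, the next letter forward is
    [lt_ a b i] and the first letter back is [lt_ b a i]. *)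
Definition lt_ (A : Type) (a b : A) (i : nat) := if odd i then b else a.

Lemma ltS (A : Type) (a b : A) i : lt_ a b i.+1 = lt_ b a i.
Proof. by rewrite /lt_ /=; case: odd. Qed.

Lemma lt_case (A : Type) (a b : A) i : (lt_ a b i = a /\ lt_ b a i = b) \/ (lt_ a b i = b /\ lt_ b a i = a).
Proof. by rewrite /lt_; case: odd; auto. Qed.

Lemma lt_lt (A : Type) (a b : A) i : lt_ (lt_ a b i) (lt_ b a i) i = a.
Proof. by rewrite /lt_; case: odd. Qed.
End Alternating.

Section Alt.
Variables (S T : Type) (act : S -> T -> T).
Fixpoint alt a b i x := if i is i'.+1 then alt b a i' (act a x) else x.

Lemma altS a b i x : alt a b i.+1 x = act (lt_ a b i) (alt a b i x).
Proof.
elim: i a b x => [|i IH] a b x //.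
by rewrite -[LHS]/(alt b a i.+1 (act a x)) IH ltS.
Qed.

Lemma altD a b i j x :
  alt a b (i + j) x = alt (lt_ a b i) (lt_ b a i) j (alt a b i x).
Proof.
elim: i a b x => [|i IH] a b x //.
by rewrite addSn /= IH !ltS.
Qed.

Hypothesis actK : forall s, involutive (act s).

Lemma alt_back a b i j x : j <= i ->
  alt (lt_ b a i) (lt_ a b i) j (alt a b i x) = alt a b (i - j) x.
Proof.
elim: j i => [|j IH] [|i] // ji.
by rewrite subSS -IH // (altS a b i) !ltS /= actK.
Qed.

(** A letter that acts trivially turns the walk round; this is how a walk behaves at the end of a
    segment. *)
Lemma alt_bounce a b i j x : act (lt_ a b i) (alt a b i x) = alt a b i x -> j <= i ->
  alt a b (i.+1 + j) x = alt a b (i - j) x.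
Proof. by move=> h ji; rewrite altD altS h !ltS alt_back. Qed.

Lemma alt_fix a b i x : act a x = x -> act b x = x -> alt a b i x = x.
Proof. by elim: i a b => //= i IH a b ha hb; rewrite ha IH. Qed.

Definition per c d M x := alt c d (2 * M) x = x.

Lemma odd2 M : odd (2 * M) = false. Proof. by rewrite oddM. Qed.

Lemma per_sym c d M x : per c d M x -> per d c M x.
Proof.
move=> h; have := @alt_back c d (2 * M) (2 * M) x (leqnn _).
by rewrite /lt_ odd2 subnn h.
Qed.

Lemma per_act c d M x : per c d M x -> per d c M (act c x).
Proof.
move=> h; rewrite /per -[LHS]/(alt c d (2 * M).+1 x) altS h.
by rewrite /lt_ odd2.
Qed.

Lemma per_alt c d M i x : per c d M x -> per c d M (alt c d i x).
Proof.
elim: i c d x => [|i IH] c d x //= h.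
by apply/per_sym/IH/per_act.
Qed.

Lemma per_mul c d M N x : per c d M x -> per c d (N * M) x.
Proof.
move=> h; elim: N => [|N IH]; first by rewrite /per mul0n.
rewrite /per (mulSn N) mulnDr altD h /lt_ odd2; exact: IH.
Qed.

Lemma per_dvd c d T0 M x : alt c d T0 x = x -> odd T0 = false -> T0 %| 2 * M -> per c d M x.
Proof.
move=> h oT /dvdnP [q hq].
have e : T0 = 2 * T0./2 by have := odd_double_half T0; rewrite oT -mul2n; lia.
rewrite e in h; rewrite /per hq e -mulnCA; exact: (@per_mul c d T0./2 q x h).
Qed.
End Alt.

Section Walks.
Variables (S Y : Type) (act : S -> Y -> Y).
Hypothesis aK : forall s, involutive (act s).

Lemma walk_up c d (F : nat -> Y) N :
  (forall j, j < N -> F j.+1 = act (lt_ c d j) (F j)) -> F N = alt act c d N (F 0).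
Proof.
elim: N => // N IH h; rewrite altS -IH; last by move=> j jN; apply: h; exact: ltnW.
exact: h.
Qed.

Lemma walk_down c d (F : nat -> Y) N L y : F L = alt act c d L y -> N <= L ->
  (forall j, N <= j < L -> F j.+1 = act (lt_ c d j) (F j)) -> F N = alt act c d N y.
Proof.
elim: L => [|L IH] e; first by case: N.
rewrite leq_eqVlt => /orP[/eqP-> //|NL] h; rewrite ltnS in NL; apply: IH => //.
  by apply: (inv_inj (aK (lt_ c d L))); rewrite -altS -e h // ltnSn andbT.
by move=> j /andP[h1 h2]; apply: h; rewrite h1 ltnW.
Qed.

Lemma alt_inj c d N : injective (alt act c d N).
Proof. by elim: N c d => [|N IH] c d x y //= /IH /(inv_inj (aK c)). Qed.
End Walks.

(** * Orbits of two involutions that are paths *)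

Section Reflections.
Variables (S : Type) (T : eqType) (io : S -> T -> T).
Hypothesis ioK : forall s, involutive (io s).

Definition refl_at a b i v := io (lt_ a b i) (alt io a b i v) = alt io a b i v.

(** For an odd difference the letter that leaves the first vertex is the letter that entered the
    second, so the collision moves inwards until two consecutive vertices agree. *)
Lemma collision_odd a b i j v : i < j -> odd (j - i) -> alt io a b i v = alt io a b j v ->
  exists2 r, i <= r < j & refl_at a b r v.
Proof.
move: {2}(j - i) (leqnn (j - i)) => d; elim: d i j => [|d IH] i j hd ij od e; first by lia.
case: (eqVneq j i.+1) => [ji|ji].
  by exists i; [lia|rewrite /refl_at -altS -ji -e].
have [r hr h] : exists2 r, i.+1 <= r < j.-1 & refl_at a b r v.
  apply: IH; [by lia|by lia| |].
    by move: od; rewrite !oddB /=; try lia; case: j ij {hd e ji} => //= j _; case: odd; case: odd.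
  rewrite altS e; have -> : j = j.-1.+1 by lia.
  rewrite altS /=.
  have -> : lt_ a b i = lt_ a b j.-1.
    rewrite /lt_; suff -> : odd j.-1 = odd i by [].
    by move: od; rewrite oddB; [|lia]; case: j ij {hd e ji} => //= j _; case: odd; case: odd.
  by rewrite ioK.
by exists r => //; lia.
Qed.

(** For an even difference both vertices were entered by the same letter, so the collision can be
    moved back to the start. *)
Lemma collision_even a b i j v : i <= j -> ~~ odd (j - i) -> alt io a b i v = alt io a b j v ->
  v = alt io a b (j - i) v.
Proof.
elim: i j => [|i IH] j ij od e; first by rewrite subn0.
case: j ij od e => // j ij od e; rewrite subSS; apply: IH => //.
move: e; rewrite !altS; have -> : lt_ a b i = lt_ a b j.
  rewrite /lt_; suff -> : odd j = odd i by [].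
  by move: od; rewrite subSS oddB //; case: odd; case: odd.
exact: (inv_inj (ioK _)).
Qed.

(** An odd collision contains a reflection. An even one moves to the start v; its last letter is b,
    which fixes v, so the step into v is itself a reflection. *)
Lemma seg_distinct a b v i0 : io b v = v -> (forall r, r < i0 -> ~ refl_at a b r v) ->
  forall i j, i < j <= i0 -> alt io a b i v <> alt io a b j v.
Proof.
move=> hv no i j /andP[ij j0] e; case: (boolP (odd (j - i))) => od.
  by have [r /andP[_ rj] h] := collision_odd ij od e; apply: (no r) => //; lia.
have e0 := collision_even (ltnW ij) od e.
have E : j - i = (j - i).-1.+1 by lia.
apply: (no (j - i).-1); first by lia.
rewrite /refl_at -altS -E -e0; rewrite {1}E altS in e0.
have lb : lt_ a b (j - i).-1 = b.
  by rewrite /lt_; have -> : odd (j - i).-1 by move: od; rewrite {1}E /= negbK.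
by rewrite lb in e0; rewrite -{1}hv {1}e0 ioK.
Qed.

Lemma pigeon (W : seq T) a b v : (forall i, alt io a b i v \in W) ->
  exists i j, i < j /\ alt io a b i v = alt io a b j v.
Proof.
move=> h; set z := fun i => alt io a b i v.
have : ~~ uniq (mkseq z (size W).+1).
  apply/negP => u; have := uniq_leq_size u (s2 := W).
  rewrite size_mkseq ltnn => /(_ _)/negP; apply=> //.
  by move=> x /mapP[i _ ->]; exact: h.
case/(uniqPn (z 0)) => i [j [ij]]; rewrite size_mkseq => js.
rewrite !nth_mkseq //; last by lia.
by move=> e; exists i, j.
Qed.

Lemma first_refl (W : seq T) a b v : (forall i, alt io a b i v \in W) -> io b v = v ->
  exists2 i0, refl_at a b i0 v & forall r, r < i0 -> ~ refl_at a b r v.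
Proof.
move=> hW hv.
suff [r hr] : exists r, refl_at a b r v.
  have ex : exists r, `[< refl_at a b r v >] by exists r; apply/asboolP.
  case: (ex_minnP ex) => i /asboolP hi imin; exists i => // j ji /asboolP /imin; lia.
apply: contrapT => no; have [i [j [ij e]]] := pigeon hW.
by apply: (@seg_distinct a b v j hv _ i j) => // [r _ h|]; [apply: no; exists r|lia].
Qed.
End Reflections.

Section FirstReflection.
Variables (S T : eqType) (io : S -> T -> T).
Hypothesis ioK : forall s, involutive (io s).

(** The {a,b}-orbit of v is then a path with i edges and extremity v. At either extremity the
    trivial letter may be a loop or a missing edge; [io] does not tell them apart. *)
Definition fst_at a b i v :=
  [/\ io b v = v, refl_at io a b i v & forall r, r < i -> ~ refl_at io a b r v].

Lemma fst_rev a b i v : fst_at a b i v ->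
  [/\ fst_at (lt_ b a i) (lt_ a b i) i (alt io a b i v),
      alt io (lt_ b a i) (lt_ a b i) i (alt io a b i v) = v,
      lt_ (lt_ b a i) (lt_ a b i) i = b & lt_ (lt_ a b i) (lt_ b a i) i = a].
Proof.
move=> [bv ri fst]; have e : alt io (lt_ b a i) (lt_ a b i) i (alt io a b i v) = v.
  by rewrite alt_back // subnn.
split; rewrite ?lt_lt //; split; rewrite /refl_at ?lt_lt ?e // => r rI.
rewrite alt_back ?(ltnW rI) // => h; apply: (fst (i - r).-1); first by lia.
have E : i - r = (i - r).-1.+1 by lia.
have L : lt_ (lt_ b a i) (lt_ a b i) r = lt_ a b (i - r).-1.
  have := @oddB i r (ltnW rI); rewrite E /= /lt_.
  by case: (odd i); case: (odd r); case: odd.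
have s : alt io a b (i - r) v = io (lt_ a b (i - r).-1) (alt io a b (i - r).-1 v) by rewrite -altS -E.
by move: h; rewrite L s ioK => h; exact/esym.
Qed.

Lemma fst_uniq a b i j v : fst_at a b i v -> fst_at a b j v -> i = j.
Proof.
move=> [_ ri fi] [_ rj fj]; case: (ltngtP i j) => // h; [case: (fj i)|case: (fi j)] => //.
Qed.

Lemma fst_dis a b i v : fst_at a b i v ->
  forall j r, j < r <= i -> alt io a b j v <> alt io a b r v.
Proof. by move=> [bv ri fst]; exact: seg_distinct. Qed.

Lemma fst_closed a b i v j c : fst_at a b i v -> j <= i -> c = a \/ c = b ->
  exists2 j', j' <= i & io c (alt io a b j v) = alt io a b j' v.
Proof.
move=> [bv ri fst] ji hc.
have : c = lt_ a b j \/ c = lt_ b a j by rewrite /lt_; case: odd; case: hc; auto.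
case=> ->.
  move: ji; rewrite leq_eqVlt => /orP[/eqP->|ji]; first by exists i.
  by exists j.+1; rewrite ?altS.
case: j ji {hc} => [|j] ji; first by exists 0.
by exists j; rewrite ?(ltnW ji) // altS ltS ioK.
Qed.

Lemma fst_closed_alt a b i v j c d N : fst_at a b i v -> j <= i ->
  c = a \/ c = b -> d = a \/ d = b ->
  exists2 j', j' <= i & alt io c d N (alt io a b j v) = alt io a b j' v.
Proof.
move=> fv; elim: N c d j => [|N IH] c d j ji hc hd; first by exists j.
by have [j' h1 /= ->] := fst_closed fv ji hc; exact: IH.
Qed.
End FirstReflection.

(** * Completing a partial action *)

Section OpenEnds.
Variables (S : eqType) (m : S -> S -> nat).
Variables (V : Type) (io : S -> V -> V) (ms : S -> V -> bool).

(* A partial action is encoded by total involutions [io s] together with the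
   predicate [ms s v] ("the edge s is missing at v"), in which case [io s v = v].
   An open end (u, a, b) is a vertex u where a is missing, seen as an end of the
   {a, b}-orbit of u. *)
Definition opend := (V * S * S)%type.
Implicit Type e : opend.
Definition is_end e := (e.1.2 != e.2) && ms e.1.2 e.1.1.
(** The walk from an end begins with [e.2], since [e.1.2] is missing there. If it meets a loop it
    turns round and comes back, so the other end may be e itself. *)
Definition oth_end e N : opend :=
  (alt io e.2 e.1.2 N e.1.1, lt_ e.2 e.1.2 N, lt_ e.1.2 e.2 N).
Definition stuck_at e N :=
  (forall i, i < N -> ~~ ms (lt_ e.2 e.1.2 i) (alt io e.2 e.1.2 i e.1.1))
  /\ ms (lt_ e.2 e.1.2 N) (alt io e.2 e.1.2 N e.1.1).
Definition closed_pg := forall v s t, s != t ->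
  (forall i, ~~ ms (lt_ s t i) (alt io s t i v)) -> per io s t (m s t) v.
(** The bounds are those that [3 <= m] can absorb: completing the orbit to 2m steps leaves
    [2 * m - (N + 1)] new vertices, an even number at least 2 if the end is joined to itself, and at
    least 3 otherwise. *)
Definition short_pg := forall e, is_end e -> exists N,
  [/\ stuck_at e N, N <= 3, oth_end e N = e -> odd N & oth_end e N <> e -> N <= 2].
End OpenEnds.

(** * One round of completion *)

Section Round.
Variables (S : eqType) (m : S -> S -> nat).
Hypothesis msym : forall s t, m s t = m t s.
Variables (V : Type) (io : S -> V -> V) (ms : S -> V -> bool).
Local Notation opend := (opend S V).
Local Notation isend := (is_end ms).
Local Notation oth := (oth_end io).
Local Notation stuck := (stuck_at io ms).
Implicit Type e : opend.

Hypothesis ioK : forall s, involutive (io s).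
Hypothesis ms_fix : forall s v, ms s v -> io s v = v.

Lemma ms_io s v : ms s (io s v) = ms s v.
Proof.
apply/idP/idP => h; last by rewrite ms_fix.
by have := ms_fix h; rewrite ioK => e; rewrite e.
Qed.

(** The end e is joined to [pt e] by a path with [g e] new vertices, hence [g e + 1] edges. If
    [pt e = e] the path is folded in the middle, where a loop results; this is why g is even there.
    By [closing] the orbit closes up after one or two segments with their gaps. *)
Variables (pt : opend -> opend) (g : opend -> nat).
Hypothesis pt_end : forall e, isend e -> isend (pt e).
Hypothesis ptK : forall e, isend e -> pt (pt e) = e.
Hypothesis g_pt : forall e, isend e -> g (pt e) = g e.
Hypothesis g_self : forall e, isend e -> pt e = e -> ~~ odd (g e) /\ 2 <= g e.
Hypothesis g_ne : forall e, isend e -> pt e <> e -> 3 <= g e.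
Hypothesis pt_a : forall e, isend e -> (pt e).1.2 = lt_ e.1.2 e.2 (g e).
Hypothesis pt_b : forall e, isend e -> (pt e).2 = lt_ e.2 e.1.2 (g e).
Hypothesis closing : forall e, isend e -> exists2 N, stuck e N &
  (pt (oth e N) = e /\ N.+1 + g (oth e N) %| 2 * m e.1.2 e.2) \/
  (exists2 N', stuck (pt (oth e N)) N' &
     pt (oth (pt (oth e N)) N') = e /\
     (N.+1 + g (oth e N)) + (N'.+1 + g (oth (pt (oth e N)) N'))
       %| 2 * m e.1.2 e.2).
Hypothesis closed : closed_pg m io ms.

Definition pairP e x := x = e \/ x = pt e.
Lemma pairP_ex e : exists x, pairP e x. Proof. by exists e; left. Qed.
Definition rep e := projT1 (cid (pairP_ex e)).
Lemma rep_in e : rep e = e \/ rep e = pt e.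
Proof. by rewrite /rep; case: cid. Qed.
(** The predicates [pairP (pt e)] and [pairP e] are equal by extensionality, so [cid] picks the same
    witness for both. *)
Lemma rep_pt e : isend e -> rep (pt e) = rep e.
Proof.
move=> he; rewrite /rep.
have E : pairP (pt e) = pairP e.
  by apply/funext => x; apply/propext; rewrite /pairP ptK //; split=> -[]; auto.
by move: (pairP_ex (pt e)); rewrite E => H; rewrite (Prop_irrelevance H (pairP_ex e)).
Qed.

(* Every gap is shared between its two ends; [hlen e] of its [g e] vertices are
   attributed to the end [e]. *)
Definition hlen e : nat :=
  if `[< pt e = e >] then (g e)./2
  else if `[< rep e = e >] then 1 else (g e).-1.

Lemma hlen_sum e : isend e -> hlen e + hlen (pt e) = g e.
Proof.
move=> he; rewrite /hlen; case: (asboolP (pt e = e)) => [pe|pne].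
  rewrite pe; case: asboolP => // _.
  by have [og _] := g_self he pe; have := odd_double_half (g e); rewrite (negPf og); lia.
have pne' : pt (pt e) <> pt e by rewrite ptK // => h; apply: pne; rewrite -h.
have g3 := g_ne he pne.
have -> : `[< pt (pt e) = pt e >] = false by apply/asboolP.
rewrite rep_pt // g_pt //.
case: (asboolP (rep e = e)) => [r1|r1]; case: (asboolP (rep e = pt e)) => [r2|r2]; try lia.
  by exfalso; apply: pne; rewrite -r2.
by case: (rep_in e) => [/r1|/r2].
Qed.

Lemma hlen_gt0 e : isend e -> 0 < hlen e.
Proof.
move=> he; rewrite /hlen; case: asboolP => [pe|pne].
  by have [og g2] := g_self he pe; lia.
by have := g_ne he pne; case: asboolP => *; lia.
Qed.

(** The new a-neighbour of u is indexed by (u, a) alone, because it begins the gaps of all ends (u,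
    a, b); every other new vertex belongs to one gap. Indices that name no vertex remain as points
    at which every edge is missing. *)
Definition nw := (V * S + opend * nat)%type.
Definition V' := (V + nw)%type.
Definition inX (u : V) (a : S) : V' := inr (inl (u, a)).
Definition inY e i : V' := inr (inr (e, i)).
Definition pos e i : V' :=
  match i with 0 => inl e.1.1 | 1 => inX e.1.1 e.1.2 | _ => inY e i end.
(** Past the half attributed to e the path crosses to the half of [pt e]; when [pt e = e] this
    crossing is the loop in the middle. *)
Definition nxt e i := if i < hlen e then pos e i.+1 else pos (pt e) (hlen (pt e)).
Definition validY e i := isend e && (1 < i <= hlen e).
Definition io' (s : S) (x : V') : V' :=
  match x with
  | inl v => if ms s v then inX v s else inl (io s v)
  | inr (inl (u, a)) =>
      if ms a u then (if s == a then inl u else nxt (u, a, s) 1) else x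
  | inr (inr (e, i)) =>
      if validY e i then
        if s == lt_ e.1.2 e.2 i then nxt e i
        else if s == lt_ e.2 e.1.2 i then pos e i.-1 else x
      else x
  end.
Definition ms' (s : S) (x : V') : bool :=
  match x with
  | inl v => false
  | inr (inl (u, a)) => ~~ ms a u
  | inr (inr (e, i)) =>
      if validY e i then (s != e.1.2) && (s != e.2) else true
  end.

Lemma lt_neq (a b : S) i : a != b -> lt_ a b i != lt_ b a i.
Proof. by rewrite /lt_; case: odd; rewrite // eq_sym. Qed.

Lemma pos_step e i : isend e -> i <= hlen e -> io' (lt_ e.1.2 e.2 i) (pos e i) = nxt e i.
Proof.
case: e => -[u a] b he hi; case: i hi => [|[|i]] hi /=.
- have /andP[/= _ ->] := he; by rewrite /nxt (hlen_gt0 he).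
- have /andP[/= ab ->] := he; by rewrite /lt_ /= eq_sym (negPf ab).
- by rewrite /validY he hi /= eqxx.
Qed.

Lemma pos_back e i : isend e -> i < hlen e -> io' (lt_ e.1.2 e.2 i) (pos e i.+1) = pos e i.
Proof.
case: e => -[u a] b he hi; case: i hi => [|i] hi /=.
  by have /andP[/= ab ->] := he; rewrite /lt_ /= eqxx.
rewrite /validY he hi /=.
have /andP[/= ab _] := he.
by rewrite (ltS a b i.+1) (ltS b a i.+1) (negPf (lt_neq i.+1 ab)) eqxx.
Qed.

Lemma pt_lab e j : isend e -> lt_ (pt e).1.2 (pt e).2 j = lt_ e.1.2 e.2 (g e + j).
Proof. by move=> he; rewrite pt_a // pt_b // /lt_ oddD; do 2 case: odd. Qed.

Lemma nxt_back e i : isend e -> i <= hlen e -> io' (lt_ e.1.2 e.2 i) (nxt e i) = pos e i.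
Proof.
move=> he; rewrite leq_eqVlt /nxt => /orP[/eqP->|hi]; last by rewrite hi pos_back.
rewrite ltnn; have he' := pt_end he.
have -> : lt_ e.1.2 e.2 (hlen e) = lt_ (pt e).1.2 (pt e).2 (hlen (pt e)).
  rewrite pt_lab // -(hlen_sum he) /lt_ !oddD; by do 2 case: odd.
by rewrite pos_step // /nxt ltnn ptK.
Qed.

Lemma io'K s : involutive (io' s).
Proof.
case=> [v|[[u a]|[e i]]].
- rewrite /=; case: ifP => h /=; first by rewrite h eqxx.
  by rewrite ms_io h ioK.
- rewrite /=; case: ifP => h /=; last by rewrite h.
  case: ifP => [/eqP sa|sa] /=; first by rewrite sa h.
  have he : isend (u, a, s) by rewrite /is_end /= eq_sym sa.
  exact: (@nxt_back (u, a, s) 1 he (hlen_gt0 he)).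
- rewrite /=; case: ifP => h /=; last by rewrite h.
  case/andP: (h) => he /andP[i1 ih].
  case: ifP => [/eqP sa|sa]; first by rewrite sa nxt_back //; case: i i1 {ih h sa} => [|[]].
  case: ifP => [/eqP sb|sb] /=; last by rewrite h sa sb.
  case: i i1 ih h sa sb => // i i1 ih h sa sb; rewrite sb ltS /= pos_step //; last by lia.
  by rewrite /nxt ih; case: i i1 {ih h sa sb}.
Qed.

Lemma ms'_fix s x : ms' s x -> io' s x = x.
Proof.
case: x => [//|[[u a]|[e i]]] /=; first by case: ifP.
case: ifP => // _ /andP[sa sb].
by case: (lt_case e.1.2 e.2 i) => -[-> ->]; rewrite (negPf sa) (negPf sb).
Qed.

Lemma walk_pos e i : isend e -> i <= hlen e -> alt io' e.1.2 e.2 i (inl e.1.1) = pos e i.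
Proof.
move=> he; elim: i => [//|i IH] hi.
by rewrite altS IH ?pos_step // ?(ltnW hi) // /nxt hi.
Qed.

Lemma walk_gap e : isend e -> alt io' e.1.2 e.2 (g e).+1 (inl e.1.1) = inl (pt e).1.1.
Proof.
move=> he; have he' := pt_end he.
rewrite -(hlen_sum he) -addSn altD altS walk_pos // pos_step // /nxt ltnn.
rewrite -(walk_pos he' (leqnn _)) !ltS.
have := alt_back io'K (pt e).1.2 (pt e).2 (inl (pt e).1.1) (leqnn (hlen (pt e))).
rewrite subnn /= => {2}<-; congr (alt _ _ _ _ _).
- rewrite pt_a // pt_b // -(hlen_sum he) /lt_ !oddD; by do 2 case: odd.
- rewrite pt_a // pt_b // -(hlen_sum he) /lt_ !oddD; by do 2 case: odd.
Qed.

Lemma walk_old u b a N : (forall i, i < N -> ~~ ms (lt_ b a i) (alt io b a i u)) ->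
  alt io' b a N (inl u) = inl (alt io b a N u).
Proof.
elim: N => [//|N IH] h.
rewrite !altS IH /=; last by move=> i iN; apply: h; lia.
by rewrite (negPf (h N (leqnn _))).
Qed.

Lemma oth_is_end e N : isend e -> stuck e N -> isend (oth e N).
Proof.
move=> /andP[ab _] [_ h]; rewrite /is_end /= h andbT eq_sym; exact: lt_neq.
Qed.

Lemma macro e N : isend e -> stuck e N ->
  alt io' e.2 e.1.2 (N.+1 + g (oth e N)) (inl e.1.1) = inl (pt (oth e N)).1.1.
Proof.
move=> he hN; have [h1 h2] := hN; have he2 := oth_is_end he hN.
by rewrite addSnnS altD walk_old // (walk_gap he2).
Qed.

Lemma macro_b e N : isend e -> stuck e N ->
  (pt (oth e N)).2 = lt_ e.2 e.1.2 (N.+1 + g (oth e N)) /\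
  (pt (oth e N)).1.2 = lt_ e.1.2 e.2 (N.+1 + g (oth e N)).
Proof.
move=> he hN; have he2 := oth_is_end he hN; rewrite pt_b // pt_a // /= /lt_ !oddD /=.
by do 2 case: odd.
Qed.

Lemma lt_even (a b : S) T : a != b -> lt_ a b T = a -> odd T = false.
Proof. by rewrite /lt_; case: odd => // ab h; rewrite h eqxx in ab. Qed.

Lemma per_end e : isend e -> per io' e.2 e.1.2 (m e.1.2 e.2) (inl e.1.1).
Proof.
move=> he; have [ab _] := andP he; rewrite eq_sym in ab.
have [N hN [[pe d]|[N' hN' [pe d]]]] := closing he.
  apply: per_dvd d; first by rewrite macro // pe.
  by apply: (lt_even ab); have [<- _] := macro_b he hN; rewrite pe.
have he2 := pt_end (oth_is_end he hN).
have [b1 a1] := macro_b he hN.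
apply: per_dvd d.
  by rewrite altD macro // -b1 -a1 macro // pe.
apply: (lt_even ab).
have [b2 _] := macro_b he2 hN'; rewrite pe b1 a1 in b2.
apply: (etrans _ (esym b2)); rewrite /lt_ oddD.
by case: (odd (N.+1 + _)); case: (odd (N'.+1 + _)).
Qed.

(** Either the old orbit of v is complete and [closed] applies, or the walk from v meets a first
    missing edge; the closed walk at that open end passes back through v. *)
Lemma per_inl v s t : s != t -> per io' s t (m s t) (inl v).
Proof.
move=> st; case: (pselect (forall i, ~~ ms (lt_ s t i) (alt io s t i v))) => [h|].
  by rewrite /per walk_old // (closed st h).
move=> /existsNP[i0 /negP/negPn hi0].
have ex : exists i, ms (lt_ s t i) (alt io s t i v) by exists i0.
case: (ex_minnP ex) => i hi imin.
pose e : opend := (alt io s t i v, lt_ s t i, lt_ t s i).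
have he : isend e by rewrite /is_end /= hi lt_neq.
have w : alt io' s t i (inl v) = inl e.1.1.
  by apply: walk_old => j ji; apply/negP => /imin; lia.
have := per_end he.
have -> : inl v = alt io' e.2 e.1.2 i (inl e.1.1) :> V'.
  by rewrite -w /= alt_back // ?subnn //; exact: io'K.
move=> /(per_alt io'K i); rewrite /e /=.
by case: (lt_case s t i) => -[-> ->]; [move/(per_sym io'K)|rewrite msym].
Qed.

Lemma per_pos e i : isend e -> i <= hlen e -> per io' e.1.2 e.2 (m e.1.2 e.2) (pos e i).
Proof.
move=> he hi; rewrite -walk_pos //; apply: per_alt; first exact: io'K.
by apply: per_sym; [exact: io'K|exact: per_end].
Qed.

Definition inpair e (s t : S) := (e.1.2 = s /\ e.2 = t) \/ (e.1.2 = t /\ e.2 = s).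
(** These are the vertices whose {s,t}-orbit has no missing edge after the round: the old ones, and
    those on the gaps labelled by s and t. *)
Definition good s t (x : V') := (exists v, x = inl v) \/
  (exists e i, [/\ isend e, i <= hlen e, inpair e s t & x = pos e i]).

Lemma pt_pair e s t : isend e -> inpair e s t -> inpair (pt e) s t.
Proof.
move=> he; rewrite /inpair pt_a // pt_b //.
by case: (lt_case e.1.2 e.2 (g e)) => -[-> ->] [[-> ->]|[-> ->]]; auto.
Qed.

Lemma good_nxt e i s t : isend e -> i <= hlen e -> inpair e s t -> good s t (nxt e i).
Proof.
move=> he hi p; right; rewrite /nxt; case: ifP => h; first by exists e, i.+1.
by exists (pt e), (hlen (pt e)); split=> //; [exact: pt_end | exact: pt_pair].
Qed.

Lemma good_step s t x : s != t -> good s t x -> ~~ ms' s x /\ good s t (io' s x).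
Proof.
move=> st [[v ->]|[e [i [he hi p ->]]]].
  split=> //=; case: ifP => h; last by left; exists (io s v).
  right; exists (v, s, t), 1; split=> //; last by left.
    by rewrite /is_end /= st h.
  by apply: hlen_gt0; rewrite /is_end /= st h.
split.
  case: i hi => [|[|i]] hi //=; first by have /andP[_ ->] := he.
  by rewrite /validY he hi /=; case: p => -[-> ->]; rewrite eqxx ?andbF.
have [E|E] : s = lt_ e.1.2 e.2 i \/ s = lt_ e.2 e.1.2 i.
  by case: p => -[-> ->]; rewrite /lt_; case: odd; auto.
  by rewrite [in io' _ _]E pos_step //; apply: good_nxt.
case: i hi E => [|i] hi E.
  rewrite /=; case: ifP => h; last by left; exists (io s e.1.1).
  have he' : isend (e.1.1, s, t) by rewrite /is_end /= st h.
  right; exists (e.1.1, s, t), 1; split=> //; last by left.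
  exact: hlen_gt0.
rewrite ltS in E; rewrite [in io' _ _]E pos_back //; right; exists e, i; split=> //; lia.
Qed.

Lemma good_sym s t x : good s t x -> good t s x.
Proof.
case=> [h|[e [i [he hi p ->]]]]; [by left | right; exists e, i; split=> //].
by rewrite /inpair in p *; tauto.
Qed.

Lemma good_walk s t i x : s != t -> good s t x -> ~~ ms' (lt_ s t i) (alt io' s t i x).
Proof.
elim: i s t x => [|i IH] s t x st gx; first by have [] := good_step st gx.
rewrite ltS /=; apply: IH; first by rewrite eq_sym.
by apply: good_sym; have [] := good_step st gx.
Qed.

Lemma inl_nomiss v s t i : s != t -> ~~ ms' (lt_ s t i) (alt io' s t i (inl v)).
Proof. by move=> st; apply: good_walk => //; left; exists v. Qed.

Lemma per_good s t x : s != t -> good s t x -> per io' s t (m s t) x.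
Proof.
move=> st [[v ->]|[e [i [he hi p ->]]]]; first exact: per_inl.
have := per_pos he hi; case: p => -[-> ->] // /(per_sym io'K).
by rewrite msym.
Qed.

Lemma nxt_shape e i : isend e -> 0 < i <= hlen e ->
  (exists u a, [/\ ms a u, nxt e i = inX u a & a = e.1.2 \/ a = e.2]) \/
  (exists e2 j, [/\ validY e2 j, nxt e i = inY e2 j & inpair e2 e.1.2 e.2]).
Proof.
move=> he /andP[i0 hi]; rewrite /nxt.
have shape e2 j : isend e2 -> 0 < j <= hlen e2 -> inpair e2 e.1.2 e.2 ->
  (exists u a, [/\ ms a u, pos e2 j = inX u a & a = e.1.2 \/ a = e.2]) \/
  (exists e3 j', [/\ validY e3 j', pos e2 j = inY e3 j' & inpair e3 e.1.2 e.2]).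
  case: j => [//|[|j]] he2 /andP[_ hj] p.
    left; exists e2.1.1, e2.1.2; split=> //; first by have /andP[] := he2.
    by case: p => -[-> _]; auto.
  by right; exists e2, j.+2; split=> //; rewrite /validY he2.
case: ifP => h; first by apply: shape => //; left.
apply: shape; first exact: pt_end.
  by rewrite leqnn andbT hlen_gt0 // pt_end.
by apply: pt_pair => //; left.
Qed.

(** Here the bounds on g matter. The vertex after [inX] in a gap is an [inY] vertex, which lacks all
    but two letters, except that a self-joined end with [g = 2] puts a loop at [inX]. Two [inX]
    vertices are never adjacent. *)
Lemma nxt1_shape e : isend e -> nxt e 1 = inX e.1.1 e.1.2 \/
  (exists e2 j, [/\ validY e2 j, nxt e 1 = inY e2 j & inpair e2 e.1.2 e.2]).
Proof.
move=> he; have h1 := hlen_gt0 he; have he' := pt_end he; have h1' := hlen_gt0 he'.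
have := hlen_sum he.
rewrite /nxt; case: ifP => h.
  by move=> _; right; exists e, 2; split=> //; [rewrite /validY he h|left].
case E: (hlen (pt e)) h1' => [//|[|j]] _ sum.
  have pe : pt e = e.
    by apply: contrapT => pne; have := g_ne he pne; lia.
  by left; rewrite pe.
right; exists (pt e), j.+2; split=> //; first by rewrite /validY he' E leqnn.
by apply: pt_pair => //; left.
Qed.

Lemma Y_nbr e i r : validY e i -> r = e.1.2 \/ r = e.2 ->
  (exists u a, [/\ ms a u, io' r (inY e i) = inX u a, a != r & a = e.1.2 \/ a = e.2]) \/
  (exists e2 j, [/\ validY e2 j, io' r (inY e i) = inY e2 j & inpair e2 e.1.2 e.2]).
Proof.
move=> v rab; case/andP: (v) => he /andP[i1 hi].
have [ab _] := andP he.
have key : (exists u a, [/\ ms a u, io' r (inY e i) = inX u a & a = e.1.2 \/ a = e.2]) \/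
  (exists e2 j, [/\ validY e2 j, io' r (inY e i) = inY e2 j & inpair e2 e.1.2 e.2]).
  rewrite /= v.
  have [E|E] : r = lt_ e.1.2 e.2 i \/ r = lt_ e.2 e.1.2 i.
    by case: rab => ->; rewrite /lt_; case: odd; auto.
    by rewrite -E eqxx; apply: nxt_shape => //; lia.
  rewrite E (negPf (lt_neq _ _)) 1?eq_sym // eqxx.
  case: i v i1 hi E => [//|[//|[|i]]] v _ hi E /=.
    by left; exists e.1.1, e.1.2; split=> //; [have /andP[] := he|left].
  right; exists e, i.+2; split=> //; [by rewrite /validY he; lia|by left].
case: key => [[u [a [h1 h2 h3]]]|h]; [left|by right].
exists u, a; split=> //; apply/eqP => ar.
have := io'K r (inY e i); rewrite h2 /= h1 ar eqxx => h; discriminate h.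
Qed.

Lemma X_nbr u a r : ms a u -> a != r -> let x := inX u a in io' r x = x \/
  (exists e2 j, [/\ validY e2 j, io' r x = inY e2 j & inpair e2 a r]).
Proof.
move=> h ar /=; rewrite h eq_sym (negPf ar).
by apply: (@nxt1_shape (u, a, r)); rewrite /is_end /= ar.
Qed.

Lemma Y_miss e i s t r : validY e i -> inpair e s t -> r != s -> r != t -> ms' r (inY e i).
Proof. by move=> v p rs rt /=; rewrite v; case: p => -[-> ->]; rewrite rs rt. Qed.

(** A complete orbit through a new vertex is either one that this round completed or a single [inX]
    vertex fixed by both letters. Any other walk soon reaches an [inY] vertex that lacks the next
    letter. *)
Lemma closed' : closed_pg m io' ms'.
Proof.
move=> x s t st nm.
case: x nm => [v|[[u a]|[e i]]] nm; first exact: per_inl.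
- have := nm 0; rewrite /= negbK => msu.
  have gd r : r != a -> per io' a r (m a r) (inX u a).
    move=> ra; have he : isend (u, a, r) by rewrite /is_end /= eq_sym ra.
    exact: (per_pos he (hlen_gt0 he)).
  case: (eqVneq s a) => [sa|sa]; first by subst s; apply: gd; rewrite eq_sym.
  case: (eqVneq t a) => [ta|ta].
    by subst t; rewrite msym; apply: per_sym; [exact: io'K|exact: gd].
  have as_ : a != s by rewrite eq_sym.
  have at_ : a != t by rewrite eq_sym.
  have [Xs|[e2 [j [v2 E2 p2]]]] := X_nbr msu as_; last first.
    have := nm 1; rewrite -[alt _ _ _ _ _]/(io' s (inX u a)) E2 -[lt_ _ _ _]/t.
    by rewrite (Y_miss v2 p2) // eq_sym.
  have [Xt|[e2 [j [v2 E2 p2]]]] := X_nbr msu at_; last first.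
    have := nm 2; rewrite -[alt _ _ _ _ _]/(io' t (io' s (inX u a))) Xs E2 -[lt_ _ _ _]/s.
    by rewrite (Y_miss v2 p2).
  exact: alt_fix.
- have := nm 0; rewrite /lt_ /=; case: ifP => // v; rewrite negb_and !negbK => sab.
  case/andP: (v) => he /andP[i1 hi].
  have {}sab : s = e.1.2 \/ s = e.2 by case/orP: sab => /eqP; auto.
  case: (boolP ((t == e.1.2) || (t == e.2))) => [|tn].
    move=> tab; apply: per_good => //; right; exists e, i; split=> //; last by case: i i1 {hi v nm} => [|[]].
    rewrite /inpair; case/orP: tab sab st => /eqP-> [->|->]; rewrite ?eqxx //; auto.
  exfalso; rewrite negb_or in tn; case/andP: tn => ta tb.
  have [[u [a [h1 h2 h3 h4]]]|[e2 [j [v2 E2 p2]]]] := Y_nbr v sab; last first.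
    by have := nm 1; rewrite -[alt _ _ _ _ _]/(io' s (inY e i)) E2 -[lt_ _ _ _]/t (Y_miss v2 p2).
  have at_ : a != t by case: h4 => ->; rewrite eq_sym.
  have [Xt|[e2 [j [v2 E2 p2]]]] := X_nbr h1 at_.
    have := nm 3; rewrite -[alt _ _ _ _ _]/(io' s (io' t (io' s (inY e i)))) h2 Xt -h2 io'K.
    by rewrite /lt_ /= v ta tb.
  have := nm 2; rewrite -[alt _ _ _ _ _]/(io' t (io' s (inY e i))) h2 E2 -[lt_ _ _ _]/s.
  by rewrite (Y_miss v2 p2) // eq_sym.
Qed.

Lemma short' : short_pg io' ms'.
Proof.
case=> -[x r] r' /andP[/= rr' mr].
have N0 : ms' r' x -> exists N, [/\ stuck_at io' ms' (x, r, r') N, N <= 3,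
    oth_end io' (x, r, r') N = (x, r, r') -> odd N &
    oth_end io' (x, r, r') N <> (x, r, r') -> N <= 2].
  move=> h; exists 0; split=> //; case=> e; have {}e : r' = r := e; by rewrite e eqxx in rr'.
case: x mr N0 => [//|[[u a]|[e i]]] mr N0; first exact: N0.
case: (boolP (validY e i)) => [v|nv]; last by apply: N0; rewrite /= (negPf nv).
have /andP[ra rb] : (r != e.1.2) && (r != e.2) by move: mr; rewrite /= v.
case: (boolP (ms' r' (inY e i))) => [/N0 //|nr'].
have {N0} _ := N0.
have r'ab : r' = e.1.2 \/ r' = e.2.
  by move: nr'; rewrite /= v negb_and !negbK => /orP[] /eqP; auto.
have [[u [a [h1 h2 h3 h4]]]|[e2 [j [v2 E2 p2]]]] := Y_nbr v r'ab; last first.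
  have mz : ms' r (inY e2 j) by apply: Y_miss v2 p2 _ _.
  exists 1; split=> //; split; first by case.
  by rewrite -[alt _ _ _ _ _]/(io' r' (inY e i)) E2.
have ar : a != r by case: h4 => ->; rewrite eq_sym.
have [Xr|[e2 [j [v2 E2 p2]]]] := X_nbr h1 ar.
  have E3 : io' r' (io' r (io' r' (inY e i))) = inY e i by rewrite h2 Xr -h2 io'K.
  exists 3; split=> //.
    split=> [[|[|[|//]]]|] //.
    - by rewrite -[alt _ _ _ _ _]/(io' r' (inY e i)) h2 /= h1.
    - by rewrite -[alt _ _ _ _ _]/(io' r (io' r' (inY e i))) h2 Xr /= h1.
    - by rewrite -[alt _ _ _ _ _]/(io' r' (io' r (io' r' (inY e i)))) E3.
  by case; rewrite /oth_end -[alt _ _ _ _ _]/(io' r' (io' r (io' r' (inY e i)))) E3.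
exists 2; split=> //; last first.
  case=> _ h _; have {}h : r' = r := h; by rewrite h eqxx in rr'.
split=> [[|[|//]]|] //.
  by rewrite -[alt _ _ _ _ _]/(io' r' (inY e i)) h2 /= h1.
rewrite -[alt _ _ _ _ _]/(io' r (io' r' (inY e i))) h2 E2.
by apply: Y_miss v2 p2 _ _; rewrite eq_sym.
Qed.
End Round.

Definition Wset (S : eqType) (m : S -> S -> nat) (Y : Type) (act : S -> Y -> Y) :=
  (forall s, involutive (act s)) /\
  (forall s t y, s != t -> per act s t (m s t) y).

Section Stuck.
Variables (S : eqType) (V : Type) (io : S -> V -> V) (ms : S -> V -> bool).
Hypothesis ioK : forall s, involutive (io s).
Hypothesis ms_fix : forall s v, ms s v -> io s v = v.
Implicit Type e : opend S V.

Lemma stuck_uniq e N N' : stuck_at io ms e N -> stuck_at io ms e N' -> N = N'.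
Proof.
move=> [h1 h2] [h1' h2']; case: (ltngtP N N') => // l.
  by move: (h1' _ l); rewrite h2.
by move: (h1 _ l); rewrite h2'.
Qed.

Lemma stuck_rev e N : is_end ms e -> stuck_at io ms e N ->
  stuck_at io ms (oth_end io e N) N /\ oth_end io (oth_end io e N) N = e.
Proof.
case: e => -[u a] b /andP[/= ab mu] [/= h1 h2].
have bk j : j <= N -> alt io (lt_ a b N) (lt_ b a N) j (alt io b a N u) = alt io b a (N - j) u.
  exact: (alt_back ioK).
have E : lt_ (lt_ a b N) (lt_ b a N) N = a by rewrite /lt_; case: odd.
have E' : lt_ (lt_ b a N) (lt_ a b N) N = b by rewrite /lt_; case: odd.
split; last by rewrite /oth_end /= bk // subnn E E'.
split=> [i iN|] /=; last by rewrite bk // subnn E.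
rewrite bk ?(ltnW iN) //.
have -> : N - i = (N - i).-1.+1 by lia.
have -> : lt_ (lt_ a b N) (lt_ b a N) i = lt_ b a (N - i).-1.
  have : odd N = odd ((N - i).-1 + i.+1) by congr odd; lia.
  by rewrite /lt_ oddD /= => ->; do 2 case: odd.
rewrite altS ms_io //; apply: h1; lia.
Qed.
End Stuck.

(** * Iterated completion and its limit *)

Section Iterate.
Variables (S : eqType) (m : S -> S -> nat).
Hypothesis msym : forall s t, m s t = m t s.
Hypothesis m3 : forall s t, s != t -> 3 <= m s t.

Record pg := PG {
  pgV : Type; pio : S -> pgV -> pgV; pms : S -> pgV -> bool;
  pioK : forall s, involutive (pio s);
  pfix : forall s v, pms s v -> pio s v = v;
  pclosed : closed_pg m pio pms;
  pshort : short_pg pio pms }.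

Section Std.
Variable P : pg.
Let io := @pio P.
Let ms := @pms P.
Implicit Type e : opend S (pgV P).

Lemma walk_ex e : exists N, is_end ms e ->
  [/\ stuck_at io ms e N, N <= 3, oth_end io e N = e -> odd N & oth_end io e N <> e -> N <= 2].
Proof.
case: (boolP (is_end ms e)) => [/(@pshort P)[N h]|_]; last by exists 0.
by exists N.
Qed.
Definition walk_len e := projT1 (cid (walk_ex e)).
(** In the later rounds each segment is completed by itself: its two ends are joined to each other,
    which gives a closed walk of 2m steps. *)
Definition std_pt e := oth_end io e (walk_len e).
Definition std_g e := 2 * m e.1.2 e.2 - (walk_len e).+1.

Lemma walk_lenP e : is_end ms e -> [/\ stuck_at io ms e (walk_len e), walk_len e <= 3,
  std_pt e = e -> odd (walk_len e) & std_pt e <> e -> walk_len e <= 2].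
Proof. by rewrite /std_pt /walk_len; case: cid. Qed.

Lemma std_end e : is_end ms e -> is_end ms (std_pt e).
Proof. by move=> he; have [h _ _ _] := walk_lenP he; apply: oth_is_end. Qed.

Lemma std_len e : is_end ms e -> walk_len (std_pt e) = walk_len e.
Proof.
move=> he; have [h _ _ _] := walk_lenP he.
have [h' _ _ _] := walk_lenP (std_end he).
have [h2 _] := stuck_rev (@pioK P) (@pfix P) he h.
exact: stuck_uniq h' h2.
Qed.

Lemma stdK e : is_end ms e -> std_pt (std_pt e) = e.
Proof.
move=> he; have [h _ _ _] := walk_lenP he.
rewrite {1}/std_pt std_len //.
by have [] := stuck_rev (@pioK P) (@pfix P) he h.
Qed.

Lemma std_m e : m (std_pt e).1.2 (std_pt e).2 = m e.1.2 e.2.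
Proof. by rewrite /std_pt /= /lt_; case: odd. Qed.

Lemma std_g_pt e : is_end ms e -> std_g (std_pt e) = std_g e.
Proof. by move=> he; rewrite /std_g std_len // std_m. Qed.

Lemma std_3 e : is_end ms e -> 3 <= m e.1.2 e.2.
Proof. by case/andP => /m3. Qed.

Lemma std_self e : is_end ms e -> std_pt e = e -> ~~ odd (std_g e) /\ 2 <= std_g e.
Proof.
move=> he pe; have [_ l o _] := walk_lenP he; have h3 := std_3 he.
have {}o := o pe; rewrite /std_g; split; last by lia.
by rewrite oddB; [rewrite oddM /= o | lia].
Qed.

Lemma std_ne e : is_end ms e -> std_pt e <> e -> 3 <= std_g e.
Proof.
move=> he pe; have [_ _ _ l] := walk_lenP he; have h3 := std_3 he.
by have {}l := l pe; rewrite /std_g; lia.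
Qed.

Lemma std_odd e : is_end ms e -> odd (std_g e) = ~~ odd (walk_len e).
Proof.
move=> he; have [_ l _ _] := walk_lenP he; have h3 := std_3 he.
by rewrite /std_g oddB; [rewrite oddM|lia].
Qed.

Lemma std_a e : is_end ms e -> (std_pt e).1.2 = lt_ e.1.2 e.2 (std_g e).
Proof. by move=> he; rewrite /lt_ std_odd // /std_pt /= /lt_; case: odd. Qed.

Lemma std_b e : is_end ms e -> (std_pt e).2 = lt_ e.2 e.1.2 (std_g e).
Proof. by move=> he; rewrite /lt_ std_odd // /std_pt /= /lt_; case: odd. Qed.

Lemma std_closing e : is_end ms e -> exists2 N, stuck_at io ms e N &
  (std_pt (oth_end io e N) = e /\ N.+1 + std_g (oth_end io e N) %| 2 * m e.1.2 e.2) \/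
  (exists2 N', stuck_at io ms (std_pt (oth_end io e N)) N' &
     std_pt (oth_end io (std_pt (oth_end io e N)) N') = e /\
     (N.+1 + std_g (oth_end io e N)) + (N'.+1 + std_g (oth_end io (std_pt (oth_end io e N)) N'))
       %| 2 * m e.1.2 e.2).
Proof.
move=> he; have [h l _ _] := walk_lenP he; have h3 := std_3 he.
exists (walk_len e) => //; left; rewrite -/(std_pt e) stdK // std_g_pt //; split=> //.
by rewrite /std_g subnKC //; lia.
Qed.

Definition round : pg :=
  @PG (V' S (pgV P)) (io' io ms std_pt std_g) (ms' ms std_pt std_g)
    (io'K (@pioK P) (@pfix P) std_end stdK std_g_pt std_self std_ne std_a std_b)
    (@ms'_fix _ _ _ _ std_pt std_g)
    (closed' msym (@pioK P) (@pfix P) std_end stdK std_g_pt std_self std_ne std_a std_b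
       std_closing (@pclosed P))
    (short' (@pioK P) (@pfix P) std_end stdK std_g_pt std_self std_ne std_a std_b).

Lemma round_io s v : ~~ @pms P s v -> @pio round s (inl v) = inl (@pio P s v).
Proof. by move=> /negPf h; rewrite /= /ms h. Qed.

Lemma round_nomiss v s t i : s != t ->
  ~~ @pms round (lt_ s t i) (alt (@pio round) s t i (inl v)).
Proof. exact: (inl_nomiss _ std_end std_self std_ne std_a std_b). Qed.

Lemma round_per v s t : s != t -> per (@pio round) s t (m s t) (inl v).
Proof.
exact: (per_inl msym (@pioK P) (@pfix P) std_end stdK std_g_pt std_self std_ne std_a std_b
       std_closing (@pclosed P)).
Qed.
End Std.

Section Limit.
Variable P0 : pg.
Fixpoint PP k := if k is k'.+1 then round (PP k') else P0.
(** The direct limit, written without a quotient by listing each point at the stage that creates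
    it. *)
Definition Ylim := (pgV P0 + {k : nat & nw S (pgV (PP k))})%type.
Fixpoint push k : pgV (PP k) -> Ylim :=
  match k return pgV (PP k) -> Ylim with
  | 0 => fun x => inl x
  | k'.+1 => fun x => match x with
      | inl x' => push x'
      | inr n => inr (existT (fun k => nw S (pgV (PP k))) k' n) end
  end.
(** A point is moved inside the stage after its creation, where none of its edges is missing any
    more. *)
Definition act_lim (s : S) (y : Ylim) : Ylim :=
  match y with
  | inl x => @push 1 (@pio (PP 1) s (inl x))
  | inr (existT k n) => @push k.+2 (@pio (PP k.+2) s (inl (inr n)))
  end.

Lemma act_push k s (x : pgV (PP k)) :
  act_lim s (push x) = @push k.+1 (@pio (PP k.+1) s (inl x)).
Proof.
elim: k x => [//|k IH] [x|n] //.
rewrite -[@push k.+1 (inl x)]/(@push k x) IH.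
by rewrite (@round_io (PP k.+1) s (inl x)).
Qed.

Lemma act_push_nm k s (x : pgV (PP k)) : ~~ @pms (PP k) s x ->
  act_lim s (push x) = push (@pio (PP k) s x).
Proof. by move=> h; rewrite act_push (@round_io (PP k)). Qed.

Lemma push_surj y : exists k (x : pgV (PP k)), y = push x.
Proof.
case: y => [x|[k n]]; first by exists 0, x.
by exists k.+1, (inr n).
Qed.

Lemma act_limK s : involutive (act_lim s).
Proof.
move=> y; have [k [x ->]] := push_surj y.
rewrite act_push act_push_nm ?pioK //.
by rewrite (ms_io (@pioK (PP k.+1)) (@pfix (PP k.+1))).
Qed.

Lemma act_walk k s t i (x : pgV (PP k)) :
  (forall j, j < i -> ~~ @pms (PP k) (lt_ s t j) (alt (@pio (PP k)) s t j x)) ->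
  alt act_lim s t i (push x) = push (alt (@pio (PP k)) s t i x).
Proof.
elim: i => [//|i IH] h; rewrite !altS IH ?act_push_nm //; first exact: h.
by move=> j ji; apply: h; lia.
Qed.

Lemma act_lim_Wset : Wset m act_lim.
Proof.
split=> [|s t y st]; first exact: act_limK.
have [k [x ->]] := push_surj y.
rewrite /per -[push x]/(@push k.+1 (inl x)) act_walk; last first.
  by move=> j _; apply: round_nomiss.
congr push; exact: round_per.
Qed.
End Limit.

Section Embed.
Variables (V : Type) (io : S -> V -> V) (ms : S -> V -> bool).
Local Notation opend := (opend S V).
Local Notation isend := (is_end ms).
Local Notation oth := (oth_end io).
Local Notation stuck := (stuck_at io ms).
Implicit Type e : opend.
Hypothesis ioK : forall s, involutive (io s).
Hypothesis ms_fix : forall s v, ms s v -> io s v = v.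
Variables (pt : opend -> opend) (g : opend -> nat).
Hypothesis pt_end : forall e, isend e -> isend (pt e).
Hypothesis ptK : forall e, isend e -> pt (pt e) = e.
Hypothesis g_pt : forall e, isend e -> g (pt e) = g e.
Hypothesis g_self : forall e, isend e -> pt e = e -> ~~ odd (g e) /\ 2 <= g e.
Hypothesis g_ne : forall e, isend e -> pt e <> e -> 3 <= g e.
Hypothesis pt_a : forall e, isend e -> (pt e).1.2 = lt_ e.1.2 e.2 (g e).
Hypothesis pt_b : forall e, isend e -> (pt e).2 = lt_ e.2 e.1.2 (g e).
Hypothesis closing : forall e, isend e -> exists2 N, stuck e N &
  (pt (oth e N) = e /\ N.+1 + g (oth e N) %| 2 * m e.1.2 e.2) \/
  (exists2 N', stuck (pt (oth e N)) N' &
     pt (oth (pt (oth e N)) N') = e /\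
     (N.+1 + g (oth e N)) + (N'.+1 + g (oth (pt (oth e N)) N'))
       %| 2 * m e.1.2 e.2).
Hypothesis closed : closed_pg m io ms.

(** Only the first round uses the prescribed gaps. It needs no bound on segments, since any round
    leaves short ones, and from then on [round] applies. A letter missing at v leads to a new
    vertex, so it moves the image of v. *)
Lemma embed : exists (Y : Type) (act : S -> Y -> Y) (f : V -> Y),
  [/\ Wset m act, forall s v, ~~ ms s v -> f (io s v) = act s (f v),
    forall s v, ms s v -> act s (f v) <> f v &
    forall e, isend e -> alt act e.1.2 e.2 (g e).+1 (f e.1.1) = f (pt e).1.1].
Proof.
pose P0 : pg := @PG (V' S V) (io' io ms pt g) (ms' ms pt g)
    (io'K ioK ms_fix pt_end ptK g_pt g_self g_ne pt_a pt_b)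
    (@ms'_fix _ _ _ _ pt g)
    (closed' msym ioK ms_fix pt_end ptK g_pt g_self g_ne pt_a pt_b closing closed)
    (short' ioK ms_fix pt_end ptK g_pt g_self g_ne pt_a pt_b).
exists (Ylim P0), (@act_lim P0), (fun v => @push P0 0 (inl v)).
have nm v s : ~~ @pms (PP P0 0) s (inl v) by [].
split=> [|s v h|s v h|e he].
- exact: act_lim_Wset.
- by rewrite act_push_nm //= (negPf h).
- by rewrite act_push_nm //= h.
- have ab : e.1.2 != e.2 by case/andP: he.
  rewrite act_walk; last first.
    move=> j _; exact: (inl_nomiss _ pt_end g_self g_ne pt_a pt_b).
  by rewrite (walk_gap ioK ms_fix pt_end ptK g_pt g_self g_ne pt_a pt_b he).
Qed.
End Embed.
End Iterate.

(** * Labelled graphs forcing fixed points *)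

Section States.
Variables (S : eqType) (m : S -> S -> nat) (k : nat).

(* Edges are undirected, since generators act by involutions; the smaller end
   comes first. *)
Definition edge := (nat * S * nat)%type.
Implicit Types (e : edge) (E : seq edge) (vv : seq nat).
Definition eg p s q : edge := if p <= q then (p, s, q) else (q, s, p).
Definition nl e := e.1.1 != e.2.
Definition inc v e := (e.1.1 == v) || (e.2 == v).

(* In a constraint [cn p s t q l] there are loops labelled s at p and
   [lt_ s t l] at q, and q is reached from p by the alternating word of length
   l - 1 that begins with t. *)
Record state := State {
  vs : seq nat;
  es : seq edge;
  cn : nat -> S -> S -> nat -> nat -> Prop }.

Definition lp (E : seq edge) v s := (v, s, v) \in E.
Definition looped (E : seq edge) v := has (fun e => (e.1.1 == v) && (e.2 == v)) E.
Definition nlc (E : seq edge) := count nl E.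
Definition V0 (vv : seq nat) (E : seq edge) := count (fun v => ~~ looped E v) vv.
Definition mu X := size (es X) + nlc (es X).

Definition wf_edges vv (E : seq edge) :=
  forall e, e \in E -> [/\ e.1.1 \in vv, e.2 \in vv & e.1.1 <= e.2].

(** The last clause is the same constraint read from q back to p. For different p and q the
    completed orbit is a closed walk of [2 * l] steps, which has to divide [2 * m s t]; hence the
    exponent must be positive. *)
Definition wf_cn (E : seq edge) (K : nat -> S -> S -> nat -> nat -> Prop) :=
  forall p s t q l, K p s t q l ->
    [/\ s != t, lp E p s, lp E q (lt_ s t l),
        exists2 i, 2 ^ i * l = 2 * m s t & (0 < i) || (p == q) &
        K q (lt_ s t l) (lt_ t s l) p l].

Definition ok (Y : Type) (act : S -> Y -> Y) (f : nat -> Y) e :=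
  f e.2 = act e.1.2 (f e.1.1).
Definition cn_ok (Y : Type) (act : S -> Y -> Y) (f : nat -> Y) (K : nat -> S -> S -> nat -> nat -> Prop) :=
  forall p s t q l, K p s t q l -> f q = alt act t s l.-1 (f p).
Definition onto vv E K := forall (Y : Type) (act : S -> Y -> Y), Wset m act ->
  forall f : nat -> Y, (forall e, e \in E -> ok act f e) -> cn_ok act f K ->
  forall v, v \in vv -> forall s, act s (f v) = f v.

(** Among the constraints along one segment the shortest decides the gap. The longer ones must
    follow from it, which is possible when they lead back to p. *)
Definition reduced E (K : nat -> S -> S -> nat -> nat -> Prop) :=
  (forall p s t q l q' l', K p s t q l -> K p s t q' l' -> l' <= l ->
     (l' = l -> q = q') /\ (l' < l -> q = p)) /\
  (forall p s t q l, K p s t q l -> lp E p t -> q = p).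
(* The exponent i such that [2 ^ i * l = 2 * m s t] counts the halvings that
   produced a constraint; they are paid for by [V0 + k - nlc]. *)
Definition depth_strict vv E (K : nat -> S -> S -> nat -> nat -> Prop) :=
  forall p s t q l i, K p s t q l -> 2 ^ i * l = 2 * m s t ->
    nlc E + i + 1 <= V0 vv E + k.
(** A constraint between different vertices may have used up its allowance; one from p to p keeps a
    unit, with which a further halving can be paid. *)
Definition depth_weak vv E (K : nat -> S -> S -> nat -> nat -> Prop) :=
  forall p s t q l i, K p s t q l -> 2 ^ i * l = 2 * m s t ->
    nlc E + i + (p == q) <= V0 vv E + k.

(** The alternative in [v_depth] is what identifications preserve: one that might destroy [reduced]
    also gains the unit that makes the depth strict. *)
Record valid X : Prop := Valid {
  v_uniq : uniq (vs X);
  v_ne : vs X <> [::];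
  v_wf : wf_edges (vs X) (es X);
  v_wfc : wf_cn (es X) (cn X);
  v_onto : onto (vs X) (es X) (cn X);
  v_size : size (es X) + 1 <= size (vs X) + k;
  v_nlc : nlc (es X) + 1 <= V0 (vs X) (es X) + k;
  v_depth : depth_strict (vs X) (es X) (cn X) \/
            (reduced (es X) (cn X) /\ depth_weak (vs X) (es X) (cn X)) }.

Lemma eg_sym p s q : eg p s q = eg q s p.
Proof.
rewrite /eg; case: leqP => h1; case: leqP => h2 //; last by lia.
by have -> : p = q by lia.
Qed.

Lemma eg_loop p s : eg p s p = (p, s, p). Proof. by rewrite /eg leqnn. Qed.

Lemma eg_nl p s q : nl (eg p s q) = (p != q).
Proof. by rewrite /eg /nl; case: ifP => //= _; rewrite eq_sym. Qed.

Lemma ok_eg (Y : Type) (act : S -> Y -> Y) f p s q : (forall s, involutive (act s)) ->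
  ok act f (eg p s q) <-> f q = act s (f p).
Proof.
move=> aK; rewrite /ok /eg; case: ifP => //= _.
by split=> ->; rewrite aK.
Qed.

Lemma eg_id e : e.1.1 <= e.2 -> e = eg e.1.1 e.1.2 e.2.
Proof. by rewrite /eg => ->; case: e => [[]]. Qed.

Lemma loopedP E v : reflect (exists s, lp E v s) (looped E v).
Proof.
apply: (iffP hasP) => [[[[p s] q] pE /= /andP[/eqP e1 /eqP e2]]|[s h]].
  by exists s; subst.
by exists (v, s, v) => //=; rewrite eqxx.
Qed.

Section Glue.
Variables (x y : nat).
Definition glue z := if z == y then x else z.
Definition gluee e := eg (glue e.1.1) e.1.2 (glue e.2).
Definition xye e := nl e && (((e.1.1 == x) && (e.2 == y)) || ((e.1.1 == y) && (e.2 == x))).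

Lemma nl_gluee e : x != y -> nl (gluee e) = nl e && ~~ xye e.
Proof.
move=> xy; rewrite /gluee eg_nl /glue /xye /nl; move: e => [[p s] q] /=.
by case: ifP => h1; case: ifP => h2; lia.
Qed.

Lemma nlc_gluee E : x != y -> nlc [seq gluee e | e <- E] + count xye E = nlc E.
Proof.
move=> xy; rewrite /nlc count_map; elim: E => //= e E IH.
rewrite nl_gluee // -IH; have : xye e -> nl e by case/andP.
by case: (nl e); case: (xye e) => //= h; [lia|have := h isT].
Qed.

Lemma lp_gluee E v s : lp E v s -> lp [seq gluee e | e <- E] (glue v) s.
Proof. by move=> h; apply/mapP; exists (v, s, v); rewrite // /gluee eg_loop. Qed.

Lemma looped_gluee E v : v != x -> v != y -> looped [seq gluee e | e <- E] v = looped E v.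
Proof.
move=> vx vy; rewrite /looped has_map; apply: eq_has => e /=.
rewrite /gluee /eg /glue; case: e => [[p s] q] /=.
by case: ifP => h1; case: ifP => h2; case: ifP => h3 /=; lia.
Qed.

Lemma looped_gluee_x E : x != y ->
  looped [seq gluee e | e <- E] x = [|| looped E x, looped E y | has xye E].
Proof.
move=> xy; rewrite /looped has_map -!has_predU; apply: eq_has => e /=.
rewrite /gluee /eg /glue /xye /nl; case: e => [[p s] q] /=.
by case: ifP => h1; case: ifP => h2; case: ifP => h3 /=; lia.
Qed.
End Glue.
End States.

(** * A minimal graph *)

Section MinimalState.
Variables (S : eqType) (m : S -> S -> nat) (k n : nat) (s0 : S).
Hypothesis msym : forall s t, m s t = m t s.
Hypothesis mbig : forall s t, s != t -> 6 * 2 ^ n <= m s t.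
Hypothesis kn : k < n.
Local Notation state := (state S).
Local Notation valid := (valid m k).
Variable X : state.
Hypothesis vX : valid X.
Hypothesis Xmin : forall X' : state, valid X' -> mu X' < mu X -> False.
Local Notation vsX := (vs X).
Local Notation esX := (es X).
Local Notation cnX := (cn X).
Local Notation edge := (edge S).
Implicit Types (vv : seq nat).

(** * Identifying two vertices *)

Lemma eg_ordered p (s : S) q : (eg p s q).1.1 <= (eg p s q).2.
Proof. by rewrite /eg; case: (leqP p q) => [h|/ltnW h]. Qed.

Lemma wf_eg vv p (s : S) q : p \in vv -> q \in vv ->
  [/\ (eg p s q).1.1 \in vv, (eg p s q).2 \in vv & (eg p s q).1.1 <= (eg p s q).2].
Proof. by move=> hp hq; split; rewrite ?eg_ordered // /eg; case: ifP. Qed.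

Lemma size_rem1 (x : nat) (v : seq nat) : x \in v -> (size (rem x v : seq nat)).+1 = size v.
Proof. by move=> h; rewrite size_rem //; case: v h. Qed.

Lemma cn_looped p s t q l : cnX p s t q l -> looped esX p.
Proof. by move=> h; have [_ h1 _ _ _] := v_wfc vX h; apply/loopedP; exists s. Qed.

Lemma V0_rem x y vv (E : seq edge) : uniq vv -> x \in vv -> y \in vv -> x != y ->
  V0 vv E = ~~ looped E x + ~~ looped E y + count (fun v : nat => ~~ looped E v) (rem x (rem y vv)).
Proof.
move=> u hx hy xy; rewrite /V0 (permP (perm_to_rem hy)) /=.
have hx' : x \in rem y vv by rewrite mem_rem_uniq // !inE xy.
by rewrite (permP (perm_to_rem hx')) /=; lia.
Qed.

Lemma weak_bound p s t q l i : cnX p s t q l -> 2 ^ i * l = 2 * m s t ->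
  nlc esX + i <= V0 vsX esX + k.
Proof.
move=> h e; case: (v_depth vX) => [d|[_ d]]; have := d _ _ _ _ _ _ h e; lia.
Qed.

(** Here E1 is the edge list before gluing. Merging x and y may lower [V0] by one, and this is paid
    by a non-loop edge absent from E1; should an edge between x and y turn into a loop, [nlc] drops
    further. If both vertices carry loops, [V0] does not change and a strict depth survives without
    payment. *)
Lemma ident_core (x y : nat) (E1 : seq edge) : x \in vsX -> y \in vsX -> x != y ->
  wf_edges vsX E1 -> size E1 < size esX ->
  [/\ nlc E1 < nlc esX, forall v, looped E1 v = looped esX v,
      looped esX y -> looped esX x &
      ~~ looped esX y -> forall v s, lp E1 v s -> lp esX v s] \/
  [/\ depth_strict m k vsX esX cnX, nlc E1 <= nlc esX,
      looped esX x && looped esX y, looped E1 x &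
      forall v, v != y -> looped E1 v = looped esX v] ->
  (forall v s, lp esX v s -> lp E1 v s \/ ((v = x \/ v = y) /\ (lp E1 x s \/ lp E1 y s))) ->
  (forall (Y : Type) (act : S -> Y -> Y), Wset m act -> forall f : nat -> Y,
     (forall e, e \in E1 -> ok act f e) -> cn_ok act f cnX -> f x = f y ->
     forall e, e \in esX -> ok act f e) -> False.
Proof.
move=> hx hy xy wfE sE pay lpE impl.
pose es' := [seq gluee x y e | e <- E1].
pose K' p' s t q' l := exists p q, [/\ cnX p s t q l, p' = glue x y p & q' = glue x y q].
pose X' := State (rem y vsX) es' K'.
have pix : glue x y x = x by rewrite /glue (negPf xy).
have piy : glue x y y = x by rewrite /glue eqxx.
have uX := v_uniq vX.
have mrem z : (z \in rem y vsX) = (z != y) && (z \in vsX) by rewrite mem_rem_uniq // !inE.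
have pin z : z \in vsX -> glue x y z \in rem y vsX.
  by rewrite mrem /glue; case: (eqVneq z y) => [_ _|h ->]; rewrite ?xy ?h.
have lpi v s : lp esX v s -> lp es' (glue x y v) s.
  move=> /lpE[h|[hv hs]]; first exact: lp_gluee.
  have -> : glue x y v = x by case: hv => ->.
  by case: hs => /(lp_gluee x y); rewrite ?pix ?piy.
have wfc' : wf_cn m es' K'.
  move=> p' s t q' l [p [q [h -> ->]]]; have [st h1 h2 [i e1 e2] h4] := v_wfc vX h.
  split; [by []|exact: lpi|exact: lpi| |by exists q, p].
  by exists i => //; case/orP: e2 => [->//|/eqP->]; rewrite eqxx orbT.
have onto' : onto m (rem y vsX) es' K'.
  move=> Y act W f' fe fc v; rewrite mrem => /andP[vy vv] s.
  have [aK _] := W.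
  pose f z := f' (glue x y z).
  have := @v_onto _ _ _ _ vX Y act W f; move/(_ _ _ v vv s); rewrite /f {3 4}/glue (negPf vy); apply.
    apply: (impl _ _ W); last by rewrite pix piy.
      move=> e eE; have := fe _ (map_f (gluee x y) eE).
      by move/(ok_eg _ _ _ _ aK).
    by move=> p s' t q l h; rewrite /f; apply: fc; exists p, q.
  by move=> p s' t q l h; apply: fc; exists p, q.
have R' : count (fun v : nat => ~~ looped es' v) (rem x (rem y vsX)) =
          count (fun v : nat => ~~ looped esX v) (rem x (rem y vsX)).
  apply: eq_in_count => v; rewrite mem_rem_uniq ?rem_uniq // !inE mem_rem_uniq // !inE.
  case/and3P => vx vy _; rewrite looped_gluee //; congr negb.
  by case: pay => [[_ -> _ _]//|[_ _ _ _ ->]].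
have V0E := V0_rem esX uX hx hy xy.
have V0E' : V0 (rem y vsX) es' = ~~ looped es' x + count (fun v : nat => ~~ looped es' v) (rem x (rem y vsX)).
  have hx' : x \in rem y vsX by rewrite mrem xy.
  by rewrite /V0 (permP (perm_to_rem hx')).
rewrite R' in V0E'.
have lx' := looped_gluee_x E1 xy; rewrite -/es' has_count in lx'.
have nlE := nlc_gluee E1 xy; rewrite -/es' in nlE.
have wbK p s t q l i : K' p s t q l -> 2 ^ i * l = 2 * m s t -> nlc esX + i <= V0 vsX esX + k.
  by move=> [p0 [q0 [h _ _]]]; exact: weak_bound h.
have lt' : mu X' < mu X.
  rewrite /mu /= size_map; have : nlc E1 <= nlc esX by case: pay => -[] *; lia.
  lia.
have vn := v_nlc vX.
suff [n' d'] : nlc es' + V0 vsX esX <= nlc esX + V0 (rem y vsX) es' /\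
  (depth_strict m k (rem y vsX) es' K' \/ reduced es' K' /\ depth_weak m k (rem y vsX) es' K').
  apply: (Xmin (X' := X')) lt'; split=> //=.
  - exact: rem_uniq.
  - by move=> E; have := pin _ hx; rewrite E.
  - move=> e /mapP[e0 /wfE[h1 h2 h3] ->]; rewrite /gluee; exact: wf_eg (pin _ h1) (pin _ h2).
  - by rewrite size_map; have := v_size vX; have := size_rem1 hy; lia.
  - lia.
have gain : nlc es' + V0 vsX esX < nlc esX + V0 (rem y vsX) es' ->
  depth_strict m k (rem y vsX) es' K'.
  by move=> h p s t q l i /wbK w /w; lia.
case: pay => [[nE lE lyx sub]|[ds nE /andP[lx ly] lx1 _]]; last first.
  rewrite lx ly in V0E; rewrite lx1 /= in lx'; rewrite lx' in V0E'.
  split; first by lia.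
  left=> p s t q l i [p0 [q0 [h _ _]]] e; have := ds _ _ _ _ _ _ h e; lia.
rewrite !lE in lx'.
case: (boolP (looped esX y)) => ly.
  have lx := lyx ly; rewrite lx ly in V0E lx'; rewrite lx' in V0E'.
  by split; [lia|left; apply: gain; lia].
rewrite (negPf ly) /= in V0E lx'.
have n' : nlc es' + V0 vsX esX <= nlc esX + V0 (rem y vsX) es'.
  by rewrite V0E V0E' lx'; case: (looped esX x) => /=; lia.
split=> //.
(* An edge between x and y becomes a new loop at the looped vertex x and could spoil [reduced]; but
   then [nlc] drops by two and [V0] by one only, so the depth is strict. *)
case: (boolP (looped esX x && (0 < count (xye x y) E1))) => [/andP[lx c0]|nolx].
  by left; apply: gain; rewrite V0E V0E' lx' lx /=; lia.
have K'K p s t q l : K' p s t q l -> cnX p s t q l.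
  move=> [p0 [q0 [h -> ->]]]; have [_ _ _ _ h'] := v_wfc vX h.
  rewrite /glue; case: eqP => [e|_]; first by rewrite -e (cn_looped h) in ly.
  by case: eqP => [e|_] //; rewrite -e (cn_looped h') in ly.
case: (v_depth vX) => [ds|[[r2 r3] dw]].
  by left=> p s t q l i /K'K h e; have := ds _ _ _ _ _ _ h e; lia.
right; split; last by move=> p s t q l i /K'K h e; have := dw _ _ _ _ _ _ h e; lia.
split; first by move=> p s t q l q' l' /K'K h /K'K h'; exact: r2 h h'.
move=> p s t q l /K'K h lpt; apply: (r3 _ _ _ _ _ h).
have lpx := cn_looped h.
have py : p != y by apply: contraNneq ly => <-.
apply: (sub ly).
have lt'' : lp E1 p t \/ lp E1 y t /\ p = x \/ has (xye x y) E1 /\ p = x.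
  move/mapP: lpt => [[[a b] c] eE]; rewrite /gluee /eg /glue /=.
  case: (eqVneq a y) => [ay|ay]; case: (eqVneq c y) => [cy|cy]; case: ifP => // hle [] e1 e2 e3; try subst b.
  - by right; left; rewrite -e1; split=> //; rewrite /lp -{1}ay -cy.
  - by rewrite leqnn in hle.
  - by right; right; split=> //; apply/hasP; exists (a, t, c) => //=; rewrite /xye /nl /=; clear -ay cy e1 e3 py; lia.
  - by right; right; split=> //; apply/hasP; exists (a, t, c) => //=; rewrite /xye /nl /=; clear -ay cy e1 e3 py; lia.
  - by right; right; split=> //; apply/hasP; exists (a, t, c) => //=; rewrite /xye /nl /=; clear -ay cy e1 e3 py; lia.
  - by right; right; split=> //; apply/hasP; exists (a, t, c) => //=; rewrite /xye /nl /=; clear -ay cy e1 e3 py; lia.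
  - by left; move: eE; rewrite -e1 -e3.
  - by rewrite -e1 -e3 leqnn in hle.
case: lt'' => [//|[[h1 _]|[h1 e]]].
  by case/negP: ly; rewrite -lE; apply/loopedP; exists t.
  by rewrite -has_count h1 -e lpx in nolx.
Qed.

Lemma in_rem (T : eqType) (a b : T) (l : seq T) : b \in l -> b != a -> b \in rem a l.
Proof.
move=> bl ba; case: (boolP (a \in l)) => [al|/rem_id->//].
by move: bl; rewrite (perm_mem (perm_to_rem al)) inE (negPf ba).
Qed.

Lemma size_rem_lt (e : edge) E : e \in E -> size (rem e E) < size E.
Proof. by move=> eE; rewrite size_rem //; case: E eE => //= *; rewrite ltnSn. Qed.

Lemma nlc_rem (e : edge) E : e \in E -> nl e -> (nlc (rem e E)).+1 = nlc E.
Proof. by move=> eE ne; rewrite /nlc (permP (perm_to_rem eE)) /= ne. Qed.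

Lemma lp_rem (e : edge) E v s : nl e -> lp E v s -> lp (rem e E) v s.
Proof.
move=> ne h; apply: in_rem => //; apply: contraTneq ne => <-.
by rewrite /nl eqxx.
Qed.

Lemma lp_remW (e : edge) E v s : lp (rem e E) v s -> lp E v s.
Proof. exact: mem_rem. Qed.

Lemma looped_eq E E' v : (forall s : S, lp E v s <-> lp E' v s) -> looped E v = looped E' v.
Proof. by move=> h; apply/loopedP/loopedP => -[s /h]; exists s. Qed.

Lemma looped_rem (e : edge) E v : nl e -> looped (rem e E) v = looped E v.
Proof. by move=> ne; apply: looped_eq => s; split; [exact: lp_remW|exact: lp_rem]. Qed.

Lemma ident_nl (x y : nat) (E1 : seq edge) : x \in vsX -> y \in vsX -> x != y ->
  wf_edges vsX E1 -> size E1 < size esX -> nlc E1 < nlc esX ->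
  (forall v, looped E1 v = looped esX v) ->
  (~~ (looped esX x && looped esX y) -> forall v s, lp E1 v s -> lp esX v s) ->
  (forall v s, lp esX v s -> lp E1 v s \/ ((v = x \/ v = y) /\ (lp E1 x s \/ lp E1 y s))) ->
  (forall (Y : Type) (act : S -> Y -> Y), Wset m act -> forall f : nat -> Y,
     (forall e, e \in E1 -> ok act f e) -> cn_ok act f cnX -> f x = f y ->
     forall e, e \in esX -> ok act f e) -> False.
Proof.
move=> hx hy xy wfE sE nE lE sub lpE impl.
case: (boolP (looped esX y && ~~ looped esX x)) => [/andP[ly lx]|h].
  apply: (@ident_core y x E1) => //; first by rewrite eq_sym.
    left; split=> //; by move=> _; apply: sub; rewrite (negPf lx).
    by move=> v s /lpE; tauto.
  by move=> Y act W f h1 h2 h3; exact: (impl _ _ W f h1 h2 (esym h3)).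
apply: (@ident_core x y E1) => //; left; split=> //.
  by move=> ly; rewrite ly negbK in h.
by move=> ly; apply: sub; rewrite (negPf ly) andbF.
Qed.

Lemma ident_rem (x y : nat) (e : edge) : x \in vsX -> y \in vsX -> x != y ->
  e \in esX -> nl e ->
  (forall (Y : Type) (act : S -> Y -> Y), Wset m act -> forall f : nat -> Y,
     (forall e', e' \in esX -> e' != e -> ok act f e') -> cn_ok act f cnX -> f x = f y ->
     ok act f e) -> False.
Proof.
move=> hx hy xy eE ne impl; apply: (@ident_nl x y (rem e esX)) => //.
- by move=> e' /mem_rem /(v_wf vX).
- exact: size_rem_lt.
- by have := nlc_rem eE ne; lia.
- by move=> v; rewrite looped_rem.
- by move=> _ v s; apply: lp_remW.
- by move=> v s h; left; apply: lp_rem.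
move=> Y act W f h1 h2 h3 e' e'E.
have hne e'' : e'' \in esX -> e'' != e -> ok act f e'' by move=> *; apply: h1; apply: in_rem.
by case: (eqVneq e' e) => [->|ne']; [exact: (impl _ _ W f hne h2 h3)|apply: hne].
Qed.

(** Merging two looped vertices leaves [V0] unchanged, so under strict depth it suffices to save the
    duplicate loop. Thus strictness confines the loops of each label to one vertex. *)
Lemma ident_loop (x y : nat) (b : S) : x \in vsX -> y \in vsX -> x != y ->
  lp esX x b -> lp esX y b -> depth_strict m k vsX esX cnX -> False.
Proof.
move=> hx hy xy lx ly ds.
have ne v s : v != y -> (v, s, v) != (y, b, y).
  by move=> vy; apply: contraNneq vy => -[-> _ _].
have lE v s : v != y -> lp esX v s -> lp (rem (y, b, y) esX) v s.
  by move=> vy h; apply: in_rem (ne _ _ vy).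
apply: (@ident_core x y (rem (y, b, y) esX)) => //.
- by move=> e' /mem_rem /(v_wf vX).
- exact: size_rem_lt.
- right; split=> //.
  + by apply: leq_count_subseq; exact: rem_subseq.
  + by apply/andP; split; apply/loopedP; exists b.
  + by apply/loopedP; exists b; apply: lE.
  + by move=> v vy; apply: looped_eq => s; split; [exact: lp_remW|exact: lE].
- move=> v s h; case: (eqVneq (v, s, v) (y, b, y)) => [[-> ->]|ne']; last by left; apply: in_rem.
  by right; split; [right|left; apply: lE].
move=> Y act W f h1 h2 h3 e' e'E.
case: (eqVneq e' (y, b, y)) => [->|ne']; last by apply: h1; apply: in_rem.
by rewrite /ok /= -h3; exact: (h1 _ (lE _ _ xy lx)).
Qed.

(** * Folding, filling and pruning *)

Definition adj p s q := eg p s q \in esX.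
Lemma adjE p s q : adj p s q = (eg p s q \in esX). Proof. by []. Qed.

Lemma adj_sym p s q : adj p s q = adj q s p. Proof. by rewrite /adj eg_sym. Qed.
Lemma adj_vs p s q : adj p s q -> p \in vsX /\ q \in vsX.
Proof. by move/(v_wf vX) => [h1 h2 _]; move: h1 h2; rewrite /eg; case: ifP. Qed.
Lemma adj_loop p s : adj p s p = lp esX p s. Proof. by rewrite /adj eg_loop. Qed.

Lemma eg_inj p (s : S) q q' : eg p s q = eg p s q' -> q = q'.
Proof. by rewrite /eg; case: ifP; case: ifP => _ _ [] // -> ->. Qed.

(** Stallings folding. The edge to be dropped must not be a loop, so the roles of q and q' are
    exchanged if q' is p. *)
Lemma folded p s q q' : adj p s q -> adj p s q' -> q = q'.
Proof.
have key q1 q2 : adj p s q1 -> adj p s q2 -> q1 != q2 -> q2 != p -> False.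
  move=> h1 h2 ne np; have [_ v1] := adj_vs h1; have [_ v2] := adj_vs h2.
  apply: (@ident_rem q1 q2 (eg p s q2)) => //; first by rewrite eg_nl eq_sym.
  move=> Y act W f he _ e12; have [aK _] := W; apply/ok_eg => //; rewrite -e12.
  apply/ok_eg => //; apply: he => //.
  by apply: contraNneq ne => /eg_inj ->.
move=> h1 h2; apply/eqP/negPn/negP => ne.
case: (eqVneq q' p) => [e|np]; last exact: (key q q').
by apply: (key q' q) => //; rewrite eq_sym // -e eq_sym.
Qed.

Lemma cn_vs p s t q l : cnX p s t q l -> p \in vsX /\ q \in vsX.
Proof.
move=> h; have [_ /(v_wf vX)[/= h1 _ _] /(v_wf vX)[/= h2 _ _] _ _] := v_wfc vX h.
by [].
Qed.

Lemma m_pos s t : s != t -> 0 < m s t.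
Proof. by move/mbig => h; apply: leq_trans h; rewrite muln_gt0 expn_gt0. Qed.

Lemma cn_len p s t q l : cnX p s t q l -> 0 < l.
Proof.
move=> h; have [st _ _ [i e _] _] := v_wfc vX h.
by case: l e {h} => // e; have := m_pos st; rewrite muln0 in e; lia.
Qed.

(** Under strict depth each label has its loops at one vertex. The far vertex of a constraint
    carries s or t, and of two different lengths the longer is even, which makes its far loop an s,
    as at p. *)
Lemma reducedX : reduced esX cnX.
Proof.
case: (v_depth vX) => [ds|[]//].
have gl x y b : x \in vsX -> y \in vsX -> lp esX x b -> lp esX y b -> x = y.
  by move=> *; apply/eqP/negPn/negP => ne; apply: (@ident_loop x y b).
split.
  move=> p s t q l q' l' h h' le; have [st lps lq [i e _] _] := v_wfc vX h.
  have [_ _ lq' [i' e' _] _] := v_wfc vX h'.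
  have [vp vq] := cn_vs h; have [_ vq'] := cn_vs h'.
  split=> [ll|ll]; first by apply: (gl q q' (lt_ s t l)) => //; rewrite -ll.
  apply: (gl q p s) => //.
  have ol : odd l = false.
    have m0 : 0 < l' by exact: cn_len h'.
    have ii : i < i'.
      rewrite ltnNge; apply/negP => le2; have : 2 ^ i' <= 2 ^ i by rewrite leq_exp2l.
      have : 0 < 2 ^ i' by rewrite expn_gt0.
      nia.
    have : 2 ^ i * l = 2 ^ i * (2 ^ (i' - i) * l') by rewrite mulnA -expnD subnKC // ?(ltnW ii) // e.
    move/eqP; rewrite eqn_pmul2l ?expn_gt0 // => /eqP->.
    by rewrite oddM oddX orbF; have -> : (i' - i == 0) = false by lia.
  by move: lq; rewrite /lt_ ol.
move=> p s t q l h lpt; have [st lps lq _ _] := v_wfc vX h.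
have [vp vq] := cn_vs h.
by move: lq; rewrite /lt_; case: ifP => _ lq; [apply: (gl q p t)|apply: (gl q p s)].
Qed.

Lemma weakX : depth_weak m k vsX esX cnX.
Proof.
case: (v_depth vX) => [ds|[]//] p s t q l i h e.
by have := ds _ _ _ _ _ _ h e; case: (p == q); lia.
Qed.

Lemma two_pow_inj i i' l : 0 < l -> 2 ^ i * l = 2 ^ i' * l -> i = i'.
Proof. by move=> l0 /eqP; rewrite eqn_pmul2r // eqn_exp2l // => /eqP. Qed.

Lemma nl_not_lp e v (s : S) : nl e -> (v, s, v) != e.
Proof. by move=> ne; apply: contraTneq ne => <-; rewrite /nl eqxx. Qed.

Lemma inc_eg v p (s : S) q : inc v (eg p s q) = (p == v) || (q == v).
Proof. by rewrite /eg /inc; case: ifP => //= _; rewrite orbC. Qed.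

Lemma count_filterC (T : eqType) (a b : pred T) (s : seq T) :
  count a (filter b s) + count a (filter (predC b) s) = count a s.
Proof. by elim: s => //= x s IH; case: (b x) => /=; lia. Qed.

(* Trading four edges of an unbranched arc for a path of three edges. *)
Lemma fill c0 x1 x2 x3 c4 g h u a b u' :
  uniq [:: x1; x2; x3] -> c0 \notin [:: x1; x2; x3] -> c4 \notin [:: x1; x2; x3] ->
  u \notin [:: x1; x2; x3] -> u' \notin [:: x1; x2; x3] -> u \in vsX -> u' \in vsX ->
  adj c0 g x1 -> adj x1 h x2 -> adj x2 g x3 -> adj x3 h c4 ->
  (forall e x, e \in esX -> x \in [:: x1; x2; x3] -> inc x e ->
     e \in [:: eg c0 g x1; eg x1 h x2; eg x2 g x3; eg x3 h c4]) ->
  (forall (Y : Type) (act : S -> Y -> Y), Wset m act -> forall f : nat -> Y,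
     (forall e, e \in esX -> e \notin [:: eg c0 g x1; eg x1 h x2; eg x2 g x3; eg x3 h c4] -> ok act f e) ->
     cn_ok act f cnX -> f u' = alt act a b 3 (f u) -> f c4 = alt act g h 4 (f c0)) -> False.
Proof.
move=> ux c0x c4x ux0 u'x hu hu' a1 a2 a3 a4 unm impl.
set old := [:: eg c0 g x1; eg x1 h x2; eg x2 g x3; eg x3 h c4] in unm impl.
have [v0 v1] := adj_vs a1; have [_ v2] := adj_vs a2; have [_ v3] := adj_vs a3; have [_ v4] := adj_vs a4.
move: (ux) (c0x) (c4x) (ux0) (u'x); rewrite /= !inE !negb_or => /andP[/andP[n12 n13] /andP[n23 _]]
  /and3P[n01 n02 n03] /and3P[n41 n42 n43] /and3P[nu1 nu2 nu3] /and3P[nv1 nv2 nv3].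
have oldnl : all (@nl S) old.
  by rewrite /= !eg_nl n01 n12 n23 eq_sym n43.
have uold : uniq old.
  rewrite /= !inE !negb_or !andbT; apply/and3P; split; [apply/and3P; split|apply/andP; split|];
    apply/eqP.
  - by move/(congr1 (inc x2)); rewrite !inc_eg eqxx orbT (negPf n02) (negPf n12).
  - by move/(congr1 (inc x2)); rewrite !inc_eg eqxx (negPf n02) (negPf n12).
  - by move/(congr1 (inc x3)); rewrite !inc_eg eqxx (negPf n03) (negPf n13).
  - by move/(congr1 (inc x3)); rewrite !inc_eg eqxx orbT (negPf n13) (negPf n23).
  - by move/(congr1 (inc x1)); rewrite !inc_eg eqxx [x3 == _]eq_sym (negPf n13) (negPf n41).
  - by move/(congr1 (inc x2)); rewrite !inc_eg eqxx [x3 == _]eq_sym (negPf n23) (negPf n42).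
pose kept : seq edge := filter (predC (mem old)) esX.
(* The new path reuses x1 and x2 while x3 disappears: one vertex and at least one non-loop edge are
   lost. *)
pose new := [:: eg u a x1; eg x1 b x2; eg x2 a u'].
have newnl : all (@nl S) new.
  by rewrite /= !eg_nl nu1 n12 eq_sym nv2.
have cold : 4 <= size (filter (mem old) esX).
  apply: (@uniq_leq_size _ old); first exact: uold.
  move=> e eo; rewrite mem_filter /= eo /=.
  by move: eo; rewrite !inE => /or4P[] /eqP->.
have skept : 4 + size kept <= size esX.
  by rewrite -(count_predC (mem old) esX) -!size_filter leq_add2r.
have nkept : nlc kept + 4 <= nlc esX.
  rewrite /nlc -(count_filterC (@nl S) (mem old) esX) -/kept addnC leq_add2r.
  suff /eqP-> : count (@nl S) (filter (mem old) esX) == size (filter (mem old) esX) by [].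
  rewrite -all_count; apply/allP => e; rewrite mem_filter => /andP[eo _].
  exact: (allP oldnl).
pose es' : seq edge := new ++ kept.
have ses : size es' <= size kept + 3 by rewrite size_cat addnC.
have lp' v s : lp es' v s <-> lp esX v s.
  rewrite /lp mem_cat mem_filter /=; split.
    case/orP => [eN|/andP[]//]; have := allP newnl _ eN.
    by rewrite /nl eqxx.
  move=> e; apply/orP; right; rewrite e andbT; apply/negP => eo.
  by have := allP oldnl _ eo; rewrite /nl eqxx.
have looped' v : looped es' v = looped esX v by apply: looped_eq.
have loopless x : x \in [:: x1; x2; x3] -> ~~ looped esX x.
  move=> hx; apply/loopedP => -[s hs].
  have := unm _ x hs hx; rewrite /inc /= eqxx => /(_ isT) eo.
  by have := allP oldnl _ eo; rewrite /nl eqxx.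
have nlc' : nlc es' <= nlc kept + 3 by rewrite /nlc count_cat /= !eg_nl; case: (_ != _); case: (_ != _); case: (_ != _); clear; lia.
have V0' : V0 (rem x3 vsX) es' + 1 = V0 vsX esX.
  rewrite /V0 (permP (perm_to_rem v3)) /= loopless ?inE ?eqxx ?orbT //.
  rewrite addnC; congr (_ + _); apply: eq_count => v; by rewrite -(looped' v).
have sr := size_rem1 v3.
have mrem z : (z \in rem x3 vsX) = (z != x3) && (z \in vsX).
  by rewrite mem_rem_uniq ?(v_uniq vX) // !inE.
pose X' := State (rem x3 vsX) es' cnX.
have mu' : mu X' < mu X by rewrite /mu /=; clear -ses skept nkept nlc'; lia.
apply: (Xmin (X' := X')) mu'; split=> //=.
- exact: rem_uniq (v_uniq vX).
- by move=> E; have := mrem u; rewrite E hu nu3.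
- move=> e; rewrite mem_cat => /orP[|].
    have r1 : u \in rem x3 vsX by rewrite mrem nu3.
    have r2 : x1 \in rem x3 vsX by rewrite mrem n13.
    have r3 : x2 \in rem x3 vsX by rewrite mrem n23.
    have r4 : u' \in rem x3 vsX by rewrite mrem nv3.
    by rewrite !in_cons in_nil orbF => /or3P[] /eqP->; [exact: wf_eg r1 r2|exact: wf_eg r2 r3|exact: wf_eg r3 r4].
  rewrite mem_filter => /andP[eo eE]; have [w1 w2 w3] := v_wf vX eE.
  have h3 : ~~ inc x3 e.
    have x3in : x3 \in [:: x1; x2; x3] by rewrite inE; apply/orP; right; rewrite inE mem_seq1 eqxx orbT.
    by move/negP: eo => eo; apply/negP => /(unm _ _ eE x3in) /eo.
  by move: h3; rewrite /inc negb_or !mrem => /andP[-> ->].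
- move=> p s t q l hK; have [h1 h2 h3 h4 h5] := v_wfc vX hK.
  by split=> //; apply/lp'.
- move=> Y act W f' fe fc v vr s.
  have [aK _] := W.
  have innew e : e \in new -> ok act f' e by move=> eN; apply: fe; rewrite mem_cat eN.
  have /(ok_eg _ _ _ _ aK) fe1 : ok act f' (eg u a x1) by apply: innew; rewrite mem_head.
  have /(ok_eg _ _ _ _ aK) fe2 : ok act f' (eg x1 b x2) by apply: innew; rewrite !inE eqxx orbT.
  have /(ok_eg _ _ _ _ aK) fe3 : ok act f' (eg x2 a u') by apply: innew; rewrite !inE eqxx !orbT.
  have f4 : f' c4 = alt act g h 4 (f' c0).
    apply: (impl _ _ W _ _ fc); last by rewrite /= fe3 fe2 fe1.
    by move=> e eE eo; apply: fe; rewrite mem_cat mem_filter /= eo eE orbT.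
  (* On x1 and x2 the values of f' belong to the new path, so a map of the old graph is obtained by
     recomputing the arc from c0; [impl] makes it arrive correctly at c4. *)
  pose f z := if z == x1 then act g (f' c0) else if z == x2 then act h (act g (f' c0))
    else if z == x3 then act g (act h (act g (f' c0))) else f' z.
  have f1 : f x1 = act g (f' c0) by rewrite /f eqxx.
  have f2 : f x2 = act h (act g (f' c0)) by rewrite /f eqxx eq_sym (negPf n12).
  have f3 : f x3 = act g (act h (act g (f' c0))).
    by rewrite /f eqxx ![x3 == _]eq_sym (negPf n13) (negPf n23).
  have fo z : z \notin [:: x1; x2; x3] -> f z = f' z.
    by rewrite !inE !negb_or /f => /and3P[/negPf-> /negPf-> /negPf->].
  have fixf w : w \in vsX -> forall r, act r (f w) = f w.
    move=> hw r; apply: (@v_onto _ _ _ _ vX _ _ W f _ _ w hw r).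
      move=> e eE; case: (boolP (e \in old)) => [|eo].
        rewrite !inE => /or4P[] /eqP->; apply/ok_eg => //.
        - by rewrite f1 fo.
        - by rewrite f1 f2.
        - by rewrite f3 f2.
        - by rewrite f3 fo // f4.
      have no x : x \in [:: x1; x2; x3] -> (e.1.1 != x) /\ (e.2 != x).
        by move=> hx; apply/andP; rewrite -negb_or; apply/negP => /(unm _ _ eE hx); exact/negP.
      have n1 : e.1.1 \notin [:: x1; x2; x3] by apply/negP => /no[]; rewrite eqxx.
      have n2 : e.2 \notin [:: x1; x2; x3] by apply/negP => /no[]; rewrite eqxx.
      rewrite /ok !fo //.
      by apply: fe; rewrite mem_cat mem_filter /= eo eE orbT.
    move=> p s' t q l hK; have [_ _ _ _ hK'] := v_wfc vX hK.
    rewrite !fo; first exact: fc hK.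
      by apply/negP => /loopless; rewrite (cn_looped hK).
    by apply/negP => /loopless; rewrite (cn_looped hK').
  (* The vertex u lies off the arc, so it is fixed already under f'; the new path transports this to
     x1 and x2. *)
  have uu := fixf _ hu; rewrite fo // in uu.
  have e1 : f' x1 = f' u by rewrite fe1 uu.
  have e2 : f' x2 = f' u by rewrite fe2 e1 uu.
  case: (eqVneq v x1) => [->|vx1]; first by rewrite e1 uu.
  case: (eqVneq v x2) => [->|vx2]; first by rewrite e2 uu.
  move: vr; rewrite mrem => /andP[vx3 vv]; rewrite -fo; first exact: fixf.
  by rewrite !inE !negb_or vx1 vx2 vx3.
- by have := v_size vX; clear -ses skept sr; lia.
- by have := v_nlc vX; clear -V0' nkept nlc'; lia.
- case: (v_depth vX) => [ds|[[r2 r3] dw]]; [left|right; split].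
  + by move=> p s t q l i hK e; have := ds _ _ _ _ _ _ hK e; clear -V0' nkept nlc'; lia.
  + by split=> // p s t q l hK /lp' ; exact: r3 hK.
  + by move=> p s t q l i hK e; have := dw _ _ _ _ _ _ hK e; case: (p == q); clear -V0' nkept nlc'; lia.
Qed.

Lemma prune v s w : v \in vsX -> ~~ looped esX v -> adj v s w ->
  (forall e, e \in esX -> inc v e -> e = eg v s w) -> False.
Proof.
move=> hv lv a unm; have [_ hw] := adj_vs a.
have wv : w != v by apply: contraNneq lv => e; rewrite e adj_loop in a; apply/loopedP; exists s.
pose es' : seq edge := filter (predC (inc v)) esX.
have lp' z r : lp es' z r <-> lp esX z r.
  rewrite /lp mem_filter; split=> [/andP[]//|h]; rewrite h andbT /inc /= orbb.
  by apply: contraNneq lv => <-; apply/loopedP; exists r.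
have looped' z : looped es' z = looped esX z by apply: looped_eq.
have se : size es' < size esX.
  rewrite size_filter -(count_predC (inc v) esX) -[X in X < _]add0n ltn_add2r -has_count.
  by apply/hasP; exists (eg v s w) => //; rewrite inc_eg eqxx.
have ne : nlc es' < nlc esX.
  rewrite /nlc -(count_filterC (@nl S) (inc v) esX) -/es' -[X in X < _]add0n ltn_add2r -has_count.
  apply/hasP; exists (eg v s w); first by rewrite mem_filter inc_eg eqxx.
  by rewrite eg_nl eq_sym.
have mrem z : (z \in rem v vsX) = (z != v) && (z \in vsX).
  by rewrite mem_rem_uniq ?(v_uniq vX) // !inE.
have sr := size_rem1 hv.
have V0' : V0 (rem v vsX) es' + 1 = V0 vsX esX.
  rewrite /V0 (permP (perm_to_rem hv)) /= lv addnC; congr (_ + _).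
  by apply: eq_count => z; rewrite -(looped' z).
have mu' : mu (State (rem v vsX) es' cnX) < mu X by rewrite /mu /=; clear -se ne; lia.
apply: (Xmin _ mu'); split=> //=.
- exact: rem_uniq (v_uniq vX).
- by move=> E; have := mrem w; rewrite E hw wv.
- move=> e; rewrite mem_filter => /andP[/= eo /(v_wf vX)[w1 w2 w3]].
  by move: eo; rewrite /inc negb_or !mrem => /andP[-> ->].
- move=> p r t q l hK; have [h1 h2 h3 h4 h5] := v_wfc vX hK.
  by split=> //; apply/lp'.
- move=> Y act W f' fe fc z; rewrite mrem => /andP[zv zz].
  have [aK _] := W.
  pose f z := if z == v then act s (f' w) else f' z.
  have fo y : y != v -> f y = f' y by rewrite /f => /negPf->.
  move=> r0; have <- := fo _ zv; apply: (@v_onto _ _ _ _ vX _ _ W f _ _ z zz r0).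
    move=> e eE; case: (boolP (inc v e)) => [/(unm _ eE)->|/[dup] nv].
      by apply/ok_eg => //; rewrite fo // {1}/f eqxx aK.
    rewrite /inc negb_or => /andP[h1 h2]; rewrite /ok !fo //; apply: fe.
    by rewrite mem_filter /= nv.
  move=> p r t q l hK; have [_ _ _ _ hK'] := v_wfc vX hK.
  by rewrite !fo ?(fc _ _ _ _ _ hK) //; apply: contraNneq lv => <-; apply: cn_looped; eassumption.
- by have := v_size vX; clear -se sr; lia.
- by have := v_nlc vX; clear -ne V0'; lia.
- case: (v_depth vX) => [ds|[[r2 r3] dw]]; [left|right; split].
  + by move=> p r t q l i hK e; have := ds _ _ _ _ _ _ hK e; clear -ne V0'; lia.
  + by split=> // p r t q l hK /lp' ; exact: r3 hK.
  + by move=> p r t q l i hK e; have := dw _ _ _ _ _ _ hK e; case: (p == q); clear -ne V0'; lia.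
Qed.

(** All letters exchange the two values [Some _] and fix [None]. Sending an isolated v to
    [Some true] and the rest to [None] is equivariant but does not send v to a fixed point. *)
Lemma not_isolated v (s : S) : v \in vsX -> exists2 e, e \in esX & inc v e.
Proof.
move=> hv; apply: contrapT => no.
have no' e : e \in esX -> ~~ inc v e by move=> eE; apply/negP => h; apply: no; exists e.
pose act (s : S) (y : option bool) := omap negb y.
have W : Wset m act.
  have aK r : involutive (act r) by case=> [[]|].
  split=> // r t y _; rewrite /per; elim: (m r t) => // M IH.
  by rewrite (mulnS 2) [alt _ _ _ _ _]/(alt act r t (2 * M) (act t (act r y))) aK.
have := @v_onto _ _ _ _ vX _ act W (fun z => if z == v then Some true else None) _ _ v hv s.
rewrite eqxx => H; suff : Some false = Some true by []. apply: H.
  by move=> e /no'; rewrite /inc negb_or /ok => /andP[/negPf-> /negPf->].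
move=> p r t q l hK; have [_ h1 h2 _ _] := v_wfc vX hK.
have := no' _ h1; have := no' _ h2; rewrite /inc /= !orbb => /negPf-> /negPf->.
by elim: l.-1 r t {hK h1 h2} => // M IH r t; rewrite /= -IH.
Qed.

(* The constraint between p and y makes the new loop and the deleted edge
   consequences of each other. *)
Lemma add_loop p s t h i y (e : edge) : s != t -> lp esX p s -> y \in vsX -> p != y ->
  e \in esX -> nl e -> 2 ^ i * h = 2 * m s t -> 0 < i ->
  nlc esX + i <= V0 vsX esX + k ->
  (forall q l, cnX p s t q l -> q = p /\ h < l) ->
  ~~ lp esX p t ->
  (forall (Y : Type) (act : S -> Y -> Y), Wset m act -> forall f : nat -> Y,
     (forall e', e' \in esX -> e' != e -> ok act f e') -> cn_ok act f cnX ->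
     f y = alt act t s h.-1 (f p) -> ok act f e) -> False.
Proof.
move=> st lps hy py eE ne hi i0 dep self npt impl.
pose b := lt_ s t h; pose a := lt_ t s h.
have h0 : 0 < h.
  by case: (h) hi => [|//]; rewrite muln0 => h0; have := m_pos st; rewrite -(ltn_pmul2l (isT : 0 < 2)) -h0.
have ab : a != b by rewrite /a /b /lt_; case: odd; rewrite // eq_sym.
have bs : lt_ b a h = s by exact: lt_lt.
have at_ : lt_ a b h = t by exact: lt_lt.
pose es' : seq edge := (y, b, y) :: rem e esX.
pose K1 p' s' t' q' l' := [\/ cnX p' s' t' q' l',
   [/\ p' = p, s' = s, t' = t, q' = y & l' = h] |
   [/\ p' = y, s' = b, t' = a, q' = p & l' = h]].
have lpo v r : lp esX v r -> lp es' v r by move=> hv; rewrite /lp inE; apply/orP; right; apply: lp_rem.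
have lpn v r : lp es' v r -> lp esX v r \/ (v = y /\ r = b).
  by rewrite /lp inE => /orP[/eqP[-> ->]|/lp_remW]; auto.
have loopn v : v != y -> looped es' v = looped esX v.
  move=> vy; apply: looped_eq => r; split=> [/lpn[//|[e0 _]]|]; last exact: lpo.
  by rewrite e0 eqxx in vy.
have loopy : looped es' y by apply/loopedP; exists b; rewrite /lp mem_head.
have se : size es' = size esX.
  by rewrite /= size_rem // prednK //; case: (esX) eE.
have nE : (nlc es').+1 = nlc esX.
  by rewrite -(nlc_rem eE ne) /nlc /= {1}/nl eqxx.
have V0E : V0 vsX es' + ~~ looped esX y = V0 vsX esX.
  have cc (P : pred nat) : count P vsX = P y + count P (rem y vsX).
    by rewrite (permP (perm_to_rem hy)).
  rewrite /V0 !cc; cbn beta; rewrite loopy add0n addnC; congr (_ + _).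
  apply: eq_in_count => v; rewrite mem_rem_uniq ?(v_uniq vX) // inE => /andP[vy _].
  by rewrite loopn.
have wb p0 s1 t0 q0 l0 i' : cnX p0 s1 t0 q0 l0 -> 2 ^ i' * l0 = 2 * m s1 t0 -> nlc esX + i' <= V0 vsX esX + k.
  by move=> hK; exact: (weak_bound hK).
have mba : m b a = m s t by rewrite /b /a /lt_; case: odd.
have newd i' : 2 ^ i' * h = 2 * m s t -> i' = i.
  by move=> e'; apply: (two_pow_inj h0); rewrite e' hi.
have mu' : mu (State vsX es' K1) < mu X by rewrite -[mu (State _ _ _)]/(size es' + nlc es') /mu; clear -se nE; lia.
apply: (Xmin _ mu'); split; cbn [vs es cn].
- exact: v_uniq vX.
- exact: v_ne vX.
- move=> e'; rewrite inE => /orP[/eqP->|/mem_rem /(v_wf vX)//] /=; by rewrite hy leqnn.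
- move=> p' s' t' q' l' [hK|[-> -> -> -> ->]|[-> -> -> -> ->]].
  + have [h1 h2 h3 h4 h5] := v_wfc vX hK; split=> //; [exact: lpo|exact: lpo|exact: Or31].
  + split=> //; [exact: lpo|by rewrite /lp mem_head|by exists i; rewrite ?i0|].
    exact: Or33.
  + split; rewrite ?bs ?at_ //; [by rewrite eq_sym|by rewrite /lp mem_head|exact: lpo|by exists i; rewrite ?i0 ?mba|].
    exact: Or32.
- move=> Y act W f' fe fc; apply: (@v_onto _ _ _ _ vX _ _ W f').
    have fe' e' : e' \in esX -> e' != e -> ok act f' e'.
      by move=> e'E ne'; apply: fe; rewrite inE in_rem ?orbT.
    move=> e' e'E; case: (eqVneq e' e) => [->|]; last exact: fe'.
    apply: (impl _ _ W _ fe'); first by move=> *; apply: fc; apply: Or31; eassumption.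
    by apply: fc; apply: Or32.
  by move=> *; apply: fc; apply: Or31; eassumption.
- by rewrite se; exact: v_size vX.
- by have := v_nlc vX; case: (looped esX y) V0E; clear -nE; lia.
(* If y had a loop, [V0] is unchanged and the deleted edge makes the depth strict. Otherwise [V0]
   falls with [nlc], but y occurred in no constraint before, so [reduced] needs checking only at p
   and for the new constraint. *)
- case: (boolP (looped esX y)) V0E => ly V0E.
    left=> p' s' t' q' l' i' [hK e'|[_ -> -> _ ->] /newd->|[_ -> -> _ ->]].
    + by have := wb _ _ _ _ _ _ hK e'; move: V0E; clear -nE; lia.
    + by move: V0E dep; clear -nE; lia.
    + by rewrite mba => /newd->; move: V0E dep; clear -nE; lia.
  have [r2 r3] := reducedX.
  have noty s1 t0 q0 l0 : ~ cnX y s1 t0 q0 l0 by move=> hK; rewrite (cn_looped hK) in ly.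
  right; split; last first.
    have dw := weakX.
    move=> p' s' t' q' l' i' [hK e'|[-> -> -> -> ->] /newd->|[-> -> -> -> ->]].
    + by have := dw _ _ _ _ _ _ hK e'; case: (p' == q'); move: V0E; clear -nE; lia.
    + by rewrite (negPf py); move: V0E dep; clear -nE; lia.
    + by rewrite mba eq_sym (negPf py) => /newd->; move: V0E dep; clear -nE; lia.
  split.
    move=> p' s' t' q' l' q2 l2 [hK|[e1 e2 e3 e4 e5]|[e1 e2 e3 e4 e5]]
      [hK2|[f1 f2 f3 f4 f5]|[f1 f2 f3 f4 f5]] le.
    + exact: r2 hK hK2 le.
    + rewrite f1 f2 f3 in hK; have [-> hl] := self _ _ hK; rewrite f1 f5; split=> // e0.
      by rewrite e0 ltnn in hl.
    + by rewrite f1 in hK; case: (noty _ _ _ _ hK).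
    + rewrite e1 e2 e3 in hK2; have [_ hl] := self _ _ hK2.
      by rewrite e5 leqNgt hl in le.
    + by rewrite e5 f5 e4 f4 ltnn.
    + by rewrite -e1 f1 eqxx in py.
    + by rewrite e1 in hK2; case: (noty _ _ _ _ hK2).
    + by rewrite -f1 e1 eqxx in py.
    + by rewrite e5 f5 e4 f4 ltnn.
  move=> p' s' t' q' l' [hK|[e1 e2 e3 e4 e5]|[e1 e2 e3 e4 e5]] /lpn[hl|[f1 f2]].
  + exact: r3 hK hl.
  + by rewrite f1 in hK; case: (noty _ _ _ _ hK).
  + by rewrite e1 e3 in hl; rewrite hl in npt.
  + by rewrite -e1 f1 eqxx in py.
  + by case/negP: ly; apply/loopedP; exists a; rewrite -e1 -e3.
  + by rewrite -f2 e3 eqxx in ab.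
Qed.

(** * The partial action carried by the folded graph *)

Definition hits (s : S) v := [seq e <- esX | (e.1.2 == s) && inc v e].
Definition ms (s : S) v := nilp (hits s v).
(** By [folded] all hits have the same far end, so the first one may be read. Loops and missing
    edges both give a fixed point; only [ms] separates them. *)
Definition io (s : S) v :=
  if hits s v is e :: _ then (if e.1.1 == v then e.2 else e.1.1) else v.

Lemma ms_fix s v : ms s v -> io s v = v.
Proof. by rewrite /ms /io; case: hits. Qed.

Lemma io_adj s v : ~~ ms s v -> adj v s (io s v).
Proof.
rewrite /ms /io; case E: (hits s v) => [//|e l] _.
have : e \in hits s v by rewrite E mem_head.
rewrite mem_filter => /andP[/andP[/eqP es iv] eE].
have [_ _ le] := v_wf vX eE; move: iv; rewrite /inc adjE.
case: eqP => [e1 _|_ /= /eqP e2].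
  by rewrite -e1 -es -eg_id.
by rewrite eg_sym -e2 -es -eg_id.
Qed.

Lemma adj_ms v s w : adj v s w -> ~~ ms s v.
Proof.
move=> a; rewrite /ms /nilp size_filter -lt0n -has_count; apply/hasP.
exists (eg v s w) => //; rewrite inc_eg eqxx andbT.
by rewrite /eg; case: ifP => /=.
Qed.

Lemma adjP v s w : adj v s w <-> ~~ ms s v /\ io s v = w.
Proof.
split=> [a|[h <-]]; last exact: io_adj.
have h := adj_ms a; split=> //; exact: folded (io_adj h) a.
Qed.

Lemma ioK s : involutive (io s).
Proof.
move=> v; case: (boolP (ms s v)) => h; first by rewrite !ms_fix.
have := io_adj h; rewrite adj_sym => /adjP[_ //].
Qed.

#[local] Hint Resolve ioK : core.

Lemma lpP v s : lp esX v s <-> ~~ ms s v /\ io s v = v.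
Proof. by rewrite -adj_loop; exact: adjP. Qed.

Lemma io_vs s v : v \in vsX -> io s v \in vsX.
Proof.
case: (boolP (ms s v)) => h; first by rewrite ms_fix.
by have [] := adj_vs (io_adj h).
Qed.

Lemma alt_vs a b i v : v \in vsX -> alt io a b i v \in vsX.
Proof. by elim: i a b v => //= i IH a b v /(io_vs a); exact: IH. Qed.

Lemma ms_vs s v : v \notin vsX -> ms s v.
Proof. by apply: contraNT => /io_adj /adj_vs[]. Qed.

Lemma step_adj a b i v : ~ refl_at io a b i v ->
  adj (alt io a b i v) (lt_ a b i) (alt io a b i.+1 v).
Proof.
move=> h; rewrite altS; apply: io_adj; apply/negP => /ms_fix; exact: h.
Qed.

(** * Counting branch vertices *)

Definition deg v := count (fun e : edge => nl e && inc v e) esX.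
(** A vertex that a path crosses by two different non-loop edges is unmarked exactly if it meets no
    other edge, which is what [fill] asks of the inner vertices of an arc. *)
Definition marked v := if looped esX v then 0 < deg v else 2 < deg v.

Lemma deg_ge v (l : seq edge) : uniq l -> all (fun e => (e \in esX) && (nl e && inc v e)) l ->
  size l <= deg v.
Proof.
move=> u /allP h; rewrite /deg -size_filter; apply: uniq_leq_size => // e /h /andP[h1 h2].
by rewrite mem_filter h2.
Qed.

Lemma loopless_deg v : v \in vsX -> ~~ looped esX v -> 2 <= deg v.
Proof.
move=> hv lv; rewrite ltnNge; apply/negP => d1.
have [e eE ie] := not_isolated s0 hv.
have nlE e' : e' \in esX -> inc v e' -> nl e'.
  move=> e'E i; apply: contraNT lv; rewrite /nl negbK => /eqP e0.
  by apply/hasP; exists e' => //; move: i; rewrite /inc /= e0 orbb => ->.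
pose w := if e.1.1 == v then e.2 else e.1.1.
have ee : e = eg v e.1.2 w.
  have [_ _ le] := v_wf vX eE; rewrite /w; move: ie; rewrite /inc.
  case: eqP => [<- _|_ /= /eqP e2]; first exact: eg_id.
  by rewrite eg_sym -e2; exact: eg_id.
apply: (prune hv lv (s := e.1.2) (w := w)).
  by rewrite adjE -ee.
move=> e' e'E ie'; rewrite -ee; apply/eqP/negPn/negP => ne.
suff : 2 <= deg v by rewrite ltnNge d1.
apply: (@deg_ge v [:: e; e']); first by rewrite /= inE eq_sym ne.
by rewrite /= eE e'E ie ie' !nlE.
Qed.

Lemma sum_deg : \sum_(v <- vsX) deg v <= 2 * nlc esX.
Proof.
rewrite /deg /nlc; elim: esX => [|e E IH]; first by rewrite /= big1.
rewrite /= big_split /= mulnDr leq_add //.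
case: (nl e); last by rewrite big1.
rewrite muln1; have -> : \sum_(v <- vsX) (true && inc v e : nat) = count (fun v => inc v e) vsX.
  by rewrite -sum1_count [RHS]big_mkcond; apply: eq_bigr => v _ /=; case: inc.
rewrite -size_filter; apply: (@uniq_leq_size _ _ [:: e.1.1; e.2]).
  exact: filter_uniq (v_uniq vX).
by move=> v; rewrite mem_filter /inc !inE => /andP[/orP[] /eqP->]; rewrite eqxx ?orbT.
Qed.

(** The comparison with the degree sum holds vertex by vertex: a loopless vertex has degree at least
    2, and a mark accounts for one more. *)
Lemma count_marked : 2 * V0 vsX esX + count marked vsX <= 2 * nlc esX.
Proof.
apply: leq_trans sum_deg; rewrite /V0.
have : {subset vsX <= vsX} by [].
elim: {1 3 4 5}vsX => [|v l IH] sub; first by rewrite big_nil.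
have {}IH : 2 * count (fun v : nat => ~~ looped esX v) l + count marked l <= \sum_(v <- l) deg v.
  by apply: IH => x xl; apply: sub; rewrite inE xl orbT.
have hd : 2 * ~~ looped esX v + marked v <= deg v.
  have hv : v \in vsX by apply: sub; rewrite mem_head.
  have := loopless_deg hv; rewrite /marked; case: (looped esX v) => /= [_|/(_ isT)].
    by clear; lia.
  by clear; lia.
by rewrite big_cons /= mulnDr addnACA leq_add.
Qed.

Lemma lbl_eg p (s : S) q : (eg p s q).1.2 = s.
Proof. by rewrite /eg; case: ifP. Qed.

Lemma unmarked_edges x y1 y2 g h e : x \in vsX -> ~~ marked x -> adj x g y1 -> adj x h y2 ->
  g != h -> y1 != x -> y2 != x -> e \in esX -> inc x e -> e = eg x g y1 \/ e = eg x h y2.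
Proof.
move=> hx um a1 a2 gh n1 n2 eE ie.
have ne12 : eg x g y1 != eg x h y2.
  by apply: contraNneq gh => /(congr1 (fun e : edge => e.1.2)); rewrite !lbl_eg => ->.
have d2 : 2 <= deg x.
  apply: (@deg_ge x [:: eg x g y1; eg x h y2]); first by rewrite /= inE ne12.
  by rewrite /= !eg_nl !inc_eg eqxx /= ![x == _]eq_sym n1 n2 !andbT; apply/andP.
have lx : ~~ looped esX x.
  by apply: contraNN um => lx; rewrite /marked lx (leq_trans _ d2).
rewrite /marked (negPf lx) -leqNgt in um.
have ne : nl e.
  apply: contraNT lx; rewrite /nl negbK => /eqP e0.
  by apply/hasP; exists e => //; move: ie; rewrite /inc /= e0 orbb => ->.
case: (eqVneq e (eg x g y1)) => [|h1]; first by left.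
case: (eqVneq e (eg x h y2)) => [|h2]; first by right.
suff : 3 <= deg x by rewrite ltnNge um.
apply: (@deg_ge x [:: e; eg x g y1; eg x h y2]).
  by rewrite /= !inE !negb_or h1 h2 ne12.
by rewrite /= !eg_nl !inc_eg eqxx /= ![x == _]eq_sym n1 n2 ne ie eE !andbT /=; apply/andP.
Qed.

(** Cut the path into M blocks of four. If each had a mark on one of its last three vertices, there
    would be M marked vertices, more than the degree count allows. *)
Lemma window (z : nat -> nat) M : (forall i j, i < j < 4 * M -> z i <> z j) ->
  (forall i, i < 4 * M -> z i \in vsX) -> 2 * nlc esX < 2 * V0 vsX esX + M ->
  exists j0, [/\ j0 + 4 <= 4 * M, ~~ marked (z j0.+1), ~~ marked (z j0.+2) & ~~ marked (z j0.+3)].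
Proof.
move=> dis zv big; apply: contrapT => no.
have cl N : N <= M -> N <= count marked (mkseq z (4 * N)).
  elim: N => // N IH NM; rewrite mulnS addnC /mkseq iotaD map_cat count_cat.
  have := IH (ltnW NM); rewrite /mkseq /=.
  suff : 0 < marked (z (4 * N).+1) + marked (z (4 * N).+2) + marked (z (4 * N).+3).
    by rewrite add0n; clear; lia.
  rewrite lt0n; apply/negP => /eqP h; apply: no; exists (4 * N).
  by move: h NM; clear; case: marked; case: marked; case: marked; split=> //; lia.
have := cl M (leqnn M); have := count_marked.
suff : count marked (mkseq z (4 * M)) <= count marked vsX by move: big; clear; lia.
rewrite -!size_filter; apply: uniq_leq_size.
  apply: filter_uniq; rewrite map_inj_in_uniq ?iota_uniq // => i j.
  rewrite !mem_iota !add0n => iM jM e; case: (ltngtP i j) => // l.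
    by case: (dis i j) => //; rewrite l.
  by case: (dis j i) => //; rewrite l.
move=> v; rewrite !mem_filter => /andP[-> /mapP[i]].
by rewrite mem_iota add0n => iM ->; rewrite zv.
Qed.

Lemma eg_pair p (s : S) q p' s' q' : eg p s q = eg p' s' q' ->
  (p = p' /\ q = q') \/ (p = q' /\ q = p').
Proof. by rewrite /eg; case: ifP => _; case: ifP => _ [] *; auto. Qed.

(** The position j0 of the arc comes out of the counting, so the last hypothesis has to recover four
    consecutive edges wherever they lie on the path. *)
Lemma arc_fill (z : nat -> nat) c d L M u a b u' : c != d ->
  (forall j, j < L -> adj (z j) (lt_ c d j) (z j.+1)) ->
  (forall i j, i < j <= L -> z i <> z j) ->
  4 * M <= L -> 2 * nlc esX < 2 * V0 vsX esX + M -> u \in vsX -> u' \in vsX ->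
  (forall j, 0 < j < L -> z j <> u /\ z j <> u') ->
  (forall j0, j0 + 4 <= L -> forall (Y : Type) (act : S -> Y -> Y), Wset m act ->
     forall f : nat -> Y,
     (forall j, j < L -> ~~ (j0 <= j < j0 + 4) -> f (z j.+1) = act (lt_ c d j) (f (z j))) ->
     (forall e, e \in esX -> (forall j, j0 <= j < j0 + 4 -> e <> eg (z j) (lt_ c d j) (z j.+1)) ->
        ok act f e) ->
     cn_ok act f cnX -> f u' = alt act a b 3 (f u) ->
     f (z (j0 + 4)) = alt act (lt_ c d j0) (lt_ d c j0) 4 (f (z j0))) -> False.
Proof.
move=> cd za zd ML big hu hu' zu impl.
have neq i j : i <= L -> j <= L -> i <> j -> z i != z j.
  move=> iL jL ij; apply/eqP; case: (ltngtP i j) => // l; first by apply: zd; rewrite l.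
  by move=> e; apply: (zd j i) => //; rewrite l.
have zv i : i < L -> z i \in vsX by move=> iL; have [] := adj_vs (za _ iL).
have [j0 [j4 u1 u2 u3]] : exists j0, [/\ j0 + 4 <= 4 * M, ~~ marked (z j0.+1), ~~ marked (z j0.+2) & ~~ marked (z j0.+3)].
  apply: (window _ _ big).
    by move=> i j /andP[ij jM]; apply: zd; rewrite ij; move: ML jM; clear; lia.
  by move=> i iM; apply: zv; move: ML iM; clear; lia.
have j4L : j0 + 4 <= L by exact: leq_trans j4 ML.
have jl i : i <= 3 -> j0 + i < L by move=> i3; move: i3 j4L; clear; lia.
set g := lt_ c d j0; set h := lt_ d c j0.
have gh : g != h by rewrite /g /h /lt_; case: odd; rewrite // eq_sym.
have l1 : lt_ c d j0.+1 = h by rewrite ltS.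
have l2 : lt_ c d j0.+2 = g by rewrite !ltS.
have l3 : lt_ c d j0.+3 = h by rewrite !ltS.
have b0 : j0 < L by have := jl 0 isT; rewrite addn0.
have b1 : j0.+1 < L by have := jl 1 isT; rewrite addn1.
have b2 : j0.+2 < L by have := jl 2 isT; rewrite addn2.
have b3 : j0.+3 < L by have := jl 3 isT; rewrite addn3.
have a0 := za _ b0; have a1 := za _ b1; have a2 := za _ b2; have a3 := za _ b3.
rewrite -/g in a0; rewrite l1 in a1; rewrite l2 in a2; rewrite l3 in a3.
have ne i j : j0 <= i <= j0.+4 -> j0 <= j <= j0.+4 -> i <> j -> z i != z j.
  by move=> hi hj; apply: neq; move: hi hj b3; clear; lia.
have xin (w : nat) : (forall j, 0 < j < L -> z j <> w) -> w \notin [:: z j0.+1; z j0.+2; z j0.+3].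
  move=> hw; rewrite !in_cons in_nil orbF !negb_or.
  by apply/and3P; split; apply/eqP => e; [apply: (hw j0.+1)|apply: (hw j0.+2)|apply: (hw j0.+3)]; rewrite ?ltn0Sn.
have nz (i j : nat) : j0 <= i <= j0.+4 -> i <> j -> j0 <= j <= j0.+4 -> (z i == z j) = false.
  by move=> hi ij hj; apply/negbTE/ne.
apply: (fill (c0 := z j0) (x1 := z j0.+1) (x2 := z j0.+2) (x3 := z j0.+3)
  (c4 := z j0.+4) (g := g) (h := h) (u := u) (a := a) (b := b) (u' := u')) => //.
- by rewrite /= !in_cons !in_nil !nz //; clear; lia.
- by rewrite !in_cons !in_nil !nz //; clear; lia.
- by rewrite !in_cons !in_nil !nz //; clear; lia.
- by apply: xin => j /zu[].
- by apply: xin => j /zu[].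
- have ue x y1 y2 g1 h1 e1 := @unmarked_edges x y1 y2 g1 h1 e1.
  have nn i j : j0 <= i <= j0.+4 -> i <> j -> j0 <= j <= j0.+4 -> z i != z j by move=> *; rewrite nz.
  have n10 : z j0 != z j0.+1 by apply: nn; clear; lia.
  have n12 : z j0.+2 != z j0.+1 by apply: nn; clear; lia.
  have n21 : z j0.+1 != z j0.+2 by apply: nn; clear; lia.
  have n23 : z j0.+3 != z j0.+2 by apply: nn; clear; lia.
  have n32 : z j0.+2 != z j0.+3 by apply: nn; clear; lia.
  have n34 : z j0.+4 != z j0.+3 by apply: nn; clear; lia.
  have hg : h != g by rewrite eq_sym.
  move: (a0) (a1) (a2); rewrite adj_sym => s1; rewrite adj_sym => s2; rewrite adj_sym => s3.
  move=> e x eE; rewrite !in_cons in_nil orbF => /or3P[] /eqP-> ie.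
  + case: (ue _ _ _ _ _ _ (zv _ b1) u1 s1 a1 gh n10 n12 eE ie) => ->.
      by rewrite eg_sym eqxx.
    by rewrite eqxx !orbT.
  + case: (ue _ _ _ _ _ _ (zv _ b2) u2 s2 a2 hg n21 n23 eE ie) => ->.
      by rewrite eg_sym eqxx !orbT.
    by rewrite eqxx !orbT.
  + case: (ue _ _ _ _ _ _ (zv _ b3) u3 s3 a3 gh n32 n34 eE ie) => ->.
      by rewrite eg_sym eqxx !orbT.
    by rewrite eqxx !orbT.
move=> Y act W f fe fc fu; have [aK _] := W.
rewrite -[j0.+4]addn4; apply: (impl j0 j4L Y act W f _ _ fc fu).
  move=> j jL jw; apply/ok_eg => //; apply: fe; first exact: za.
  have bad i : j0 <= i < j0 + 4 -> eg (z j) (lt_ c d j) (z j.+1) <> eg (z i) (lt_ c d i) (z i.+1).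
    move=> iw e; have ij : i <> j by move=> E; rewrite -E iw in jw.
    have iL : i < L by move: iw j4L; clear; lia.
    case: (eg_pair e) => -[/eqP e1 /eqP e2].
      by move: e1; apply/negP/neq; [exact: ltnW|exact: ltnW|move=> E; apply: ij].
    case: (eqVneq j i.+1) => E.
      move: e2; rewrite E; apply/negP/neq; [by rewrite -E|exact: ltnW|].
      by clear; lia.
    by move: e1; apply/negP/neq; [exact: ltnW|exact: iL|exact/eqP].
  rewrite !in_cons in_nil orbF !negb_or; apply/and4P; split; apply/eqP.
  - by apply: (bad j0); clear; lia.
  - by rewrite -l1; apply: (bad j0.+1); clear; lia.
  - by rewrite -l2; apply: (bad j0.+2); clear; lia.
  - by rewrite -l3; apply: (bad j0.+3); clear; lia.
move=> e eE he; apply: fe => //.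
rewrite !in_cons in_nil orbF !negb_or; apply/and4P; split; apply/eqP.
- by apply: (he j0); clear; lia.
- by rewrite -l1; apply: (he j0.+1); clear; lia.
- by rewrite -l2; apply: (he j0.+2); clear; lia.
- by rewrite -l3; apply: (he j0.+3); clear; lia.
Qed.

(** * Bounds on the lengths of segments *)

Lemma V0_nlc : V0 vsX esX <= nlc esX.
Proof. by have := count_marked; clear; lia. Qed.

Lemma fst_adj a b i v i0 : (forall r, r < i0 -> ~ refl_at io a b r v) -> i < i0 ->
  adj (alt io a b i v) (lt_ a b i) (alt io a b i.+1 v).
Proof. by move=> h /h; exact: step_adj. Qed.

(* In a longer segment, the relation (ab)^m supplies a path of three edges
   that makes four edges of the segment redundant. *)
Lemma no_loop_seg u a b i0 : u \in vsX -> a != b -> ms a u -> refl_at io b a i0 u ->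
  (forall r, r < i0 -> ~ refl_at io b a r u) -> i0 + 4 <= 2 * m a b.
Proof.
move=> hu ab mu_ r0 fst; rewrite leqNgt; apply/negP => big.
have M0 := mbig ab; have n2 : n < 2 ^ n by exact: ltn_expl.
have iu : io a u = u by apply: ms_fix.
(* These edges of the segment and the three of the new path make up the relation of length 2m. *)
pose L := 2 * m a b - 3.
have L3 : L + 3 = 2 * m a b by rewrite /L; move: M0 n2; clear; lia.
have Li : L <= i0 by rewrite /L; move: big; clear; lia.
have oL : odd L.
  have : odd (L + 3) = false by rewrite L3 oddM.
  by rewrite oddD /= addbT => /negbFE.
pose z j := alt io b a j u.
have dis := seg_distinct ioK iu fst.
apply: (@arc_fill z b a L (2 * k) (z L) a b (z 0)).
- by rewrite eq_sym.
- by move=> j jL; apply: (fst_adj fst); exact: leq_trans Li.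
- by move=> i j /andP[ij jL]; apply: dis; rewrite ij (leq_trans jL).
- by move: L3 M0 n2 kn; clear; lia.
- by have := v_nlc vX; clear; lia.
- exact: alt_vs.
- exact: alt_vs.
- move=> j /andP[j0 jL]; split; first by apply: dis; rewrite jL.
  by move=> e; apply: (dis 0 j) => //; rewrite j0 ltnW // (leq_trans jL).
move=> j0 j4 Y act W f fz fe fc fu; have [aK pr] := W.
pose y := f (z 0).
have fL : f (z L) = alt act b a L y.
  have p : alt act b a (L + 3) y = y by rewrite L3 msym; apply: pr; rewrite eq_sym.
  rewrite altD in p; have e1 : lt_ b a L = a by rewrite /lt_ oL.
  have e2 : lt_ a b L = b by rewrite /lt_ oL.
  rewrite e1 e2 in p; apply: (@alt_inj _ _ act aK a b 3).
  by rewrite p -fu.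
have f0 : f (z j0) = alt act b a j0 y.
  apply: (@walk_up _ _ act b a (fun j => f (z j)) j0) => j jj; apply: fz; move: jj j4; clear; lia.
have f4 : f (z (j0 + 4)) = alt act b a (j0 + 4) y.
  apply: (walk_down aK (F := fun j => f (z j)) fL j4) => j /andP[h1 h2]; apply: fz => //.
  by rewrite negb_and -leqNgt h1 orbT.
by rewrite f4 altD f0.
Qed.

Lemma eg_seg_neq a b i0 v i j : io b v = v -> (forall r, r < i0 -> ~ refl_at io a b r v) ->
  i < j < i0 ->
  eg (alt io a b j v) (lt_ a b j) (alt io a b j.+1 v) !=
  eg (alt io a b i v) (lt_ a b i) (alt io a b i.+1 v).
Proof.
move=> hv fst /andP[ij ji]; have dis := seg_distinct ioK hv fst.
apply/eqP => /eg_pair[[e _]|[_ e]].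
  by apply: (dis i j) => //; rewrite ij ltnW.
by apply: (dis i j.+1) => //; rewrite ji ltnS ltnW.
Qed.

(** Otherwise the two extremities are identified and the first edge dropped. The merged vertex is
    fixed by both s and t, so any map is constant along the segment and the dropped edge follows. *)
Lemma two_loops p s t i1 : lp esX p s -> s != t -> refl_at io t s i1 p ->
  (forall r, r < i1 -> ~ refl_at io t s r p) -> ~~ ms (lt_ t s i1) (alt io t s i1 p) -> i1 = 0.
Proof.
move=> lps st r1 fst nms; case: (posnP i1) => // i1p; exfalso.
have [mp ip] := (lpP p s).1 lps.
have hp : p \in vsX by have [] := v_wf vX lps.
pose z j := alt io t s j p.
have dis := seg_distinct ioK ip fst.
have hq : z i1 \in vsX by exact: alt_vs.
have pq : p != z i1 by apply/eqP => e; apply: (dis 0 i1) => //; rewrite i1p leqnn.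
have lq : lp esX (z i1) (lt_ t s i1) by apply/lpP.
have a0 : adj p t (z 1) := fst_adj fst i1p.
have nl0 : nl (eg p t (z 1)).
  by rewrite eg_nl; apply/eqP => e; apply: (dis 0 1).
have edge_ok (Y : Type) (act : S -> Y -> Y) (f : nat -> Y) : Wset m act ->
   act s (f p) = f p -> act t (f p) = f p -> f p = f (z i1) ->
   (forall j, 0 < j < i1 -> ok act f (eg (z j) (lt_ t s j) (z j.+1))) ->
   ok act f (eg p t (z 1)).
  move=> [aK _] fs ft fq he; apply/ok_eg => //; rewrite ft.
  have -> : f (z 1) = alt act t s 1 (f p).
    apply: (walk_down aK (F := fun j => f (z j)) (L := i1)) => //.
      by rewrite -fq alt_fix.
    by move=> j hj; apply/ok_eg => //; apply: he.
  by rewrite /= ft.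
have seg_in j : 0 < j < i1 -> eg (z j) (lt_ t s j) (z j.+1) \in esX /\
   eg (z j) (lt_ t s j) (z j.+1) != eg p t (z 1).
  move=> /andP[j0 ji]; split; first exact: (fst_adj fst).
  by apply: (@eg_seg_neq t s i1 p 0 j) => //; rewrite j0.
case: (boolP (odd i1)) => od; last first.
  have lt1 : lt_ t s i1 = t by rewrite /lt_ (negPf od).
  rewrite lt1 in lq.
  apply: (ident_rem hp hq pq a0 nl0) => Y act W f fe fc fq; have [aK _] := W.
  apply: edge_ok => //.
  - by have := fe _ lps (nl_not_lp _ _ nl0); rewrite /ok /= => <-.
  - by rewrite fq; have := fe _ lq (nl_not_lp _ _ nl0); rewrite /ok /= => <-.
  - by move=> j /seg_in[h1 h2]; apply: fe.
have lt1 : lt_ t s i1 = s by rewrite /lt_ od.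
rewrite lt1 in lq; set q := z i1 in lq hq pq edge_ok *.
pose E0 := rem (q, s, q) (rem (eg p t (z 1)) esX).
have lpE v r : (v, r) != (q, s) -> lp esX v r -> lp E0 v r.
  move=> ne h; apply: in_rem; first exact: lp_rem.
  by apply: contraNneq ne => -[-> ->].
have lq' : (q, s, q) \in rem (eg p t (z 1)) esX by exact: lp_rem.
have sz : (size E0).+2 = size esX.
  by rewrite (perm_size (perm_to_rem a0)) /= (perm_size (perm_to_rem lq')).
apply: (@ident_nl p q ((q, t, q) :: E0)) => //.
- move=> e; rewrite inE => /orP[/eqP->|/mem_rem /mem_rem /(v_wf vX)//] /=.
  by rewrite hq leqnn.
- by rewrite /= -sz.
- have := nlc_rem a0 nl0; move=> <-; rewrite ltnS /nlc /= {1}/nl /= eqxx /=.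
  by apply: leq_count_subseq; exact: rem_subseq.
- move=> v; case: (eqVneq v q) => [->|vq].
    by apply/loopedP/loopedP => _; [exists s|exists t; rewrite /lp mem_head].
  apply: looped_eq => r; rewrite /lp inE; split=> [/orP[/eqP[e]|/mem_rem /mem_rem //]|h].
    by rewrite e eqxx in vq.
  by apply/orP; right; apply: lpE => //; rewrite xpair_eqE (negPf vq).
- case/negP; apply/andP; split; apply/loopedP; by exists s.
- move=> v r h; case: (eqVneq (v, r) (q, s)) => [[-> ->]|ne].
    by right; split; [right|left; rewrite /lp inE; apply/orP; right; apply: lpE => //; rewrite xpair_eqE (negPf pq)].
  by left; rewrite /lp inE; apply/orP; right; apply: lpE.
move=> Y act W f fe fc fq; have [aK _] := W.
have fps : act s (f p) = f p.
  have h : lp E0 p s by apply: lpE => //; rewrite xpair_eqE (negPf pq).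
  have : ok act f (p, s, p) by apply: fe; rewrite inE; apply/orP; right.
  by rewrite /ok /= => <-.
have fpt : act t (f p) = f p.
  have : ok act f (q, t, q) by apply: fe; rewrite mem_head.
  by rewrite /ok /= fq => <-.
have other e : e \in esX -> e != (q, s, q) -> e != eg p t (z 1) -> ok act f e.
  by move=> eE n1 n2; apply: fe; rewrite inE; apply/orP; right; apply: in_rem => //; apply: in_rem.
move=> e eE; case: (eqVneq e (q, s, q)) => [->|n1]; first by rewrite /ok /= -fq fps.
case: (eqVneq e (eg p t (z 1))) => [->|n2]; last exact: other.
apply: edge_ok => // j /[dup] hj /seg_in[h1 h2]; apply: other => //.
apply/eqP => e0; have : nl (eg (z j) (lt_ t s j) (z j.+1)) by rewrite eg_nl; apply/eqP; apply: dis; case/andP: hj => _ ->; rewrite ltnSn.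
by rewrite e0 /nl eqxx.
Qed.

(** With no edge missing a reflection is a loop, and [two_loops] shrinks the orbit to a point.
    Without reflections the orbit is a cycle of even length r. If r > 2, the vertices 0 and 2 are
    identified; st then acts trivially there and the closing edge is redundant. *)
Lemma closedX : closed_pg m io ms.
Proof.
move=> v s t st nms; have hv : v \in vsX by apply: contraT => /(@ms_vs s) h; have := nms 0; rewrite h.
pose z i := alt io s t i v.
have hz i : z i \in vsX by exact: alt_vs.
have m0 : 0 < m s t by exact: (m_pos).
case: (pselect (exists r, refl_at io s t r v)) => [[r hr]|no].
  have ex : exists r, `[< refl_at io s t r v >] by exists r; apply/asboolP.
  case: (ex_minnP ex) => i /asboolP hi imin {r hr ex}.
  set a := lt_ s t i; set b := lt_ t s i; set p := z i.
  have ap : io a p = p by [].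
  have lpa : lp esX p a by apply/lpP; split=> //; exact: nms.
  have ab : a != b by rewrite /a /b /lt_; case: odd; rewrite // eq_sym.
  have [i1 r1 f1] : exists2 i0, refl_at io b a i0 p & forall r, r < i0 -> ~ refl_at io b a r p.
    by apply: (first_refl ioK (W := vsX)) => // j; apply: alt_vs; exact: hz.
  have zj j : alt io b a j p = z (i.+1 + j).
    by rewrite /z altD altS -/a -/p ap !ltS.
  have lj j : lt_ b a j = lt_ s t (i.+1 + j).
    by rewrite /a /b /lt_ addSn /= oddD; case: (odd i); case: (odd j).
  have i10 : i1 = 0.
    by apply: (two_loops lpa ab r1 f1); rewrite lj zj; exact: nms.
  have bp : io b p = p by move: r1; rewrite i10.
  suff i00 : i = 0.
    by apply: alt_fix; [move: ap|move: bp]; rewrite /p /a /b i00.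
  case: (posnP i) => // i_gt0; suff /asboolP/imin : refl_at io s t i.-1 v by lia.
  have lb : lt_ s t i.-1 = b by rewrite /b; case: (i) i_gt0 => //= j _; rewrite ltS.
  have : p = io b (z i.-1) by rewrite -lb -altS prednK.
  by rewrite /refl_at lb => e; rewrite -/(z i.-1) -e -{1}bp e ioK.
have noz i j : i < j -> z i = z j -> ~~ odd (j - i).
  move=> ij e; apply/negP => od; have [r _ h] := collision_odd ioK ij od e.
  by apply: no; exists r.
have [i [j [ij e]]] := pigeon hz.
have ex : exists r, (0 < r) && (z r == v).
  exists (j - i); rewrite subn_gt0 ij; apply/eqP.
  exact/esym/(collision_even ioK (ltnW ij) (noz _ _ ij e) e).
case: (ex_minnP ex) => r /andP[r0 /eqP zr] rmin.
have evr : ~~ odd r by have := noz 0 r r0; rewrite subn0; apply.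
have {}rmin q : 0 < q < r -> z q <> v.
  by case/andP=> q0 qr /eqP zq; have := rmin q; rewrite q0 zq => /(_ isT); lia.
case: (eqVneq r 2) => [r2|r2].
  apply: (@per_dvd _ _ io s t 2) => //; first by rewrite -{2}zr r2.
  exact: dvdn_mulr.
exfalso.
have adjz q : adj (z q) (lt_ s t q) (z q.+1).
  by apply: step_adj => h; apply: no; exists q.
have r1 : 0 < r.-1 < r by case: r {zr rmin} r0 evr r2 => [|[]] //= *; lia.
have rr : r.-1.+1 = r by lia.
have lr : lt_ s t r.-1 = t.
  by rewrite /lt_; have -> : odd r.-1 by move: evr; rewrite -{1}rr /= negbK.
have ae := adjz r.-1; rewrite lr rr zr in ae.
have ne02 : z 0 != z 2.
  by apply/eqP => e2; apply: (rmin 2) => //; move: r1 r2 evr; case: (r) => [|[|[|[]]]].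
apply: (ident_rem (hz 0) (hz 2) ne02 ae).
  by rewrite eg_nl; apply/eqP; exact: rmin.
move=> Y act W f fe _ f02; have [aK _] := W.
have fz q : q < r.-1 -> f (z q.+1) = act (lt_ s t q) (f (z q)).
  move=> qr; apply/ok_eg => //; apply: fe; first exact: adjz.
  apply/eqP => E; case: (eg_pair E) => -[e1 e2].
    by apply: (rmin q.+1) => //; move: qr rr; clear; lia.
  case: (posnP q) => [q0|q0]; last by apply: (rmin q) => //; rewrite q0; move: qr r1; clear; lia.
  move: E => /(congr1 (fun e : edge => e.1.2)); rewrite !lbl_eg q0 => E.
  by move: st; rewrite /lt_ /= in E; rewrite E eqxx.
have p1 : per act s t 1 (f v).
  have b0 : 0 < r.-1 by case/andP: r1.
  have b1 : 1 < r.-1.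
    by move: r1 r2 evr; clear; lia.
  by rewrite /per /= -[RHS]/(f (z 0)) [RHS]f02 (fz _ b1) (fz _ b0).
apply/ok_eg => //; rewrite (walk_up (act := act) (c := s) (d := t) (F := fun j => f (z j)) (N := r.-1)) //.
have := @per_mul _ _ act s t 1 r./2 _ p1.
have -> : per act s t (r./2 * 1) (f v) = (alt act s t r (f v) = f v).
  by rewrite /per muln1 mul2n even_halfK.
by rewrite -{1}rr altS lr => ->.
Qed.

Local Notation fst_at := (fst_at io).

Lemma depth_le i : nlc esX + i <= V0 vsX esX + k -> i <= k.
Proof. by have := V0_nlc; clear; lia. Qed.

(** The halving step. If the segment reached step [h - 1], half-way along the period [2 * h], a loop
    could be placed there in exchange for the first edge, which is recovered by walking back from
    the new loop along the constraint. *)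
Lemma self_seg p s t i1 i h : lp esX p s -> s != t -> fst_at t s i1 p ->
  2 ^ i * (2 * h) = 2 * m s t -> nlc esX + i + 1 <= V0 vsX esX + k ->
  (forall q l, cnX p s t q l -> q = p /\ 2 * h <= l) -> i1 + 2 <= h.
Proof.
move=> lps st f1 hi dep self; rewrite leqNgt; apply/negP => big.
have [ip r1 fst] := f1; have dis := fst_dis ioK f1.
have ik : i.+1 <= k by apply: depth_le; rewrite addnS -addn1.
(* At most k halvings occur and k < n, so the period is still far from being exhausted. *)
have h2 : 1 < h.
  rewrite ltnNge; apply/negP => h1.
  have M0 := mbig st; have : 2 ^ i.+1 <= 2 ^ n by rewrite leq_exp2l // ltnW // (leq_ltn_trans ik).
  have n0 : 0 < 2 ^ n by rewrite expn_gt0.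
  have : 2 ^ i * (2 * h) <= 2 ^ i * (2 * 1) by rewrite !leq_mul2l h1 !orbT.
  by rewrite hi expnS; move: M0 n0; clear; lia.
have i10 : 0 < i1 by move: big h2; clear; lia.
have hp : p \in vsX by have [] := v_wf vX lps.
pose z j := alt io t s j p.
have a0 : adj p t (z 1) := fst_adj fst i10.
apply: (@add_loop p s t h i.+1 (z h.-1) (eg p t (z 1))) => //.
- exact: alt_vs.
- apply/eqP => e; apply: (dis 0 h.-1) => //; move: big h2; clear; lia.
- by rewrite eg_nl; apply/eqP => e; apply: (dis 0 1).
- by rewrite expnS -hi mulnCA mulnA.
- by rewrite addnS -addn1.
- by move=> q l /self[-> hl]; split=> //; move: hl h2; clear; lia.
- by apply/negP => /lpP[_ e]; apply: (fst 0).
move=> Y act W f fe _ fy; have [aK _] := W; apply/ok_eg => //.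
apply: (walk_down aK (c := t) (d := s) (F := fun j => f (z j)) (L := h.-1)) => //.
  by move: h2; clear; lia.
move=> j /andP[j1 jh]; have ji : j < i1 by move: jh big; clear; lia.
apply/ok_eg => //; apply: fe; first exact: (fst_adj fst).
by apply: (@eg_seg_neq t s i1 p 0 j) => //; rewrite j1.
Qed.

Lemma con_ms p s t q l i1 : cnX p s t q l -> q <> p -> fst_at t s i1 p ->
  ms (lt_ t s i1) (alt io t s i1 p).
Proof.
move=> K qp [ip r1 fst]; apply: contraT => nms; case: qp.
have [st lps _ _ _] := v_wfc vX K.
have i10 := two_loops lps st r1 fst nms.
have [_ r3] := reducedX.
by apply: (r3 _ _ _ _ _ K); apply/lpP; move: nms r1; rewrite i10.
Qed.

(** Segments that meet lie in the same orbit, so q would be on the segment of p. Having a loop, q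
    could only be an extremity; but the far one is open by [con_ms] and the near one is p. *)
Lemma con_disjoint p s t q l i1 i2 : cnX p s t q l -> q <> p -> fst_at t s i1 p ->
  fst_at (lt_ t s l) (lt_ s t l) i2 q ->
  forall i j, i <= i1 -> j <= i2 ->
  alt io t s i p <> alt io (lt_ t s l) (lt_ s t l) j q.
Proof.
move=> K qp f1 f2 i j ii jj e; have nm := con_ms K qp f1.
have [st lps lq _ _] := v_wfc vX K.
set b := lt_ s t l in e f2 lq; set b' := lt_ t s l in e f2.
have hb : b = t \/ b = s by rewrite /b /lt_; case: odd; auto.
have hb' : b' = t \/ b' = s by rewrite /b' /lt_; case: odd; auto.
have bb c d N : c = t \/ c = s -> d = t \/ d = s -> lt_ c d N = t \/ lt_ c d N = s.
  by rewrite /lt_; case: odd.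
have [r ri] := fst_closed_alt ioK j f1 ii (bb _ _ j hb hb') (bb _ _ j hb' hb).
rewrite e alt_back // subnn /= => {}e.
have /lpP[nq iq] := lq.
have : b = lt_ t s r \/ b = lt_ s t r by move: hb; rewrite /lt_; case: odd; case; auto.
have [ip r1 fst] := f1.
case=> Eb.
  move: ri; rewrite leq_eqVlt => /orP[/eqP ri|ri].
    by move: nq; rewrite e Eb ri nm.
  by apply: (fst r ri); rewrite /refl_at -Eb -e.
case: r ri e Eb => [|r] ri e Eb; first by apply: qp.
apply: (fst_dis ioK f1 (j := r) (r := r.+1)); first by rewrite leqnn.
rewrite ltS in Eb; rewrite -e -iq Eb e; by rewrite altS ioK.
Qed.

(** The constraint now plays the part of the relation: three new edges join the two segments into a
    walk of length [l - 1] from p to q. The arc is taken from the longer segment, so that it can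
    have about half of l. *)
Lemma con_seg_le p s t q l i1 i2 : cnX p s t q l -> q <> p -> fst_at t s i1 p ->
  fst_at (lt_ t s l) (lt_ s t l) i2 q -> i2 <= i1 -> i1 + i2 + 5 <= l.
Proof.
move=> K qp f1 f2 le; rewrite leqNgt; apply/negP => big.
have [st lps lq [i hi _] _] := v_wfc vX K.
have [vp vq] := cn_vs K.
have disj := con_disjoint K qp f1 f2.
have [ip r1 fst] := f1; have dis := fst_dis ioK f1.
have [iq r2 fst2] := f2.
have dep := weakX K hi.
rewrite eq_sym (negPf (introN eqP qp)) addn0 in dep.
have ik := depth_le dep.
(* This is where the constant is spent: [2 * m s t] is at least [12 * 2^n], hence [24 * 2^k], and i
   halvings divide it by [2^i]. Half of the result exceeds the [8 * (k - i) + 4] edges that the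
   window requires. *)
have bl : 24 * 2 ^ (k - i) <= l.
  rewrite -(@leq_pmul2l (2 ^ i)) ?expn_gt0 // hi mulnCA -expnD subnKC //.
  have := mbig st; have : 2 ^ k.+1 <= 2 ^ n by rewrite leq_exp2l.
  by rewrite expnS; clear; lia.
have dk : k - i < 2 ^ (k - i) by exact: ltn_expl.
(* The numbers x and y count the vertices used on the two segments; [x - 1] steps, three new edges
   and [y - 1] steps add up to [l - 1]. *)
pose y := minn i2.+1 ((l - 2) %/ 2); pose x := l - 2 - y.
have [x1 x2 y1 y2] : [/\ 8 * (k - i) + 5 <= x, x <= i1.+1, 1 <= y & y <= i2.+1].
  by rewrite /x /y; move: bl dk big le; clear; split; lia.
have xy : x + y + 2 = l by rewrite /x /y; move: bl dk; clear; lia.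
pose L := x.-1; have xL : x = L.+1 by rewrite /L; move: x1; clear; lia.
pose w j := alt io (lt_ t s l) (lt_ s t l) j q.
have yy : y = y.-1.+1 by rewrite prednK.
apply: (@arc_fill (fun j => alt io t s j p) t s L (2 * (k - i) + 1)
   (alt io t s L p) (lt_ t s L) (lt_ s t L) (w y.-1)).
- by rewrite eq_sym.
- by move=> j jL; apply: (fst_adj fst); move: jL xL x2; clear; lia.
- by move=> j r /andP[jr rL]; apply: dis; rewrite jr; move: rL xL x2; clear; lia.
- by move: xL x1; clear; lia.
- by move: dep ik; clear; lia.
- exact: alt_vs.
- exact: alt_vs.
- move=> j /andP[j0 jL]; split.
    by apply: dis; rewrite jL; move: xL x2; clear; lia.
  by apply: disj; [move: jL xL x2|move: y1 y2]; clear; lia.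
move=> j0 j4 Y act W f fz fe fc fu; have [aK pr] := W.
have fq := fc _ _ _ _ _ K.
have fw : f (w y.-1) = alt act (lt_ t s l) (lt_ s t l) y.-1 (f q).
  apply: (@walk_up _ _ act _ _ (fun j => f (w j))) => j jy.
  have ji : j < i2 by move: jy y2 yy; clear; lia.
  apply/ok_eg => //; apply: fe; first exact: (fst_adj fst2).
  move=> r /andP[_ rj] E.
  have rL : r < i1 by move: rj j4 xL x2; clear; lia.
  by case: (eg_pair E) => -[e1 e2]; [apply: (disj r j)|apply: (disj r.+1 j)]; rewrite ?(ltnW rL) ?(ltnW ji).
have fL : f (alt io t s L p) = alt act t s L (f p).
  apply: (@alt_inj _ _ act aK (lt_ t s L) (lt_ s t L) 3).
  rewrite -fu fw fq -altD.
  have l1 : l = l.-1.+1 by move: xy; clear; lia.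
  rewrite {1 2}l1 !ltS alt_back //; last by move: xy x1 y1; clear; lia.
  by congr (alt act t s _ (f p)); move: xy xL y1; clear; lia.
have f0 : f (alt io t s j0 p) = alt act t s j0 (f p).
  apply: (@walk_up _ _ act t s (fun j => f (alt io t s j p)) j0) => j jj; apply: fz; move: jj j4; clear; lia.
rewrite f0 -altD.
apply: (walk_down aK (F := fun j => f (alt io t s j p)) fL j4) => j /andP[h1 h2]; apply: fz => //.
by rewrite negb_and -leqNgt h1 orbT.
Qed.

Lemma con_seg p s t q l i1 i2 : cnX p s t q l -> q <> p -> fst_at t s i1 p ->
  fst_at (lt_ t s l) (lt_ s t l) i2 q -> i1 + i2 + 5 <= l.
Proof.
move=> K qp f1 f2; case: (leqP i2 i1) => [|/ltnW] le; first exact: (con_seg_le K qp f1 f2).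
have [_ _ _ _ K'] := v_wfc vX K.
rewrite (addnC i1); apply: (con_seg_le K' _ f2 _ le); first by move=> e; apply: qp.
by rewrite !lt_lt.
Qed.

(** * Gaps between open ends *)

Local Notation opend := (opend S nat).
Local Notation isend := (is_end ms).
Local Notation oth := (oth_end io).
Local Notation stuck := (stuck_at io ms).
Implicit Type e : opend.

(** An odd l would put a loop labelled t at p too; the segment would be the point p, with neither
    letter missing. *)
Lemma cn_even p s t l i : cnX p s t p l -> fst_at t s i p ->
  ms (lt_ t s i) (alt io t s i p) -> ~~ odd l.
Proof.
move=> K [ip r1 fst] nm; apply/negP => ol; have [st lps lq _ _] := v_wfc vX K.
have [nt it] : ~~ ms t p /\ io t p = p by apply/lpP; move: lq; rewrite /lt_ ol.
have i0 : i = 0 by case: i r1 fst nm => // i _ /(_ 0 isT); case.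
by move: nm; rewrite i0 /= (negPf nt).
Qed.

(* The {s,t}-segment of p, with a loop s at p, and an open end e at its other
   extremity. *)
Definition root e p s t i :=
  [/\ lp esX p s, s != t, fst_at t s i p, ms (lt_ t s i) (alt io t s i p) &
      e = (alt io t s i p, lt_ t s i, lt_ s t i)].

(** A segment with i edges has [i + 1] vertices. An open one is completed to 2m steps. A loop at p
    makes the walk traverse the segment twice, so l steps leave [l - 2 * (i + 1)] for the gap. A
    constraint between p and q describes an orbit folded at two loops, with l vertices: both
    segments and the gap between them. *)
Inductive gap e : opend -> nat -> Prop :=
| gap_free i : fst_at e.2 e.1.2 i e.1.1 -> ms (lt_ e.2 e.1.2 i) (alt io e.2 e.1.2 i e.1.1) ->
    gap e (oth e i) (2 * m e.1.2 e.2 - i.+1)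
| gap_self p s t i l : root e p s t i -> (forall q l', cnX p s t q l' -> q = p /\ l <= l') ->
    l = 2 * m s t \/ cnX p s t p l -> gap e e (l - 2 * i.+1)
| gap_con p s t i q l e' i' : root e p s t i -> cnX p s t q l -> q <> p ->
    root e' q (lt_ s t l) (lt_ t s l) i' -> gap e e' (l - i.+1 - i'.+1).

Lemma root_end e p s t i : root e p s t i -> isend e.
Proof.
by case=> _ st _ h ->; rewrite /is_end h /= andbT /lt_; case: odd; rewrite // eq_sym.
Qed.

Lemma root_fst e p s t i : root e p s t i ->
  [/\ fst_at e.2 e.1.2 i e.1.1, p = alt io e.2 e.1.2 i e.1.1,
      s = lt_ e.2 e.1.2 i & t = lt_ e.1.2 e.2 i].
Proof. by case=> _ _ f1 _ -> /=; have [h1 h2 h3 h4] := fst_rev ioK f1. Qed.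

Lemma root_not_ms e p s t i : root e p s t i -> ~~ ms (lt_ e.2 e.1.2 i) (alt io e.2 e.1.2 i e.1.1).
Proof. by move=> r; have [_ <- <- _] := root_fst r; case: r => /lpP[]. Qed.

Lemma root_uniq e p s t i p' s' t' i' : root e p s t i -> root e p' s' t' i' ->
  [/\ p = p', s = s', t = t' & i = i'].
Proof.
move=> r r'; have [f h1 h2 h3] := root_fst r; have [f' h1' h2' h3'] := root_fst r'.
have ii := fst_uniq f f'; rewrite -ii in h1' h2' h3'.
by rewrite h1 h2 h3 h1' h2' h3'.
Qed.

Lemma root_det e e' p s t i i' : root e p s t i -> root e' p s t i' -> e = e' /\ i = i'.
Proof.
by move=> [_ _ f _ ->] [_ _ f' _ ->]; rewrite (fst_uniq f f').
Qed.

Lemma end_fst e : isend e -> exists i, fst_at e.2 e.1.2 i e.1.1.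
Proof.
case/andP=> ne h; have au := ms_fix h.
case: (boolP (e.1.1 \in vsX)) => hv.
  have [i r1 f1] : exists2 i0, refl_at io e.2 e.1.2 i0 e.1.1 & forall r, r < i0 -> ~ refl_at io e.2 e.1.2 r e.1.1.
    by apply: (first_refl ioK (W := vsX)) => // j; exact: alt_vs.
  by exists i.
by exists 0; split=> //; rewrite /refl_at /=; apply: ms_fix; exact: (ms_vs).
Qed.

Lemma end_root e i : isend e -> fst_at e.2 e.1.2 i e.1.1 ->
  ~~ ms (lt_ e.2 e.1.2 i) (alt io e.2 e.1.2 i e.1.1) ->
  root e (alt io e.2 e.1.2 i e.1.1) (lt_ e.2 e.1.2 i) (lt_ e.1.2 e.2 i) i.
Proof.
case/andP=> ne h f nm; have [h1 h2 h3 h4] := fst_rev ioK f; have [_ r1 _] := f.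
split=> //; first by apply/lpP.
- by rewrite /lt_; case: odd; rewrite // eq_sym.
- by rewrite h3 h2.
by rewrite h2 h3 h4; case: e {ne h f nm h1 h2 h3 h4 r1} => [[]].
Qed.

Lemma con_root p s t q l e i : root e p s t i -> cnX p s t q l -> q <> p ->
  exists e' i', root e' q (lt_ s t l) (lt_ t s l) i'.
Proof.
move=> r K qp; have [st lps lq _ K'] := v_wfc vX K.
have [iq nq] := (lpP _ _).1 lq; have [_ vq] := cn_vs K.
have [i' r1 f1] : exists2 i0, refl_at io (lt_ t s l) (lt_ s t l) i0 q & forall r, r < i0 -> ~ refl_at io (lt_ t s l) (lt_ s t l) r q.
  by apply: (first_refl ioK (W := vsX)) => // j; exact: alt_vs.
have f' : fst_at (lt_ t s l) (lt_ s t l) i' q by [].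
eexists; exists i'; split; last by reflexivity.
- exact: lq.
- by rewrite /lt_; case: odd; rewrite // eq_sym.
- exact: f'.
apply: (con_ms K') => //; by move=> E; apply: qp.
Qed.

Lemma gap_ex e : isend e -> exists e' g, gap e e' g.
Proof.
move=> he; have [i f] := end_fst he.
case: (boolP (ms (lt_ e.2 e.1.2 i) (alt io e.2 e.1.2 i e.1.1))) => nm.
  by eexists; eexists; apply: gap_free f nm.
have := end_root he f nm; set p := alt _ _ _ _ _; set s := lt_ e.2 _ _; set t := lt_ e.1.2 _ _ => r.
case: (pselect (exists q l, cnX p s t q l /\ q <> p)) => [[q [l [K qp]]]|no].
  have [e' [i' r']] := con_root r K qp.
  by exists e'; eexists; apply: gap_con r K qp r'.
(* The shortest period in force at p is chosen; [2 * m s t] is always available. *)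
have ex : exists l, `[< l = 2 * m s t \/ cnX p s t p l >].
  by exists (2 * m s t); apply/asboolP; left.
case: (ex_minnP ex) => l /asboolP hl lmin.
exists e; eexists; apply: (gap_self r _ hl) => q l' K.
have qp : q = p by apply: contrapT => qp; apply: no; exists q, l'.
by split=> //; apply/lmin/asboolP; right; rewrite qp in K.
Qed.

Lemma cn_le p s t q l : cnX p s t q l -> l <= 2 * m s t.
Proof.
by move=> K; have [_ _ _ [i <- _] _] := v_wfc vX K; rewrite leq_pmull // expn_gt0.
Qed.

(** Together with [gap_sym] this makes any choice of gaps an involutive pairing: the gap chosen at
    the partner must be the same one reversed. *)
Lemma gap_uniq e e1 g1 e2 g2 : gap e e1 g1 -> gap e e2 g2 -> e1 = e2 /\ g1 = g2.
Proof.
have fr i p s t i' : fst_at e.2 e.1.2 i e.1.1 -> ms (lt_ e.2 e.1.2 i) (alt io e.2 e.1.2 i e.1.1) ->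
    root e p s t i' -> False.
  move=> f nm r; have [f' _ _ _] := root_fst r; have := root_not_ms r.
  by rewrite -(fst_uniq f f') nm.
case=> [i f nm|p s t i l r lmin hl|p s t i q l e' i' r K qp r'];
case=> [j f' nm'|p0 s0' t0 j l0 r0 lmin' hl'|p0 s0' t0 j q0 l0 e0 j' r0 K' qp' r0'].
- by rewrite (fst_uniq f f').
- by case: (fr _ _ _ _ _ f nm r0).
- by case: (fr _ _ _ _ _ f nm r0).
- by case: (fr _ _ _ _ _ f' nm' r).
- have [E1 E2 E3 E4] := root_uniq r r0; subst p0 s0' t0 j.
  suff -> : l = l0 by [].
  apply/eqP; rewrite eqn_leq; apply/andP; split.
    case: hl' => [->|/lmin[] //]; case: hl => [->//|/cn_le //].
  case: hl => [->|/lmin'[] //]; case: hl' => [->//|/cn_le //].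
- have [E1 E2 E3 E4] := root_uniq r r0; subst p0 s0' t0 j.
  by have [] := lmin _ _ K'.
- by case: (fr _ _ _ _ _ f' nm' r).
- have [E1 E2 E3 E4] := root_uniq r r0; subst p0 s0' t0 j.
  by have [] := lmin' _ _ K.
have [E1 E2 E3 E4] := root_uniq r r0; subst p0 s0' t0 j.
have [r2 _] := reducedX.
have [ll qq] : l = l0 /\ q = q0.
  case: (ltngtP l l0) => h; last by split=> //; have [] := r2 _ _ _ _ _ _ _ K K' => // [|h1 _]; [rewrite h|exact: h1].
    by have [_ /(_ h)] := r2 _ _ _ _ _ _ _ K' K (ltnW h).
  by have [_ /(_ h)] := r2 _ _ _ _ _ _ _ K K' (ltnW h).
subst l0 q0; have [-> ->] := root_det r' r0'; by [].
Qed.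

Lemma gap_end e e' g : isend e -> gap e e' g -> isend e'.
Proof.
move=> he [i f nm|//|p s t i q l e0 i' _ _ _ /root_end //].
by case/andP: he => ne _; rewrite /is_end nm /= andbT /lt_; case: odd; rewrite // eq_sym.
Qed.

Lemma gap_sym e e' g : isend e -> gap e e' g -> gap e' e g.
Proof.
move=> he [i f nm|p s t i l r h1 h2|p s t i q l e0 i' r K qp r'].
- have [h1 h2 h3 h4] := fst_rev ioK f.
  have mm : 2 * m (oth e i).1.2 (oth e i).2 = 2 * m e.1.2 e.2 by rewrite /= /lt_; case: odd; rewrite // msym.
  have ee : oth (oth e i) i = e by rewrite /oth_end /= h2 h3 h4; case: (e) => [[]].
  have := @gap_free (oth e i) i; rewrite ee mm; apply=> //=; rewrite h3 h2; by case/andP: he.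
- exact: gap_self r h1 h2.
have [st lps lq _ K'] := v_wfc vX K.
rewrite subnAC; apply: (gap_con r' K') => [E|]; first by apply: qp.
by rewrite !lt_lt.
Qed.

Lemma self_bound e p s t i l : root e p s t i -> (forall q l', cnX p s t q l' -> q = p /\ l <= l') ->
  l = 2 * m s t \/ cnX p s t p l -> ~~ odd l /\ 2 * i.+1 + 2 <= l.
Proof.
move=> r lmin hl; have [lps st f nm _] := r.
have ol : ~~ odd l by case: hl => [->|/cn_even]; [rewrite oddM|apply; [exact: f|exact: nm]].
split=> //; have E : l = 2 * l./2 by rewrite mul2n even_halfK.
have {hl}[j hj dj] : exists2 j, 2 ^ j * l = 2 * m s t & nlc esX + j + 1 <= V0 vsX esX + k.
  case: hl => [->|K]; first by exists 0; rewrite ?mul1n // addn0; exact: (v_nlc vX).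
  have [_ _ _ [j hj _] _] := v_wfc vX K; exists j => //.
  by have := weakX K hj; rewrite eqxx.
suff : i + 2 <= l./2 by rewrite {2}E; clear; lia.
apply: (self_seg lps st f (i := j)) => //; first by rewrite -E.
by move=> q l' /lmin; rewrite -E.
Qed.

Lemma con_bound e p s t i q l e' i' : root e p s t i -> cnX p s t q l -> q <> p ->
  root e' q (lt_ s t l) (lt_ t s l) i' -> i + i' + 5 <= l.
Proof.
by move=> [_ _ f _ _] K qp [_ _ f' _ _]; exact: (con_seg K qp f f').
Qed.

Lemma free_bound e i : isend e -> fst_at e.2 e.1.2 i e.1.1 ->
  ms (lt_ e.2 e.1.2 i) (alt io e.2 e.1.2 i e.1.1) -> i + 4 <= 2 * m e.1.2 e.2.
Proof.
move=> /andP[ne h] f nm; case: (boolP (e.1.1 \in vsX)) => hv.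
  have [_ r1 f1] := f; exact: (no_loop_seg hv ne h r1 f1).
have [_ _ f1] := f; have -> : i = 0.
  case: (posnP i) => // /f1 []; rewrite /refl_at /=; apply: ms_fix; exact: (ms_vs).
have := mbig ne; have : 0 < 2 ^ n by rewrite expn_gt0.
by move: (m e.1.2 e.2) (2 ^ n) => x y; clear; lia.
Qed.

Lemma gap_fixed e e' g : isend e -> gap e e' g -> e' = e -> ~~ odd g /\ 2 <= g.
Proof.
move=> he [i f nm|p s t i l r h1 h2|p s t i q l e0 i' r K qp r'] E.
- exfalso; have [bv _ f1] := f; case: (posnP i) => [i0|i0].
    by move: he; rewrite /is_end -{2}E i0 /= eqxx.
  have [] := fst_dis ioK f (j := 0) (r := i); first by apply/andP.
  by have := congr1 (fun x : opend => x.1.1) E; rewrite /oth_end /= => ->.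
- have [ol lb] := self_bound r h1 h2; split; last by move: lb; clear; lia.
  by rewrite oddB ?oddM //; first rewrite (negPf ol); move: lb; clear; lia.
by case: qp; rewrite E in r'; have [->] := root_uniq r r'.
Qed.

Lemma gap_ne e e' g : isend e -> gap e e' g -> e' <> e -> 3 <= g.
Proof.
move=> he [i f nm|p s t i l r h1 h2|p s t i q l e0 i' r K qp r'] ne //.
  by have := free_bound he f nm; clear; lia.
by have := con_bound r K qp r'; clear; lia.
Qed.

Lemma gap_labels e e' g : isend e -> gap e e' g ->
  e'.1.2 = lt_ e.1.2 e.2 g /\ e'.2 = lt_ e.2 e.1.2 g.
Proof.
move=> he [i f nm|p s t i l r h1 h2|p s t i q l e0 i' r K qp r'].
- have b := free_bound he f nm; rewrite /= /lt_ oddB ?oddM /=; last by move: b; clear; lia.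
  by case: odd.
- have [ol lb] := self_bound r h1 h2; rewrite /lt_ oddB ?oddM ?(negPf ol) //.
  by move: lb; clear; lia.
have b := con_bound r K qp r'; have [_ _ _ _ ->] := r; have [_ _ _ _ ->] := r'.
rewrite /= /lt_ -subnDA oddB; last by move: b; clear; lia.
by rewrite oddD /=; case: odd; case: odd; case: odd.
Qed.

(** The walk takes i steps to the loop, one at the loop and i back. *)
Lemma root_stuck e p s t i : isend e -> root e p s t i ->
  stuck e (2 * i).+1 /\ oth e (2 * i).+1 = e.
Proof.
move=> /andP[ne h] r; have [f _ _ _] := root_fst r; have nm := root_not_ms r.
have [bv r1 f1] := f.
have o1 (a b : S) : lt_ a b (2 * i).+1 = b by rewrite /lt_ /= oddM.
have back j : j <= i -> alt io e.2 e.1.2 (i.+1 + j) e.1.1 = alt io e.2 e.1.2 (i - j) e.1.1.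
  by move=> ji; apply: alt_bounce.
have back0 : alt io e.2 e.1.2 (2 * i).+1 e.1.1 = e.1.1.
  by have := back i (leqnn i); rewrite subnn addSn addnn -mul2n.
have nms j : j < i -> ~~ ms (lt_ e.2 e.1.2 j) (alt io e.2 e.1.2 j e.1.1).
  by move=> /f1 hj; apply/negP => /ms_fix; exact: hj.
split; last by rewrite /oth_end back0 !o1; case: (e) => [[]].
split; last by rewrite back0 o1.
move=> j ji; case: (ltngtP j i) => [/nms //|ij|->//].
have jj : j = i.+1 + (j - i.+1) by rewrite subnKC.
have ii : j - i.+1 < i by move: ji ij; clear; lia.
have ss : i - (j - i.+1) = (i - (j - i.+1)).-1.+1 by move: ij ii; clear; lia.
rewrite jj back ?(ltnW ii) //.
have -> : lt_ e.2 e.1.2 (i.+1 + (j - i.+1)) = lt_ e.2 e.1.2 (i - (j - i.+1)).-1.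
  move: ii; move: (j - i.+1) => x xi; have E : i = x + (i - x).-1.+1 by move: xi; clear; lia.
  rewrite {1}E; move: (i - x).-1 => y; rewrite /lt_ /= !oddD /=.
  by case: (odd x); case: (odd y).
rewrite {2}ss altS (ms_io ioK (@ms_fix)); apply: nms; move: ii ij; clear; lia.
Qed.

Lemma gap_closing pt g e : (forall e, isend e -> gap e (pt e) (g e)) -> isend e ->
  exists2 N, stuck e N &
  (pt (oth e N) = e /\ N.+1 + g (oth e N) %| 2 * m e.1.2 e.2) \/
  (exists2 N', stuck (pt (oth e N)) N' &
     pt (oth (pt (oth e N)) N') = e /\
     (N.+1 + g (oth e N)) + (N'.+1 + g (oth (pt (oth e N)) N'))
       %| 2 * m e.1.2 e.2).
Proof.
move=> hF he; have G := hF e he; have he' := gap_end he G.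
have G' := hF _ he'; have [ptK gg] := gap_uniq G' (gap_sym he G).
case: {-1}(pt e) {-1}(g e) / G (erefl (pt e)) (erefl (g e)) => [i f nm|p s t i l r h1 h2|p s t i q l e0 i' r K qp r'] Ee Eg.
- have b := free_bound he f nm; exists i.
    split=> // j ji; have [_ _ f1] := f; apply/negP => /ms_fix; exact: (f1 j ji).
  left; rewrite -Ee ptK gg Eg; split=> //.
  by rewrite subnKC //; move: b; clear; lia.
- have [st oe] := root_stuck he r; exists (2 * i).+1 => //; left.
  have [ol lb] := self_bound r h1 h2.
  rewrite oe; split=> //; rewrite Eg.
  have -> : (2 * i).+2 + (l - 2 * i.+1) = l by move: lb; clear; lia.
  have [_ _ f _ ->] := r; rewrite /=.
  have -> : m (lt_ t s i) (lt_ s t i) = m s t by rewrite /lt_; case: odd; rewrite // msym.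
  case: h2 => [->//|K]; have [_ _ _ [j <- _] _] := v_wfc vX K; exact: dvdn_mull.
have [st oe] := root_stuck he r; have [st' oe'] := root_stuck (root_end r') r'.
exists (2 * i).+1 => //; right; rewrite oe Ee; exists (2 * i').+1 => //.
rewrite oe' -Ee ptK gg Eg; split=> //.
have b := con_bound r K qp r'.
(* Each segment and the gap are traversed twice, [2 * l] steps in all; this divides [2 * m s t]
   because the exponent of a constraint between different vertices is positive. *)
have -> : (2 * i).+2 + (l - i.+1 - i'.+1) + ((2 * i').+2 + (l - i.+1 - i'.+1)) = 2 * l by move: b; clear; lia.
have [_ _ f _ ->] := r; rewrite /=.
have -> : m (lt_ t s i) (lt_ s t i) = m s t by rewrite /lt_; case: odd; rewrite // msym.
have [_ _ _ [j <- /orP[j0|/eqP E]] _] := v_wfc vX K; last by case: qp.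
by rewrite -(prednK j0) expnSr -mulnA dvdn_mull.
Qed.

Lemma embedX : exists (Y : Type) (act : S -> Y -> Y) (f : nat -> Y), [/\ Wset m act,
  (forall s v, ~~ ms s v -> f (io s v) = act s (f v)),
  (forall s v, ms s v -> act s (f v) <> f v) &
  forall e e' g, isend e -> gap e e' g -> alt act e.1.2 e.2 g.+1 (f e.1.1) = f e'.1.1].
Proof.
have /choice[F hF] : forall e, exists z : opend * nat, isend e -> gap e z.1 z.2.
  move=> e; case: (boolP (isend e)) => [/gap_ex[e' [g G]]|_]; first by exists (e', g).
  by exists (e, 0).
pose pt e := (F e).1; pose g e := (F e).2.
have G e : isend e -> gap e (pt e) (g e) by exact: hF.
have pt_end e : isend e -> isend (pt e) by move=> he; exact: gap_end (G e he).
have sym e : isend e -> pt (pt e) = e /\ g (pt e) = g e.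
  move=> he; exact: gap_uniq (G _ (pt_end e he)) (gap_sym he (G e he)).
have m3 s t : s != t -> 3 <= m s t.
  by move/mbig; apply: leq_trans; rewrite -[3]muln1 leq_mul // expn_gt0.
have gs e : isend e -> pt e = e -> ~~ odd (g e) /\ 2 <= g e by move=> he; exact: (gap_fixed he (G e he)).
have gn e : isend e -> pt e <> e -> 3 <= g e by move=> he; exact: (gap_ne he (G e he)).
have ga e : isend e -> (pt e).1.2 = lt_ e.1.2 e.2 (g e) by move=> he; case: (gap_labels he (G e he)).
have gb e : isend e -> (pt e).2 = lt_ e.2 e.1.2 (g e) by move=> he; case: (gap_labels he (G e he)).
have [Y [act [f [h1 h2 h3 h4]]]] := embed msym m3 ioK (@ms_fix) pt_end
  (fun e he => (sym e he).1) (fun e he => (sym e he).2) gs gn ga gb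
  (fun e he => gap_closing G he) (closedX).
exists Y, act, f; split=> // e e' g' he G'.
by have [<- <-] := gap_uniq (G e he) G'; exact: h4.
Qed.

(** * Constraints in the completion, and the end of the argument *)

Lemma pow_dvd_lt a b L l M : 2 ^ a * L = M -> 2 ^ b * l = M -> 0 < M -> L < l -> 2 * L %| l.
Proof.
move=> hL hl M0 Ll; have L0 : 0 < L by move: M0; rewrite -hL muln_gt0 => /andP[].
have ba : b < a.
  rewrite ltnNge; apply/negP => ab.
  have := ltn_mul2l (2 ^ a) L l; rewrite expn_gt0 Ll /= hL -hl ltnNge leq_mul2r => /negP[].
  by rewrite leq_exp2l // ab orbT.
have : 2 ^ b * l = 2 ^ b * (2 ^ (a - b).-1 * (2 * L)).
  rewrite [2 ^ _ * (2 * L)]mulnA -expnSr prednK ?subn_gt0 // mulnA -expnD subnKC ?(ltnW ba) //.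
  by rewrite hL hl.
move/eqP; rewrite eqn_pmul2l ?expn_gt0 // => /eqP->.
exact: dvdn_mull.
Qed.

(** As s fixes y, returning after [L - 1] letters is the same as returning after L, with L even;
    periods of that kind pass to multiples. *)
Lemma alt_dvd (Y : Type) (act : S -> Y -> Y) s t y L l : (forall s, involutive (act s)) ->
  act s y = y -> ~~ odd L -> 0 < L -> alt act t s L.-1 y = y -> L %| l -> 0 < l ->
  alt act t s l.-1 y = y.
Proof.
move=> aK sy oL L0 hL /dvdnP[q ->] l0.
have per0 : alt act t s L y = y.
  rewrite -(prednK L0) altS hL; have -> : lt_ t s L.-1 = s; last by [].
  by rewrite /lt_; move: oL; rewrite -{1}(prednK L0) /= negbK => ->.
have perq : alt act t s (q * L) y = y.
  by elim: q {l0} => // q IH; rewrite mulSn altD per0 /lt_ (negPf oL).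
apply: (inv_inj (aK s)); rewrite sy -{2}perq -{2}(prednK l0) altS; congr (act _ _).
have : ~~ odd (q * L) by rewrite oddM (negPf oL) andbF.
by rewrite -{1}(prednK l0) /lt_ /= negbK => ->.
Qed.

(** The gaps build in only the constraints they select. Any other at the same segment is longer and
    leads back to p, and its length is a multiple of the selected period: l1 for [gap_self],
    [2 * l1] for [gap_con], where the walk turns round at the loop of the far vertex. If p carries
    both loops, nothing is to be shown. *)
Lemma embed_cn (Y : Type) (act : S -> Y -> Y) (f : nat -> Y) : Wset m act ->
  (forall s v, ~~ ms s v -> f (io s v) = act s (f v)) ->
  (forall e e' g, isend e -> gap e e' g -> alt act e.1.2 e.2 g.+1 (f e.1.1) = f e'.1.1) ->
  cn_ok act f cnX.
Proof.
move=> [aK _] hio hg p s t q l K; have [st lps lq [j hj _] K'] := v_wfc vX K.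
have [np ip] := (lpP _ _).1 lps; have [vp vq] := cn_vs K.
have fp : act s (f p) = f p by rewrite -(hio _ _ np) ip.
have l0 := cn_len K; have M0 : 0 < 2 * m s t by rewrite muln_gt0 (m_pos).
have [r2 r3] := reducedX.
have [i f1] : exists i, fst_at t s i p.
  have [i r1 f1] : exists2 i0, refl_at io t s i0 p & forall r, r < i0 -> ~ refl_at io t s r p.
    by apply: (first_refl ioK (W := vsX)) => // j1; exact: alt_vs.
  by exists i.
case: (boolP (ms (lt_ t s i) (alt io t s i p))) => nm; last first.
  have [_ r1 fst] := f1; have i0 := two_loops lps st r1 fst nm.
  have lpt : lp esX p t by apply/lpP; move: nm r1; rewrite i0.
  have -> : q = p by exact: (r3 _ _ _ _ _ K).
  rewrite alt_fix //; by have [nt it] := (lpP _ _).1 lpt; rewrite -(hio _ _ nt) it.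
have walk a b i0 v : fst_at a b i0 v -> f (alt io a b i0 v) = alt act a b i0 (f v).
  move=> [_ _ fst]; apply: (@walk_up _ _ act a b (fun j => f (alt io a b j v)) i0) => r ri.
  rewrite altS hio //; apply/negP => /ms_fix; exact: fst.
pose e : opend := (alt io t s i p, lt_ t s i, lt_ s t i).
have r : root e p s t i by [].
have he := root_end r; have [e' [g G]] := gap_ex he.
have fu : f e.1.1 = alt act t s i (f p) by exact: walk.
have H := hg _ _ _ he G; case: G H => [i0 f0 nm0|p1 s1 t1 i1 l1 r1 lmin hl|p1 s1 t1 i1 q1 l1 e1 i2 r1 K1 qp1 r'].
- have [f' _ _ _] := root_fst r; have := root_not_ms r.
  by rewrite -(fst_uniq f0 f') nm0.
- have [E1 E2 E3 E4] := root_uniq r r1; subst p1 s1 t1 i1.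
  rewrite fu /= => H; have [ol lb] := self_bound r1 lmin hl.
  have [-> ll] := lmin _ _ K.
  have L0 : 0 < l1 by move: lb; clear; lia.
  have hl1 : alt act t s l1.-1 (f p) = f p.
    have E : l1.-1 = i + (l1 - 2 * i.+1).+1 + i by move: lb; clear; lia.
    rewrite E !altD [alt _ _ _ _ (alt _ _ _ i _)]H.
    have -> : lt_ t s (i + (l1 - 2 * i.+1).+1) = lt_ s t i.
      by rewrite /lt_ oddD /= oddB ?oddM ?(negPf ol) /=; [case: odd|move: lb; clear; lia].
    have -> : lt_ s t (i + (l1 - 2 * i.+1).+1) = lt_ t s i.
      by rewrite /lt_ oddD /= oddB ?oddM ?(negPf ol) /=; [case: odd|move: lb; clear; lia].
    by rewrite alt_back // subnn.
  apply/esym; apply: (alt_dvd aK fp ol L0 hl1 _ l0).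
  move: ll; rewrite leq_eqVlt => /orP[/eqP->//|ll].
  have [j1 hj1] : exists j1, 2 ^ j1 * l1 = 2 * m s t.
    case: hl => [->|K1]; first by exists 0; rewrite mul1n.
    by have [_ _ _ [j1 hj1 _] _] := v_wfc vX K1; exists j1.
  exact: dvdn_trans (dvdn_mull _ (dvdnn _)) (pow_dvd_lt hj1 hj M0 ll).
have [E1 E2 E3 E4] := root_uniq r r1; subst p1 s1 t1 i1.
have [_ lq1 f2 nm2 E] := r'; have b := con_bound r1 K1 qp1 r'.
rewrite fu E /= (walk _ _ _ _ f2) => H.
have [_ _ _ [j1 hj1 _] K1'] := v_wfc vX K1.
have fq : f q1 = alt act t s l1.-1 (f p).
  have E' : l1.-1 = i + (l1 - i.+1 - i2.+1).+1 + i2 by move: b; clear; lia.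
  rewrite E' !altD [alt _ _ _ _ (alt _ _ _ i _)]H.
  have -> : lt_ t s (i + (l1 - i.+1 - i2.+1).+1) = lt_ (lt_ s t l1) (lt_ t s l1) i2.
    rewrite /lt_ oddD /= -subnDA oddB ?oddD /=; last by move: b; clear; lia.
    by case: odd; case: odd; case: odd.
  have -> : lt_ s t (i + (l1 - i.+1 - i2.+1).+1) = lt_ (lt_ t s l1) (lt_ s t l1) i2.
    rewrite /lt_ oddD /= -subnDA oddB ?oddD /=; last by move: b; clear; lia.
    by case: odd; case: odd; case: odd.
  by rewrite alt_back // subnn.
have [qp|qp] := eqVneq q p; last first.
  case: (ltngtP l l1) => ll; last by have [|h _] := r2 _ _ _ _ _ _ _ K K1; [rewrite ll|rewrite h // ll].
    by have [_ /(_ ll) h] := r2 _ _ _ _ _ _ _ K1 K (ltnW ll); case: qp1.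
  by have [_ /(_ ll) h] := r2 _ _ _ _ _ _ _ K K1 (ltnW ll); move: qp; rewrite h eqxx.
rewrite qp in K *; apply/esym.
have ll : l1 < l.
  rewrite ltnNge; apply/negP => ll; have [h1 h2] := r2 _ _ _ _ _ _ _ K1 K ll.
  by case: qp1; move: ll; rewrite leq_eqVlt => /orP[/eqP/h1|/h2].
have l10 : 0 < l1 by move: b; clear; lia.
have e2 : ~~ odd (2 * l1) by rewrite oddM.
have p2 : 0 < 2 * l1 by rewrite muln_gt0.
apply: (alt_dvd aK fp e2 p2 _ (pow_dvd_lt hj1 hj M0 ll) l0).
have -> : (2 * l1).-1 = l1.-1.+1 + l1.-1 by move: l10; clear; lia.
rewrite alt_bounce // ?subnn // -fq.
have -> : lt_ t s l1.-1 = lt_ s t l1 by rewrite -{2}(prednK l10) ltS.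
have [_ lq' _ _ _] := v_wfc vX K1'; have [nq iq] := (lpP _ _).1 lq'.
by rewrite -(hio _ _ nq) iq.
Qed.

Lemma edge_adj (e : edge) : e \in esX -> adj e.1.1 e.1.2 e.2.
Proof. by move=> eE; have [_ _ le] := v_wf vX eE; rewrite adjE -eg_id. Qed.

Lemma no_missing v s : v \in vsX -> ~~ ms s v.
Proof.
move=> hv; have [Y [act [f [W h1 h2 h3]]]] := embedX; have [aK _] := W.
apply/negP => /h2; apply.
apply: (v_onto vX W _ (embed_cn W h1 h3)) => // e eE.
by have /adjP[nm E] := edge_adj eE; rewrite /ok -E h1.
Qed.

Lemma all_loops v s : v \in vsX -> lp esX v s.
Proof.
move=> hv; apply/lpP; split; first exact: no_missing.
have [r2 r3] := reducedX.
(* With nothing missing, [io] is an action on all of [nat]; numbers that are not vertices are fixed.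
   The identity map can therefore be tested against [v_onto]. *)
have W : Wset m io.
  split=> [|a b y ab]; first exact: ioK.
  case: (boolP (y \in vsX)) => hy.
    by apply: (closedX ab) => i; apply: no_missing; exact: alt_vs.
  by apply: alt_fix; apply: ms_fix; exact: (ms_vs).
apply: (v_onto vX W (f := id)) => // [e eE|p a b q l K].
  by have /adjP[_ E] := edge_adj eE; rewrite /ok -E.
have [ab lpa lq _ _] := v_wfc vX K; have [ip np] := (lpP _ _).1 lpa.
have [vp _] := cn_vs K.
have [i r1 f1] : exists2 i0, refl_at io b a i0 p & forall r, r < i0 -> ~ refl_at io b a r p.
  by apply: (first_refl ioK (W := vsX)) => // j; exact: alt_vs.
have i0 := two_loops lpa ab r1 f1 (no_missing _ (alt_vs _ _ _ vp)).
have lpb : lp esX p b by apply/lpP; split; [exact: no_missing|move: r1; rewrite i0].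
by rewrite (r3 _ _ _ _ _ K lpb) alt_fix //; have [] := (lpP _ _).1 lpb.
Qed.

End MinimalState.

Lemma no_valid (S : finType) (m : S -> S -> nat) k (X : state S) :
  (forall s t, m s t = m t s) -> (forall s t, s != t -> 6 * 2 ^ #|S| <= m s t) ->
  k < #|S| -> ~ valid m k X.
Proof.
move=> msym mbig kn; have [s0 _] : exists s0 : S, s0 \in S by apply/card_gt0P; exact: leq_ltn_trans kn.
move: {2}(mu X).+1 (ltnSn (mu X)) => N; elim: N X => // N IH X XN vX.
have Xmin (X' : state S) : valid m k X' -> mu X' < mu X -> False.
  by move=> v' lt; apply: (IH X') => //; exact: leq_trans lt _.
have lps := all_loops s0 msym mbig kn vX Xmin.
have : size [seq (v, s, v) | v <- vs X, s <- enum S] <= size (es X).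
  apply: uniq_leq_size.
    apply: allpairs_uniq; [exact: v_uniq vX|exact: enum_uniq|].
    by move=> [v s] [v' s'] _ _ /= [-> ->].
  by move=> e /allpairsP[[v s] /= [hv _ ->]]; exact: lps.
rewrite size_allpairs -cardE; have := v_size vX.
have : 0 < size (vs X) by case: (vs X) (v_ne vX).
move: kn; clear.
(* For a vertices, [n * a <= a + k - 1] with k < n would make [(n - 1) * (a - 1)] negative. *)
move: (size (vs X)) (size (es X)) #|S| => a b c; nia.
Qed.

(** * The rose of a family of words *)

Section Rose.
Variable S : eqType.
Local Notation edge := (edge S).

Fixpoint petal c N (u : seq S) : seq edge :=
  if u is s :: u' then
    if u' is [::] then [:: eg c s 0] else eg c s N :: petal N N.+1 u'
  else [::].

Fixpoint rose (us : seq (seq S)) : nat * seq edge :=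
  if us is u :: us' then
    ((rose us').1 + (size u).-1, petal 0 (rose us').1 u ++ (rose us').2)
  else (1, [::]).

Lemma petal_size c N u : size (petal c N u) = size u.
Proof. by elim: u c N => // s [|s' u] IH c N //=; rewrite IH. Qed.

Lemma petal_wf c N vv u : 0 \in vv -> c \in vv ->
  (forall v, N <= v < N + (size u).-1 -> v \in vv) -> wf_edges vv (petal c N u).
Proof.
elim: u c N => // s [|s' u] IH c N h0 hc hv e.
  by rewrite /= inE => /eqP->; exact: wf_eg.
have hN : N \in vv by apply: hv; rewrite leqnn /= addnS ltnS leq_addr.
rewrite inE => /orP[/eqP->|]; first exact: wf_eg.
apply: IH => // v /andP[v1 v2]; apply: hv; rewrite ltnW //=.
by rewrite addnS -addSn.
Qed.

Lemma petal_nl c N u : c < N -> 1 < size u -> all (@nl S) (petal c N u).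
Proof.
have step c' s s' N' u' : petal c' N' [:: s, s' & u'] = eg c' s N' :: petal N' N'.+1 (s' :: u') by [].
have tail c' N' u' : 0 < c' < N' -> all (@nl S) (petal c' N' u').
  elim: u' c' N' => // s [|s' u'] IH c' N' /andP[c0 cN].
    by rewrite /= eg_nl -lt0n c0.
  rewrite step; apply/andP; split; first by rewrite eg_nl neq_ltn cN.
  apply: IH.
  by rewrite ltnSn andbT (leq_ltn_trans _ cN).
case: u => // s [|s' u] // cN _.
rewrite step; apply/andP; split; first by rewrite eg_nl neq_ltn cN.
apply: tail.
by rewrite ltnSn andbT (leq_ltn_trans _ cN).
Qed.

Lemma rose_pos us : 0 < (rose us).1.
Proof. by elim: us => //= u us IH; rewrite addn_gt0 IH. Qed.

Lemma rose_wf us : wf_edges (iota 0 (rose us).1) (rose us).2.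
Proof.
elim: us => //= u us IH e; have h0 := rose_pos us.
rewrite mem_cat => /orP[] h.
  apply: (petal_wf _ _ _ h); rewrite ?mem_iota //= ?add0n ?addn_gt0 ?h0 //.
  by move=> v /andP[_ vN]; rewrite mem_iota.
have [h1 h2 ->] := IH e h; move: h1 h2; rewrite !mem_iota /= !add0n => h1 h2.
by split; rewrite ?ltn_addr.
Qed.

Lemma rose_size us : size (rose us).2 + 1 <= (rose us).1 + size us.
Proof.
elim: us => //= u us IH; rewrite size_cat petal_size.
by move: IH; clear; case: u => /= *; lia.
Qed.

Lemma looped_nl (E : seq edge) v : all (@nl S) E -> ~~ looped E v.
Proof.
move=> /allP h; apply/hasPn => e /h; rewrite /nl; apply: contra => /andP[/eqP-> /eqP->] //.
Qed.

Lemma rose_looped us v : 0 < v -> ~~ looped (rose us).2 v.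
Proof.
move=> v0; elim: us => //= u us IH; rewrite /looped has_cat negb_or IH andbT.
have h0 := rose_pos us.
case: u => // s [|s' u]; last by exact: (looped_nl v (@petal_nl 0 _ [:: s, s' & u] h0 isT)).
by case: (v) v0.
Qed.

(** A word with at least two letters adds one more non-loop edge than vertices; a one-letter word
    adds only a loop at 0. The [looped] term prepares for [V0], since 0 is the only vertex that may
    carry a loop. *)
Lemma rose_nlc us : nlc (rose us).2 + looped (rose us).2 0 + 1 <= (rose us).1 + size us.
Proof.
elim: us => //= u us IH; rewrite /nlc count_cat /looped has_cat; have h0 := rose_pos us.
case: u => [|s [|s' u]].
- by move: IH; rewrite /nlc /looped /=; clear; lia.
- move: IH; rewrite /nlc /looped /=; clear; case: has; lia.
have nl_ := @petal_nl 0 (rose us).1 [:: s, s' & u] h0 isT.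
have := looped_nl 0 nl_; rewrite /looped => /negPf ->.
move: nl_; rewrite all_count => /eqP ->; rewrite petal_size.
by move: IH; rewrite /nlc /looped /=; clear; case: has; lia.
Qed.

Lemma rose_V0 us : nlc (rose us).2 + 1 <= V0 (iota 0 (rose us).1) (rose us).2 + size us.
Proof.
have := rose_nlc us; rewrite /V0; have := rose_pos us.
have : forall v, 0 < v -> ~~ looped (rose us).2 v by exact: rose_looped.
case: (rose us) => [[|N] E] //= h _.
have -> : count (fun v => ~~ looped E v) (iota 1 N) = N.
  rewrite -[RHS](size_iota 1); apply/eqP; rewrite -all_count; apply/allP => v.
  by rewrite mem_iota => /andP[/h].
by case: looped => /=; clear; lia.
Qed.

Section Run.
Variables (Y : Type) (act : S -> Y -> Y).
Hypothesis aK : forall s, involutive (act s).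
Definition run (u : seq S) y := foldl (fun y s => act s y) y u.

Lemma petal_run f c N u : (forall e, e \in petal c N u -> ok act f e) -> 0 < size u ->
  run u (f c) = f 0.
Proof.
elim: u c N => // s [|s' u] IH c N h _.
  by rewrite /run /=; apply/esym/ok_eg => //; apply: h; rewrite mem_head.
have fN : f N = act s (f c) by apply/ok_eg => //; apply: h; rewrite mem_head.
rewrite -[LHS]/(run (s' :: u) (act s (f c))) -fN; apply: (IH N N.+1) => // e he.
by apply: h; rewrite in_cons he orbT.
Qed.

Lemma petal_fixed f c N u : (forall e, e \in petal c N u -> ok act f e) ->
  (forall s, act s (f c) = f c) -> forall v, N <= v < N + (size u).-1 -> f v = f c.
Proof.
elim: u c N => [|s [|s' u] IH] c N h fc v.
- by rewrite /= addn0 => /andP[/leq_ltn_trans h1 /h1]; rewrite ltnn.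
- by rewrite /= addn0 => /andP[/leq_ltn_trans h1 /h1]; rewrite ltnn.
have fN : f N = f c.
  by rewrite -(fc s); apply/ok_eg => //; apply: h; rewrite mem_head.
case/andP; rewrite leq_eqVlt => /orP[/eqP<- //|Nv] vN.
rewrite -fN; apply: (IH N N.+1).
- by move=> e he; apply: h; rewrite in_cons he orbT.
- by rewrite fN.
by rewrite Nv /= addSn -addnS.
Qed.

Lemma rose_run f us u : (forall e, e \in (rose us).2 -> ok act f e) -> u \in us ->
  run u (f 0) = f 0.
Proof.
elim: us => //= w us IH h; rewrite inE => /orP[/eqP->|]; last first.
  by apply: IH => e he; apply: h; rewrite mem_cat he orbT.
case: w h => // s w h; apply: (petal_run (N := (rose us).1)) => // e he.
by apply: h; rewrite mem_cat he.
Qed.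

Lemma rose_fixed f us : (forall e, e \in (rose us).2 -> ok act f e) ->
  (forall s, act s (f 0) = f 0) -> forall v, v < (rose us).1 -> f v = f 0.
Proof.
elim: us => [|u us IH] h f0 v; first by case: v.
case: (ltnP v (rose us).1) => [hv _|hv vN].
  by apply: IH => // e he; apply: h; rewrite mem_cat he orbT.
apply: (petal_fixed (u := u) (N := (rose us).1)) => //; last by rewrite hv.
by move=> e he; apply: h; rewrite mem_cat he.
Qed.
End Run.
End Rose.

(** Otherwise every equivariant map sends the vertex 0 of the rose to a fixed point, the petals
    transport this to all vertices, and the rose without constraints is valid. *)
Lemma words_bound (S : finType) (m : S -> S -> nat) (us : seq (seq S)) :
  (forall s t, m s t = m t s) -> (forall s t, s != t -> 6 * 2 ^ #|S| <= m s t) ->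
  size us < #|S| ->
  exists (Y : Type) (act : S -> Y -> Y) y s, [/\ Wset m act,
    forall u, u \in us -> run act u y = y & act s y <> y].
Proof.
move=> msym mbig kn; apply: contrapT => no.
apply: (@no_valid S m (size us) (State (iota 0 (rose us).1) (rose us).2 (fun _ _ _ _ _ => False))) => //.
split=> //=.
- exact: iota_uniq.
- by case: (rose us).1 (rose_pos us).
- exact: rose_wf.
- move=> Y act W f fe _ v; rewrite mem_iota add0n /= => hv s; have [aK _] := W.
  have f0 s' : act s' (f 0) = f 0.
    apply: contrapT => ne; apply: no; exists Y, act, (f 0), s'; split=> // u uus.
    exact: (rose_run aK fe).
  by rewrite (rose_fixed aK fe f0).
- by rewrite size_iota; exact: rose_size.
- exact: rose_V0.
by left.
Qed.

Local Open Scope classical_set_scope.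

(** * Coxeter groups *)

Section CoxeterAction.
Variables (S : finType) (M : S -> S -> option nat) (d : nat).
Hypothesis coxM : is_coxeter_matrix M.
Local Notation R := (coxeter_relators M).
Local Notation G := (coxeter_group M).

(** An infinite entry gives no relator, so it may be replaced by a finite number: sets satisfying
    the additional relation still carry an action of the Coxeter group. *)
Definition fin_entry s t := if M s t is Some m then m else d.

Variables (Y : Type) (act : S -> Y -> Y).
Hypothesis W : Wset fin_entry act.
Local Notation runw w := (run act (map fst w)).

Lemma run_cat (u v : seq S) y : run act (u ++ v) y = run act v (run act u y).
Proof. exact: foldl_cat. Qed.

Lemma run_alt s t q y : runw (flatten (nseq q [:: (s, true); (t, true)])) y = alt act s t (2 * q) y.
Proof.
by elim: q y => // q IH y; rewrite mulnS /= -IH.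
Qed.

Lemma run_eq u v : pres_eq R u v -> forall y, runw u y = runw v y.
Proof.
have [aK pr] := W; elim=> {u v} //.
- by move=> u v w _ h1 _ h2 y; rewrite h1.
- by move=> u u' v v' _ h1 _ h2 y; rewrite !map_cat !run_cat h1 h2.
- by move=> s b y; rewrite /run /= aK.
move=> r [s [t [q [Mst ->]]]] y; rewrite run_alt.
case: (eqVneq s t) => [st|st].
  have [M1 _ _] := coxM; move: Mst; rewrite st M1 => -[<-].
  by rewrite /= aK.
by have := pr _ _ y st; rewrite /fin_entry Mst.
Qed.

Definition stab y : set G := [set g : G | runw (repr g) y = y].

Lemma run_repr w y : runw (repr (pres_class R w)) y = runw w y.
Proof. by apply: run_eq; exact: pres_repr. Qed.

Lemma stab_subgroup y : is_subgroup (stab y).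
Proof.
have [aK _] := W; split; rewrite /stab /=.
- by rewrite run_repr.
- by move=> g h hg hh; rewrite run_repr map_cat run_cat hg hh.
move=> g hg; rewrite run_repr -{1}hg.
elim: (repr g) y {hg} => // -[s b] w IH y.
by rewrite -cat1s inv_word_cat !map_cat !run_cat IH /run /= aK.
Qed.

Lemma generates_fixed (A : set G) y : generates A ->
  (forall g, A g -> runw (repr g) y = y) -> forall s, act s y = y.
Proof.
move=> gA hA s; have : (smallest (@is_subgroup G) A) (pres_class R [:: (s, true)]) by rewrite gA.
move=> /(_ (stab y) (conj (stab_subgroup y) hA)).
by rewrite /stab /= run_repr.
Qed.
End CoxeterAction.

Lemma simple_generators (S : finType) (M : S -> S -> option nat) :
  generates [set pres_class (coxeter_relators M) [:: (s, true)] | s in [set: S]].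
Proof.
apply/seteqP; split=> // g _ H [[H1 HM HV] sub].
rewrite -(pres_reprK g); elim: (repr g) => [|[s b] w IH]; first exact: H1.
have cat_mul u v : pres_class (coxeter_relators M) (u ++ v) =
    pres_mul (pres_class _ u) (pres_class _ v).
  by apply/pres_classP/pres_sym/pres_cat; exact: pres_repr.
rewrite -cat1s cat_mul; apply: HM => //.
have Hs : H (pres_class _ [:: (s, true)]) by apply: sub; exists s.
case: b => //; suff -> : pres_class (coxeter_relators M) [:: (s, false)] =
    pres_inv (pres_class _ [:: (s, true)]) by exact: HV.
apply/pres_classP; set r := repr _.
have hr : pres_eq (coxeter_relators M) r [:: (s, true)] by exact: pres_repr.
rewrite -[X in pres_eq _ X _]cats0.
apply: pres_trans (pres_cat (pres_refl _ _) (pres_sym (pres_mulwV _ r))) _.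
rewrite catA -[X in pres_eq _ _ X]cat0s; apply: pres_cat (pres_refl _ _).
apply: pres_trans (pres_cat (pres_refl _ _) hr) _.
exact: (pres_cancel _ s false).
Qed.

Theorem theorem1 (S : finType) (n : nat) (M : S -> S -> option nat)
    (cardS : #|S| = n) (coxM : is_coxeter_matrix M)
    (large : forall s t : S, s != t -> entry_ge (M s t) (6 * 2 ^ n)) :
  has_rank (coxeter_group M) n.
Proof.
pose m := fin_entry M (6 * 2 ^ n).
have lower (A : set (coxeter_group M)) : generates A -> (`I_n #<= A)%card.
  move=> gA; case: (pselect (finite_set A)) => [[k Ak]|/infiniteP]; last first.
    by apply: card_le_trans; exact: subset_card_le.
  have [AI IA] := (card_eqPle _ _).1 Ak.
  apply: card_le_trans IA; rewrite card_le_II leqNgt; apply/negP => kn.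
  have /ocard_geP/surjPex[h hs] := AI.
  (* The enumeration h of A is partial; an index without value contributes the empty word, which
     fixes every point. *)
  pose us := [seq (if h i is Some g then map fst (repr g) else [::]) | i <- iota 0 k].
  have [s t|s t st||Y [act [y [s [W fix_ mov]]]]] := @words_bound S m us.
  - by rewrite /m /fin_entry; have [_ -> _] := coxM.
  - by rewrite cardS /m /fin_entry; have := large s t st; case: (M s t).
  - by rewrite /us size_map size_iota cardS.
  apply: mov; apply: (generates_fixed coxM W gA) => g Ag.
  have [i /= ik hi] : (h @` `I_k) (Some g) by apply: hs; exists g.
  apply: fix_; apply/mapP; exists i; first by rewrite mem_iota.
  by rewrite hi.
split=> //; exists [set pres_class (coxeter_relators M) [:: (s, true)] | s in [set: S]].
  exact: simple_generators.
(* That the simple generators are pairwise distinct is not proved directly: they generate, so the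
   lower bound applies to them, and only the upper bound remains. *)
apply/card_eqPle; split; last exact/lower/simple_generators.
pose g i := if nth None (map Some (enum S)) i is Some s then
  pres_class (coxeter_relators M) [:: (s, true)] else pres_one _.
apply: (card_le_trans (B := g @` `I_n)); last exact: card_image_le.
apply: subset_card_le => _ [s _ <-]; exists (index s (enum S)).
  by rewrite /= -cardS cardE index_mem mem_enum.
by rewrite /g (nth_map s) ?nth_index ?index_mem ?mem_enum.
Qed.
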